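(* Let $G$ be a finite abelian group of order $n$, let $S$ be the set of bijections $\{1,\dots,n\}\to G$ (viewed as elements of $G^n$, with pointwise addition), and let $f:\{1,\dots,n\}\to G$ be a function satisfying $\sum_{i=1}^n f(i)=\sum_{x\in G}x$. Then the number of triples $(\pi_1,\pi_2,\pi_3)\in S^3$ with $\pi_1+\pi_2+\pi_3=f$ is \[ (\mathfrak{S}(f)+o(1))\,\frac{n!^3}{n^{n-1}},\qquad\text{where}\qquad \mathfrak{S}(f)=\exp\Big(-\frac{1}{2n^2}\sum_{x\in G}|f^{-1}(x)|^2\Big), \] and $o(1)$ denotes a quantity tending to $0$ as $n\to\infty$, uniformly over all such $G$ and $f$.
   Context: Functions $\{1,\dots,n\}\to G$ are added pointwise. $f^{-1}(x)=\{i: f(i)=x\}$. *)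

(* Defs.v *)
From mathcomp Require Import all_boot all_algebra.
From Stdlib Require Import Reals.

Set Implicit Arguments.
Unset Strict Implicit.
Unset Printing Implicit Defensive.

Definition bijb (G : finType) (n : nat) (p : {ffun 'I_n -> G}) : bool :=
  injectiveb p && [forall x : G, exists i : 'I_n, p i == x].

Definition num_triples (G : finZmodType) (f : {ffun 'I_#|G| -> G}) : nat :=
  #|[set t : {ffun 'I_#|G| -> G} * {ffun 'I_#|G| -> G} * {ffun 'I_#|G| -> G} |
      [&& bijb t.1.1, bijb t.1.2, bijb t.2 &
          [forall i : 'I_#|G|, GRing.add (GRing.add (t.1.1 i) (t.1.2 i)) (t.2 i) == f i]]]|.

Definition fiber_sq_sum (G : finZmodType) (f : {ffun 'I_#|G| -> G}) : nat :=
  (\sum_(x : G) #|[set i : 'I_#|G| | f i == x]| ^ 2)%N.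

Definition frakS (G : finZmodType) (f : {ffun 'I_#|G| -> G}) : R :=
  exp (- (INR (fiber_sq_sum f) / (2 * (INR #|G|) ^ 2)))%R.

Definition main_term (n : nat) : R :=
  ((INR (n`!)) ^ 3 / (INR n) ^ (n - 1))%R.

Section SumCond.
Local Open Scope ring_scope.
Definition sum_cond (G : finZmodType) (f : {ffun 'I_#|G| -> G}) : Prop :=
  \sum_(i : 'I_#|G|) f i = \sum_(x : G) x.
End SumCond.

(* Main.v *)
(** Let [n = |G|], let [K] be the dual group of [G], and index the positions by
    [G] itself.  Write [P chi] for the average of [prod_i chi_i (s i)] over all
    permutations [s] of [G].  Fourier inversion on [G ^ n] gives
    [count / main_term = (1/n) * sum_chi P(chi)^3 * prod_i chi_i (- f i)], and the
    summand does not change when all the [chi_i] are multiplied by one character.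
    Hence the [chi] having a majority character contribute the sum over the [chi]
    whose support (the positions with [chi_i <> 1]) has size [m < n/2]; the others
    are an error term.

    - Moving the character of position [i] onto position [j] and summing over [j]
      gives [0].  This expresses [P chi] through supports of size [m-1] and [m-2].
      Squared, it yields an exact three-term recursion for the mass
      [sum |P chi|^2] over the supports of size [m]; cubed, it shows that the
      support-[m] part of the main sum satisfies, up to [o(1)], the recursion of the
      Taylor coefficients of [exp (- S)], where [S] is the exponent in [frakS].
    - A Hadamard-type bound for permanents (coefficient extraction from
      [prod_x sum_k y_k k(x)], then AM-GM and Parseval) gives
      [|P chi| <= (prod_k a_k! / n!) * prod_k (n / a_k)^(a_k / 2)], where [a_k] is
      the multiplicity of [k] in [chi].
    - For [m >> sqrt n], and without a majority character, the cubes of this bound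
      have a negligible sum.  For [M <= m << sqrt n], a [chi] taking at least [m/5]
      distinct nontrivial values is controlled by this sup bound times the mass, and
      a [chi] taking fewer values by summing the cubed bound. *)

From HB Require Import structures.
From mathcomp Require Import all_boot all_order all_fingroup all_algebra.
From mathcomp Require Import all_solvable all_field all_character ring lra zify.
From mathcomp Require Import boolp reals sequences exp complex.
From mathcomp Require Rstruct Rstruct_topology.
From mathcomp Require classical_sets topology normedtype.
Require Import Defs.

Set Implicit Arguments.
Unset Strict Implicit.
Unset Printing Implicit Defensive.
Import Order.TTheory GRing.Theory Num.Theory.
Local Open Scope ring_scope.

(** * Characters and averages over permutations *)

(** The dual group enters only through a perfect pairing: bimultiplicativity, unit modulus and the
    two orthogonality relations. The difficulty is that no single estimate covers all support sizes.
    The cubed recursion is approximate, with constants growing with [m], so it settles each fixed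
    [m] only. The cubed permanent bound loses a factor [1 + O(1 / sqrt n)] for each of the [n]
    characters, hence [exp(O(sqrt n))], which its exponential gain in [m] repays only beyond a large
    multiple of [sqrt n]. In between, a [chi] with [r] distinct nontrivial values has a spare factor
    [m ^ r] in the bound for [|P chi|^2]; if [r] is proportional to [m], this makes
    [sup |P| * sum |P|^2] small. If [r] is smaller, charging [n] per value present reduces the loss
    to a constant at the price [n ^ r]. Since [(m / n) ^ (m / 2)] is about [n ^ (- m / 4)] for [m]
    near [sqrt n], the proportion [r / m] has to stay below 1/4, whence 1/5. *)

Record pairing (C : numClosedFieldType) (G K : finZmodType) := Pairing {
  pair_fun :> K -> G -> C;
  pairDl : forall k l x, pair_fun (k + l) x = pair_fun k x * pair_fun l x;
  pairDr : forall k x y, pair_fun k (x + y) = pair_fun k x * pair_fun k y;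
  norm_pair : forall k x, `|pair_fun k x| = 1;
  sum_pairr : forall k, k != 0 -> \sum_x pair_fun k x = 0;
  sum_pairl : forall x, x != 0 -> \sum_k pair_fun k x = 0 }.

Section Duality.
Variables (C : numClosedFieldType) (G K : finZmodType) (e : pairing C G K).
Implicit Types (k : K) (x y i j l : G) (chi : {ffun G -> K}).
Local Notation n := #|G|.

Lemma pair_neq0 k x : e k x != 0.
Proof. by rewrite -normr_eq0 norm_pair oner_eq0. Qed.

Lemma pair0l x : e 0 x = 1.
Proof. by apply: (mulfI (pair_neq0 0 x)); rewrite -pairDl addr0 mulr1. Qed.

Lemma pair0r k : e k 0 = 1.
Proof. by apply: (mulfI (pair_neq0 k 0)); rewrite -pairDr addr0 mulr1. Qed.

Lemma pairNl k x : e (- k) x = (e k x)^*.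
Proof.
apply: (mulfI (pair_neq0 k x)).
by rewrite -pairDl subrr pair0l -normCK norm_pair expr1n.
Qed.

Lemma pairNr k x : e k (- x) = (e k x)^*.
Proof.
apply: (mulfI (pair_neq0 k x)).
by rewrite -pairDr subrr pair0r -normCK norm_pair expr1n.
Qed.

Lemma pair_sumr (I : finType) (F : I -> G) k :
  e k (\sum_i F i) = \prod_i e k (F i).
Proof.
by apply: (big_morph (e k)) => [x y|]; rewrite ?pairDr ?pair0r.
Qed.

Lemma sum_pairrE k : \sum_x e k x = (k == 0)%:R * n%:R.
Proof.
have [->|/(sum_pairr e)->] := eqVneq k 0; last by rewrite mul0r.
by under eq_bigr do rewrite pair0l; rewrite sumr_const mul1r.
Qed.

(** The double sum of [e k x] equals [#|K|] or [n] according to which variable is summed first. *)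
Lemma card_dual : #|K| = n.
Proof.
apply/eqP; rewrite -(eqr_nat C); apply/eqP.
transitivity (\sum_k \sum_x e k x).
  rewrite exchange_big (bigD1 0) //= [X in _ + X]big1 => [|x /(sum_pairl e) //].
  by under eq_bigr do rewrite pair0r; rewrite sumr_const addr0.
rewrite (eq_bigr _ (fun k _ => sum_pairrE k)) (bigD1 0) //= eqxx mul1r big1.
  by rewrite addr0.
by move=> k /negPf->; rewrite mul0r.
Qed.

Lemma sum_pairlE x : \sum_k e k x = (x == 0)%:R * n%:R.
Proof.
have [->|/(sum_pairl e)->] := eqVneq x 0; last by rewrite mul0r.
by under eq_bigr do rewrite pair0r; rewrite sumr_const mul1r -card_dual.
Qed.

Lemma card_zmod_gt0 : (0 < n)%N.
Proof. by apply/card_gt0P; exists 0. Qed.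

Lemma natn_neq0 : n%:R != 0 :> C.
Proof. by rewrite pnatr_eq0 -lt0n card_zmod_gt0. Qed.

(** Up to the factor [n!], the permanent of the matrix with entries [e (chi i) x]. *)
Definition perm_avg chi : C :=
  (\sum_(s : {perm G}) \prod_i e (chi i) (s i)) / (n`!)%:R.

Definition supp chi : {set G} := [set i | chi i != 0].

(* [K] is written additively: the character at [i] is erased and multiplied onto
   the one at [j]; [untransfer] is the inverse operation when [chi i] is trivial. *)
Definition transfer chi i j : {ffun G -> K} :=
  [ffun l => (if l == i then 0 else chi l) + (if l == j then chi i else 0)].

Definition untransfer chi i j k : {ffun G -> K} :=
  [ffun l => chi l + (if l == i then k else 0) - (if l == j then k else 0)].

Lemma fact_neq0 m : (m`!)%:R != 0 :> C.
Proof. by rewrite pnatr_eq0 -lt0n fact_gt0. Qed.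

Lemma card_permG : #|{: {perm G}}| = n`!.
Proof.
rewrite -(cardsT G) -card_perm; apply: eq_card => s.
by rewrite !inE; apply/esym/subsetP => x _; rewrite inE.
Qed.

Lemma perm_avg_perm chi (s : {perm G}) : perm_avg [ffun i => chi (s i)] = perm_avg chi.
Proof.
congr (_ / _).
rewrite [RHS](reindex_inj (@mulgI _ (s^-1)%g)); apply: eq_bigr => t _ /=.
rewrite [RHS](reindex_inj (@perm_inj _ s)); apply: eq_bigr => i _ /=.
by rewrite ffunE permM permK.
Qed.

Lemma perm_avg0 : perm_avg 0 = 1.
Proof.
rewrite /perm_avg (eq_bigr (fun=> 1)) => [|s _]; last first.
  by rewrite big1 // => i _; rewrite ffunE pair0l.
by rewrite sumr_const card_permG divff // fact_neq0.
Qed.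

Lemma prod_pair_pt (s : {perm G}) j k :
  \prod_l e (if l == j then k else 0) (s l) = e k (s j).
Proof.
rewrite (bigD1 j) //= eqxx big1 ?mulr1 // => l /negPf->.
by rewrite pair0l.
Qed.

(** For fixed [s] the target [j] enters only through [e (chi i) (s j)], and [s j] runs over all of
    [G]: orthogonality for the nontrivial character [chi i]. *)
Lemma sum_perm_avg_transfer chi i : chi i != 0 -> \sum_j perm_avg (transfer chi i j) = 0.
Proof.
move=> ci0; rewrite -mulr_suml exchange_big big1 ?mul0r // => s _ /=.
under eq_bigr => j _.
  under eq_bigr do rewrite ffunE pairDl.
  rewrite big_split /= prod_pair_pt; over.
rewrite -mulr_sumr.
have -> : \sum_j e (chi i) (s j) = \sum_x e (chi i) x.
  by rewrite [RHS](reindex_inj (@perm_inj _ s)).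
by rewrite (sum_pairr e) // mulr0.
Qed.

(** Moving a character onto a trivial position merely exchanges two positions. *)
Lemma perm_avg_transfer0 chi i j : chi j = 0 -> perm_avg (transfer chi i j) = perm_avg chi.
Proof.
move=> cj0; rewrite -[RHS](perm_avg_perm chi (tperm i j)); congr perm_avg.
apply/ffunP => l; rewrite !ffunE.
have [->|lj] := eqVneq l j.
  by rewrite tpermR; case: eqP => [<-|_]; rewrite ?cj0 ?add0r ?addr0.
have [->|li] := eqVneq l i; first by rewrite tpermL cj0 addr0.
by rewrite addr0 tpermD // eq_sym.
Qed.

(** In the vanishing sum over targets, the [n - #|supp chi|] positions off the support and [i]
    itself each give back [perm_avg chi]; the other positions of the support are the right-hand
    side. *)
Lemma perm_avg_supp chi i : i \in supp chi ->
  (n - #|supp chi|).+1%:R * perm_avg chi = - \sum_(j in supp chi :\ i) perm_avg (transfer chi i j).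
Proof.
move=> si; have ci0 : chi i != 0 by rewrite inE in si.
apply/eqP; rewrite -addr_eq0; apply/eqP; rewrite -[RHS](sum_perm_avg_transfer ci0).
rewrite [RHS](bigID (mem (supp chi :\ i))) /= addrC; congr (_ + _).
rewrite (eq_bigr (fun=> perm_avg chi)) => [|j].
  rewrite sumr_const -[RHS]mulr_natl; congr (_ * _); congr _%:R.
  apply/eqP; rewrite -(eqn_add2l #|supp chi :\ i|) cardC.
  have := max_card (mem (supp chi)); rewrite (cardsD1 i (supp chi)) si => le_n.
  by rewrite addnS -addSn -add1n subnKC.
rewrite !inE negb_and !negbK => /orP[/eqP->|/eqP cj0]; last exact: perm_avg_transfer0.
congr perm_avg; apply/ffunP => l; rewrite ffunE.
by case: eqP => [->|]; rewrite ?add0r ?addr0.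
Qed.

(** The dual relation: [k] enters only through [e k (s i - s j)], and [s i != s j], so the sum over
    characters vanishes. *)
Lemma sum_perm_avg_untransfer chi i j : i != j -> \sum_k perm_avg (untransfer chi i j k) = 0.
Proof.
move=> ij; rewrite -mulr_suml exchange_big big1 ?mul0r // => s _ /=.
under eq_bigr => k _.
  have E l : untransfer chi i j k l = chi l + (if l == i then k else 0) +
      (if l == j then - k else 0).
    by rewrite ffunE; case: (l == j); rewrite ?subr0 ?addr0.
  under eq_bigr do rewrite E !pairDl.
  rewrite !big_split /= !prod_pair_pt -mulrA pairNl -pairNr -pairDr; over.
rewrite -mulr_sumr sum_pairl ?mulr0 // subr_eq0.
by rewrite (inj_eq (@perm_inj _ s)).
Qed.

Lemma perm_avg_trans chi k : perm_avg [ffun i => chi i + k] = perm_avg chi * e k (\sum_x x).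
Proof.
rewrite /perm_avg mulrAC; congr (_ / _); rewrite mulr_suml; apply: eq_bigr => s _.
under eq_bigr do rewrite ffunE pairDl.
rewrite big_split /= -pair_sumr; congr (_ * e k _).
by rewrite [RHS](reindex_inj (@perm_inj _ s)).
Qed.

Lemma transferK chi i j : i != j -> untransfer (transfer chi i j) i j (chi i) = chi.
Proof.
move=> ij; apply/ffunP => l; rewrite !ffunE.
have [->|li] := eqVneq l i; first by rewrite (negPf ij) !add0r subr0.
by case: (l == j); rewrite ?addr0 ?subr0 ?addrK.
Qed.

Lemma transfer_at chi i j : i != j -> transfer chi i j i = 0.
Proof. by move=> ij; rewrite ffunE eqxx (negPf ij) addr0. Qed.

Lemma untransfer_at chi i j k : i != j -> chi i = 0 -> untransfer chi i j k i = k.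
Proof. by move=> ij ci; rewrite ffunE eqxx (negPf ij) ci add0r subr0. Qed.

Lemma untransfer_at2 chi i j k : i != j -> untransfer chi i j k j = chi j - k.
Proof. by move=> ij; rewrite ffunE eqxx eq_sym (negPf ij) addr0. Qed.

Lemma untransferK chi i j k : i != j -> chi i = 0 -> transfer (untransfer chi i j k) i j = chi.
Proof.
move=> ij ci; apply/ffunP => l; rewrite ffunE untransfer_at // ffunE.
have [->|li] := eqVneq l i; first by rewrite (negPf ij) ci addr0.
by case: (l == j); rewrite ?addr0 ?subr0 ?subrK.
Qed.

Lemma sum_transfer (T : nmodType) i j (F : {ffun G -> K} -> T) : i != j ->
  \sum_chi F chi =
    \sum_(chi : {ffun G -> K} | chi i == 0) \sum_k F (untransfer chi i j k).
Proof.
move=> ij; rewrite pair_big_dep /=.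
rewrite (reindex_onto (fun p : {ffun G -> K} * K => untransfer p.1 i j p.2)
  (fun chi => (transfer chi i j, chi i))) /= => [|chi _]; last exact: transferK.
apply: eq_bigl => -[chi k] /=; rewrite andbT; apply/eqP/eqP => [[<- _]|ci].
  exact: transfer_at.
by rewrite untransferK // untransfer_at.
Qed.

(** The two excluded values of [k] are those for which [i] or [j] ends up trivial. *)
Lemma card_supp_untransfer chi i j k : i != j -> chi i = 0 -> k != 0 -> k != chi j ->
  #|supp (untransfer chi i j k)| = (#|supp chi| + 1 + (chi j == 0%R))%N.
Proof.
move=> ij ci k0 kj.
have -> : supp (untransfer chi i j k) = i |: (j |: supp chi).
  apply/setP => l; rewrite !inE ffunE.
  have [->|li] := eqVneq l i; first by rewrite (negPf ij) ci add0r subr0.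
  have [->|lj] := eqVneq l j; first by rewrite addr0 subr_eq0 eq_sym.
  by rewrite addr0 subr0.
rewrite !cardsU1 !inE (negPf ij) ci eqxx /= negbK.
by case: (chi j == 0); rewrite /= ?add0n ?addn0 ?addn1 ?add1n.
Qed.

End Duality.

(** * The mass of the supports of given size *)

(** Brings the sum over [chi] innermost, so that it can be reindexed for fixed positions [i] and
    [j]. *)
Lemma sum3_mkcond (T : nmodType) (I J L : finType) (P : pred I) (Q : I -> pred J)
    (S : I -> J -> pred L) (F : I -> J -> L -> T) :
  \sum_(a | P a) \sum_(b | Q a b) \sum_(c | S a b c) F a b c =
  \sum_b \sum_c \sum_a if [&& P a, Q a b & S a b c] then F a b c else 0.
Proof.
transitivity (\sum_a \sum_b \sum_c
    if [&& P a, Q a b & S a b c] then F a b c else 0).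
  rewrite big_mkcond; apply: eq_bigr => a _; case: (P a) => /=; last first.
    by rewrite big1 // => b _; rewrite big1.
  rewrite big_mkcond; apply: eq_bigr => b _; case: (Q a b) => /=.
    exact: big_mkcond.
  by rewrite big1.
rewrite exchange_big; apply: eq_bigr => b _; exact: exchange_big.
Qed.

Section Mass.
Variables (C : numClosedFieldType) (G K : finZmodType) (e : pairing C G K).
Implicit Types (k : K) (x y i j l : G) (chi : {ffun G -> K}).
Local Notation n := #|G|.

(* Reindexing by [chi' := transfer chi i j] and [k := chi i]: the support of [chi']
   is smaller by two if [chi i + chi j = 0], and by one otherwise. *)
Lemma sum_supp2 (T : nmodType) m (F : {ffun G -> K} -> G -> G -> T) :
  \sum_(chi | #|supp chi| == m.+2) \sum_(i in supp chi)
    \sum_(j in supp chi :\ i) F chi i j =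
  \sum_(chi : {ffun G -> K} | #|supp chi| == m) \sum_(i | i \notin supp chi)
    \sum_(j | (j \notin supp chi) && (j != i))
      \sum_(k | k != 0) F (untransfer chi i j k) i j
  + \sum_(chi : {ffun G -> K} | #|supp chi| == m.+1) \sum_(i | i \notin supp chi)
    \sum_(j in supp chi) \sum_(k | (k != 0) && (k != chi j)) F (untransfer chi i j k) i j.
Proof.
rewrite [LHS]sum3_mkcond [X in _ = X + _]sum3_mkcond [X in _ = _ + X]sum3_mkcond.
rewrite -big_split; apply: eq_bigr => i _.
rewrite -big_split; apply: eq_bigr => j _; rewrite -big_split /=.
have [->|ij] := eqVneq i j.
  rewrite !big1 ?addr0 // => chi _; rewrite !inE ?eqxx ?andbF //.
  by case: (chi j == 0); rewrite ?andbF addr0.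
rewrite (sum_transfer _ ij) big_mkcond; apply: eq_bigr => chi _ /=.
rewrite !inE !negbK /= andbT.
have [ci|_] := eqVneq (chi i) 0; last by rewrite !andbF /= !addr0.
rewrite /=.
have E k : (if [&& #|supp (untransfer chi i j k)| == m.+2,
       i \in supp (untransfer chi i j k) & j \in supp (untransfer chi i j k) :\ i]
    then F (untransfer chi i j k) i j else 0) =
  if (k != 0) && (k != chi j) && (#|supp chi| + 1 + (chi j == 0%R) == m.+2)
  then F (untransfer chi i j k) i j else 0.
  rewrite !inE untransfer_at // untransfer_at2 // subr_eq0 [chi j == k]eq_sym.
  rewrite [j == i]eq_sym ij /=.
  have [->|k0] /= := eqVneq k 0; first by rewrite !andbF.
  have [->|kj] /= := eqVneq k (chi j); first by rewrite !andbF.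
  by rewrite card_supp_untransfer // !andbT.
rewrite (eq_bigr _ (fun k _ => E k)) {E} -big_mkcond /=.
have -> : (#|supp chi| + 1 + (chi j == 0%R) == m.+2)%N =
    if chi j == 0 then #|supp chi| == m else #|supp chi| == m.+1.
  by case: (chi j == 0); rewrite !addn1 ?addn0 ?eqSS.
have [cj|cj] := eqVneq (chi j) 0; rewrite ?addr0 ?add0r ?andbT ?andbF /=.
  case: (_ == m); last by rewrite big_pred0 ?addr0 // => k; rewrite andbF.
  by rewrite addr0; apply: eq_bigl => k; rewrite cj andbT andbb.
rewrite add0r; case: (_ == m.+1); last by rewrite big_pred0 // => k; rewrite andbF.
by apply: eq_bigl => k; rewrite andbT.
Qed.

Definition mass p m : C := \sum_(chi | #|supp chi| == m) `|perm_avg e chi| ^+ p.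

Lemma perm_avg_untransfer_top chi i j : chi i = 0 -> i != j ->
  perm_avg e (untransfer chi i j (chi j)) = perm_avg e chi.
Proof.
move=> ci ij; rewrite -(perm_avg_transfer0 e j ci); congr perm_avg; apply/ffunP => l.
rewrite !ffunE; have [->|lj] := eqVneq l j.
  by rewrite eq_sym (negPf ij) addr0 subrr addr0.
by rewrite subr0.
Qed.

Lemma untransfer0 chi i j : untransfer chi i j 0 = chi.
Proof. by apply/ffunP => l; rewrite ffunE !if_same addr0 subr0. Qed.

Lemma card_notin_supp chi i : i \notin supp chi ->
  #|[pred j | (j \notin supp chi) && (j != i)]| = (n - #|supp chi|).-1.
Proof.
move=> si; rewrite -(cardsT G) -cardsDS ?subsetT // (cardsD1 i) inE si inE /=.
by apply: eq_card => j; rewrite !inE andbT andbC.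
Qed.

(** In [|P chi|^2] one factor is expanded by [perm_avg_supp] and the conjugate one is kept. After
    reindexing, the expanded factor is [P chi'], free of [k], while the kept one is summed over [k]
    and evaluated by [sum_perm_avg_untransfer]. The omitted values, [k = 0] and for a merger also
    [k = chi' j], each account for [- P chi']. This linearity in the kept factor is why the second
    moment obeys an exact recursion. *)
Lemma mass2_rec m : (m.+2 <= n)%N ->
  m.+2%:R * mass 2 m.+2 = (2 * m.+1)%:R * mass 2 m.+1 + (n - m)%:R * mass 2 m.
Proof.
(* This is the coefficient [n - (m + 2) + 1] of [perm_avg_supp] for supports of size [m + 2]. *)
move=> mn; have d0 : (n - m).-1%:R != 0 :> C.
  by rewrite pnatr_eq0 -lt0n -subnS subn_gt0.
apply: (mulfI d0).
have -> : (n - m).-1%:R * (m.+2%:R * mass 2 m.+2) =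
    - \sum_(chi | #|supp chi| == m.+2) \sum_(i in supp chi)
       \sum_(j in supp chi :\ i) (perm_avg e chi)^* * perm_avg e (transfer chi i j).
  rewrite -sumrN !mulr_sumr; apply: eq_bigr => chi /eqP sc.
  transitivity (\sum_(i in supp chi) (perm_avg e chi)^* * ((n - m).-1%:R * perm_avg e chi)).
    by rewrite sumr_const sc -mulr_natl normCK; ring.
  rewrite -sumrN; apply: eq_bigr => i si; rewrite -mulr_sumr -mulrN -perm_avg_supp //.
  by rewrite sc; congr (_ * (_%:R * _)); rewrite -subnS subnSK.
rewrite sum_supp2 opprD [RHS]mulrDr [RHS]addrC; congr (_ + _).
  rewrite -sumrN mulr_sumr mulr_sumr; apply: eq_bigr => chi /eqP sc.
  rewrite -sumrN; transitivity (\sum_(i | i \notin supp chi)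
     (n - m).-1%:R * `|perm_avg e chi| ^+ 2); last first.
    rewrite sumr_const; have -> : #|[pred i | i \notin supp chi]| = (n - m)%N.
      by rewrite -sc -(cardsT G) -cardsDS ?subsetT //; apply: eq_card => i; rewrite !inE andbT.
    by rewrite -mulr_natl; ring.
  apply: eq_bigr => i si; rewrite -sumrN.
  transitivity (\sum_(j | (j \notin supp chi) && (j != i)) `|perm_avg e chi| ^+ 2); last first.
    by rewrite sumr_const card_notin_supp // sc mulr_natl.
  apply: eq_bigr => j /andP[sj ji]; rewrite inE negbK in si.
  have ij : i != j by rewrite eq_sym.
  under eq_bigr do rewrite untransferK ?(eqP si) //.
  rewrite -mulr_suml -rmorph_sum -mulNr normCK mulrC; congr (_ * _).
  rewrite -rmorphN; congr (_^*).
  have := sum_perm_avg_untransfer e chi ij; rewrite (bigD1 0) //= untransfer0.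
  by move/eqP; rewrite addr_eq0 => /eqP.
rewrite -sumrN mulr_sumr mulr_sumr; apply: eq_bigr => chi /eqP sc.
rewrite -sumrN; transitivity (\sum_(i | i \notin supp chi)
   (2 * m.+1)%:R * `|perm_avg e chi| ^+ 2); last first.
  rewrite sumr_const; have -> : #|[pred i | i \notin supp chi]| = (n - m).-1%N.
    by rewrite -subnS -sc -(cardsT G) -cardsDS ?subsetT //; apply: eq_card => i; rewrite !inE andbT.
  by rewrite -mulr_natl; ring.
apply: eq_bigr => i si; rewrite -sumrN.
transitivity (\sum_(j in supp chi) 2 * `|perm_avg e chi| ^+ 2); last first.
  by rewrite sumr_const sc natrM -mulr_natl; ring.
apply: eq_bigr => j sj; rewrite inE negbK in si; rewrite inE in sj.
have ij : i != j by apply: contraNneq sj => <-.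
under eq_bigr do rewrite untransferK ?(eqP si) //.
rewrite -mulr_suml -rmorph_sum -mulNr normCK mulrC mulrCA; congr (_ * _).
rewrite -rmorphN -[2]conjC_nat -rmorphM; congr (_^*).
have := sum_perm_avg_untransfer e chi ij; rewrite (bigD1 0) //= untransfer0.
rewrite (bigD1 (chi j)) //= perm_avg_untransfer_top ?(eqP si) //.
by move/eqP; rewrite addrA addr_eq0 => /eqP; rewrite mulr_natl.
Qed.

Lemma mass_0 p : mass p 0 = 1.
Proof.
rewrite /mass (bigD1 (0 : {ffun G -> K})) /=; last first.
  by apply/eqP/eqP; rewrite cards_eq0; apply/eqP/setP => i; rewrite !inE ffunE eqxx.
rewrite perm_avg0 normr1 expr1n big1 ?addr0 // => chi /andP[].
rewrite cards_eq0 => /eqP s0 /eqP[]; apply/ffunP => i; rewrite ffunE.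
by apply/eqP; have := in_set0 i; rewrite -s0 inE => /negbFE.
Qed.

Lemma mass_1 p : mass p.+1 1 = 0.
Proof.
apply: big1 => chi /cards1P[i sc].
have si : i \in supp chi by rewrite sc set11.
have := perm_avg_supp e si; rewrite sc setDv big_set0 oppr0 => /eqP.
by rewrite mulf_eq0 pnatr_eq0 /= => /eqP->; rewrite normr0 expr0n.
Qed.

End Mass.

(** * A Hadamard bound for permanents *)

Lemma closed_prim_root (F : numClosedFieldType) m : (0 < m)%N ->
  exists z : F, m.-primitive_root z.
Proof.
move=> m0; pose p : {poly F} := 'X^m - 1.
have [r Dp] := closed_field_poly_normal p.
move: Dp; rewrite (monicP _) ?monicXnsubC // scale1r => Dp.
have rn1 : all m.-unity_root r by apply/allP=> z; rewrite -root_prod_XsubC -Dp.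
have sz_r : (m < (size r).+1)%N.
  by rewrite -(size_prod_XsubC r id) -Dp size_XnsubC.
have [|z] := hasP (cyclic.has_prim_root m0 rn1 _ sz_r); last by exists z.
by rewrite -separable_prod_XsubC -Dp separable_Xn_sub_1 // pnatr_eq0 -lt0n.
Qed.

Section Count.
Variables (T K : finType).
Implicit Types (chi g : {ffun T -> K}) (k : K) (s : {perm T}).

Definition fiber_card chi k := #|[set i | chi i == k]|.

(** The orbit of [chi] under permutations of the positions, described by multiplicities;
    [rearr_permP] links the two descriptions. *)
Definition rearr chi : {set {ffun T -> K}} := [set g | [forall k, fiber_card g k == fiber_card chi k]].

Lemma rearrP g chi : reflect (fiber_card g =1 fiber_card chi) (g \in rearr chi).
Proof.
by rewrite inE; apply: (iffP forallP) => h k; apply/eqP.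
Qed.

Lemma sum_fiber_card chi : (\sum_k fiber_card chi k = #|T|)%N.
Proof.
rewrite -sum1_card (partition_big chi predT) //=; apply: eq_bigr => k _.
by rewrite /fiber_card -sum1_card; apply: eq_bigl => i; rewrite inE.
Qed.

Lemma fiber_card_le chi k : (fiber_card chi k <= #|T|)%N.
Proof. exact: max_card. Qed.

Lemma fiber_card_perm chi s k : fiber_card [ffun i => chi (s i)] k = fiber_card chi k.
Proof.
rewrite -[RHS](card_imset _ (@perm_inj _ s^-1)); apply: eq_card => i.
rewrite inE ffunE; apply/idP/imsetP => [h|[j]]; last first.
  by rewrite inE => /eqP <- ->; rewrite permKV.
by exists (s i); rewrite ?inE // permK.
Qed.

Lemma rearr_permP g chi : g \in rearr chi -> exists s, g = [ffun i => chi (s i)].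
Proof.
move=> /rearrP gc; pose t f := [tuple f (enum_val i) | i < #|T|] : #|T|.-tuple K.
have ct (f : {ffun T -> K}) k : count_mem k (t f) = fiber_card f k.
  rewrite /t /= count_map -sum1_count big_enum_cond /fiber_card -[RHS]sum1_card.
  rewrite (reindex _ (onW_bij _ (@enum_rank_bij T))) /=.
  by apply: eq_bigl => x; rewrite /= inE enum_rankK.
have /tuple_permP[p tp] : perm_eq (t g) (t chi).
  by apply/allP => k _ /=; rewrite !ct gc.
have inj : injective (fun x => enum_val (p (enum_rank x))).
  by move=> x y /enum_val_inj/perm_inj/enum_rank_inj.
exists (perm inj); apply/ffunP => x; rewrite ffunE permE.
have := congr1 (fun u : seq K => nth (g x) u (enum_rank x)) tp.
by rewrite -!tnth_nth !tnth_mktuple enum_rankK.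
Qed.

(** If [s0] is one solution, then [s0^-1 * s] preserves every fibre of [chi] for each solution [s],
    and is determined by its restrictions to the fibres. *)
Lemma card_stab chi g : (#|[set s : {perm T} | [ffun i => chi (s i)] == g]|
   <= \prod_k (fiber_card chi k)`!)%N.
Proof.
have [->|[s0]] := set_0Vmem [set s : {perm T} | [ffun i => chi (s i)] == g].
  by rewrite cards0.
rewrite inE => /eqP sg.
pose fib k := [set i | chi i == k].
pose phi (s : {perm T}) : {ffun K -> {perm T}} :=
  [ffun k => restr_perm (fib k) (s0^-1 * s)%g].
have stab s : s \in [set s : {perm T} | [ffun i => chi (s i)] == g] ->
    forall i, chi ((s0^-1 * s)%g i) = chi i.
  rewrite inE => /eqP sg' i; rewrite permM.
  have := congr1 (fun h : {ffun T -> K} => h (s0^-1 i)%g) sg'.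
  by rewrite -sg !ffunE permKV.
have inN s k : s \in [set s : {perm T} | [ffun i => chi (s i)] == g] ->
    (s0^-1 * s)%g \in ('N(fib k | 'P))%g.
  move=> /stab st; apply/astabsP => i /=; rewrite !inE.
  by rewrite /aperm st.
have inj : {in [set s : {perm T} | [ffun i => chi (s i)] == g] &, injective phi}.
  move=> s s' hs hs' /ffunP eqf; apply: (mulgI s0^-1%g); apply/permP => i.
  have := congr1 (fun q : {perm T} => q i) (eqf (chi i)); rewrite !ffunE.
  have fi : i \in fib (chi i) by rewrite inE.
  by rewrite !(restr_permE (inN _ _ _) fi).
rewrite -(card_in_imset inj).
pose F k := [pred q : {perm T} | perm_on (fib k) q].
have <- : #|(family F : pred {ffun K -> {perm T}})| = (\prod_k (fiber_card chi k)`!)%N.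
  by rewrite card_family foldrE big_image; apply: eq_bigr => k _; exact: card_perm.
apply: subset_leq_card; apply/subsetP => _ /imsetP[s _ ->].
by apply/familyP => k; rewrite ffunE inE restr_perm_on.
Qed.

Lemma card_rearr chi : (#|T|`! <= #|rearr chi| * \prod_k (fiber_card chi k)`!)%N.
Proof.
have -> : #|T|`! = #|{: {perm T}}|.
  rewrite -(cardsT T) -card_perm; apply: eq_card => s.
  by rewrite !inE; apply/subsetP => x _; rewrite inE.
rewrite -[X in (X <= _)%N]sum1_card (partition_big (fun s : {perm T} => [ffun i => chi (s i)])
  (mem (rearr chi))) /= => [|s _]; last by apply/rearrP => k; exact: fiber_card_perm.
rewrite -sum_nat_const; apply: leq_sum => g _; rewrite sum1_card.
by apply: leq_trans (card_stab chi g); rewrite -cardsE.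
Qed.

End Count.

Lemma prod_fiber_card (R : comPzRingType) (T K : finType) (g : {ffun T -> K}) (F : K -> R) :
  \prod_i F (g i) = \prod_k F k ^+ fiber_card g k.
Proof.
rewrite (partition_big g predT) //=; apply: eq_bigr => k _.
rewrite (eq_bigr (fun=> F k)) => [|i /eqP-> //].
by rewrite prodr_const /fiber_card; congr (_ ^+ _); apply: eq_card => i; rewrite !inE.
Qed.

(** Coefficient extraction by averaging over roots of unity; exponents below [N] are distinct modulo
    [N]. *)
Lemma sum_root_unity (C : numClosedFieldType) N (z : C) a b :
  N.-primitive_root z -> (a < N)%N -> (b < N)%N ->
  \sum_(j < N) (z ^+ j) ^+ a * ((z ^+ j)^*) ^+ b = (a == b)%:R * N%:R.
Proof.
move=> zN aN bN; have zn1 := prim_expr_order zN.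
have N0 : (0 < N)%N by exact: leq_trans aN.
have nz1 : `|z| = 1.
  by apply: (pexpIrn N0); rewrite ?nnegrE ?ler01 // -normrX zn1 normr1 expr1n.
have zc : z * z^* = 1 by rewrite -normCK nz1 expr1n.
pose w := z ^+ a * (z^*) ^+ b.
rewrite (eq_bigr (fun j : 'I_N => w ^+ j)) => [|j _]; last first.
  by rewrite rmorphXn exprMn -!exprM ![(j * _)%N]mulnC.
have wE : w * z ^+ b = z ^+ a by rewrite -mulrA -exprMn [_^* * _]mulrC zc expr1n mulr1.
have [ab|ab] := eqVneq a b.
  under eq_bigr do rewrite /w ab -exprMn zc !expr1n.
  by rewrite sumr_const card_ord mul1r.
have w1 : w != 1.
  apply: contra ab => /eqP w1; have := eq_prim_root_expr zN a b.
  by rewrite -wE w1 mul1r eqxx eq_sym !modn_small // eq_sym => <-.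
have wN : w ^+ N = 1.
  rewrite exprMn -!exprM ![(_ * N)%N]mulnC !exprM zn1 -rmorphXn zn1 rmorph1.
  by rewrite !expr1n mulr1.
have := subrX1 w N; rewrite wN subrr => /esym/eqP.
by rewrite mulf_eq0 subr_eq0 (negPf w1) mul0r => /eqP.
Qed.

Section Hadamard.
Variables (C : numClosedFieldType) (G K : finZmodType) (e : pairing C G K).
Implicit Types (k : K) (x y i j l : G) (chi g : {ffun G -> K}).
Local Notation n := #|G|.

Lemma parseval (Y : K -> C) :
  \sum_x `|\sum_k Y k * e k x| ^+ 2 = n%:R * \sum_k `|Y k| ^+ 2.
Proof.
transitivity (\sum_k \sum_l Y k * (Y l)^* * \sum_x e (k - l) x).
  under eq_bigr => x _.
    rewrite normCK rmorph_sum big_distrlr /=.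
    under eq_bigr => k _ do under eq_bigr => l _
      do rewrite rmorphM /= mulrACA -pairNl -pairDl.
    over.
  rewrite exchange_big; apply: eq_bigr => k _.
  rewrite exchange_big; apply: eq_bigr => l _.
  by rewrite mulr_sumr.
rewrite mulr_sumr; apply: eq_bigr => k _.
rewrite (bigD1 k) //= subrr sum_pairrE eqxx mul1r big1 => [|l lk].
  by rewrite addr0 normCK mulrC.
by rewrite sum_pairrE subr_eq0 eq_sym (negPf lk) mul0r mulr0.
Qed.

(** The left side is the coefficient of [prod_k y_k ^ a_k] in [prod_x sum_k y_k e k x], with [a_k]
    the multiplicities of [chi]. Composition with a permutation preserves [rearr chi], so each term
    may be averaged over all permutations. *)
Lemma sum_rearr chi : \sum_(g in rearr chi) \prod_x e (g x) x = #|rearr chi|%:R * perm_avg e chi.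
Proof.
have n0 := fact_neq0 C n; apply: (mulfI n0).
transitivity (\sum_(s : {perm G}) \sum_(g in rearr chi) \prod_x e (g (s x)) x).
  rewrite -card_permG mulr_natl -sumr_const; apply: eq_bigr => s _.
  have inj : injective (fun g => [ffun i => g (s i)] : {ffun G -> K}).
    move=> g g' /ffunP eg; apply/ffunP => i.
    by have := eg (s^-1%g i); rewrite !ffunE permKV.
  rewrite (reindex_inj inj); apply: eq_big => [g|g _]; last first.
    by apply: eq_bigr => x _; rewrite ffunE.
  by apply/rearrP/rearrP => h k; rewrite -(h k) fiber_card_perm.
rewrite exchange_big mulrCA mulr_natl -sumr_const; apply: eq_bigr => g gc.
have [s gE] := rearr_permP gc.
have -> : perm_avg e chi = perm_avg e g by rewrite gE perm_avg_perm.
rewrite mulrC divfK // [RHS](reindex_inj (@invg_inj _)); apply: eq_bigr => t _.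
rewrite [RHS](reindex_inj (@perm_inj _ t)); apply: eq_bigr => x _.
by rewrite permK.
Qed.

(** The variables are [y_k = sqrt (rho k)] times a root of unity. The coefficient is an average over
    these roots, and each product over [x] is bounded by AM-GM on the squared moduli followed by
    Parseval, with a result independent of the roots. The weights [rho] remain free for a later
    optimisation. *)
Lemma hadamard (rho : K -> C) chi : (forall k, 0 <= rho k) ->
  `|perm_avg e chi| ^+ 2 * #|rearr chi|%:R ^+ 2 * \prod_k rho k ^+ fiber_card chi k
  <= (\sum_k rho k) ^+ n.
Proof.
move=> r0; have [z zN] := closed_prim_root C (ltn0Sn n).
(* Multiplicities range over [0..n], so [n + 1] roots of unity are needed to tell them apart. *)
set N := n.+1 in zN; pose r k := sqrtC (rho k).
have r_ge0 k : 0 <= r k by rewrite sqrtC_ge0.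
have N_gt0 : 0 < N%:R :> C by rewrite ltr0n.
have nz1 : `|z| = 1.
  apply: (pexpIrn (ltn0Sn n)); rewrite ?nnegrE ?ler01 //.
  by rewrite -normrX (prim_expr_order zN) normr1 expr1n.
pose Y (t : {ffun K -> 'I_N}) k := r k * z ^+ t k.
pose H t := \prod_x \sum_k Y t k * e k x.
have S0 : 0 <= \sum_k rho k by apply: sumr_ge0.
have normY t k : `|Y t k| ^+ 2 = rho k.
  by rewrite normrM normrX nz1 expr1n mulr1 ger0_norm // sqrtCK.
have Hle t : `|H t| <= sqrtC ((\sum_k rho k) ^+ n).
  rewrite -(@ler_pXn2r _ 2) ?nnegrE ?sqrtC_ge0 ?exprn_ge0 // sqrtCK.
  rewrite normr_prod -prodrXl.
  have := (@leif_AGM C G predT (fun x => `|\sum_k Y t k * e k x| ^+ 2)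
     (fun x _ => exprn_ge0 _ (normr_ge0 _))).1.
  rewrite parseval -[#|xpredT|]/n mulrAC divff ?natn_neq0 // mul1r.
  by rewrite (eq_bigr _ (fun k _ => normY t k)).
have coef : \sum_t H t * (\prod_x z ^+ t (chi x))^* =
    N%:R ^+ #|K| * (#|rearr chi|%:R * perm_avg e chi) * \prod_x r (chi x).
  have EH t : H t * (\prod_x z ^+ t (chi x))^* = \sum_(g : {ffun G -> K})
      (\prod_x (Y t (g x) * e (g x) x)) * (\prod_x z ^+ t (chi x))^*.
    by rewrite /H bigA_distr_bigA mulr_suml.
  rewrite (eq_bigr _ (fun t _ => EH t)).
  rewrite exchange_big /= -sum_rearr mulrAC mulr_sumr big_mkcond [RHS]big_mkcond.
  apply: eq_bigr => g _.
  have E t : (\prod_x (Y t (g x) * e (g x) x)) * (\prod_x z ^+ t (chi x))^* =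
      (\prod_x r (g x)) * (\prod_x e (g x) x) *
      \prod_k ((z ^+ t k) ^+ fiber_card g k * ((z ^+ t k)^*) ^+ fiber_card chi k).
    rewrite !big_split /= -(prod_fiber_card g (fun k => z ^+ t k)).
    rewrite -(prod_fiber_card chi (fun k => (z ^+ t k)^*)) rmorph_prod /=; ring.
  rewrite (eq_bigr _ (fun t _ => E t)) -mulr_sumr.
  rewrite -(bigA_distr_bigA (fun k (j : 'I_N) =>
     (z ^+ j) ^+ fiber_card g k * ((z ^+ j)^*) ^+ fiber_card chi k)).
  have R k : \sum_(j < N) (z ^+ j) ^+ fiber_card g k * ((z ^+ j)^*) ^+ fiber_card chi k =
     (fiber_card g k == fiber_card chi k)%:R * N%:R.
    by apply: sum_root_unity; rewrite // ltnS fiber_card_le.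
  rewrite (eq_bigr _ (fun k _ => R k)).
  case: ifP => [/rearrP gc|/negP gc].
    rewrite (eq_bigr (fun=> N%:R)) => [|k _]; last by rewrite gc eqxx mul1r.
    rewrite prodr_const (prod_fiber_card g r) (prod_fiber_card chi r).
    by under eq_bigr do rewrite gc; ring.
  have [/forallP h|/forallPn[k kk]] := boolP [forall k, fiber_card g k == fiber_card chi k].
    by case: gc; rewrite inE; apply/forallP.
  by rewrite [X in _ * X](bigD1 k) //= (negPf kk) !mul0r mulr0.
have prod_r : \prod_x r (chi x) = sqrtC (\prod_k rho k ^+ fiber_card chi k).
  rewrite -(prod_fiber_card chi rho); apply: (pexpIrn (ltn0Sn 1)).
  - by rewrite nnegrE; apply: prodr_ge0.
  - by rewrite nnegrE sqrtC_ge0; apply: prodr_ge0.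
  by rewrite sqrtCK -prodrXl; apply: eq_bigr => x _; rewrite sqrtCK.
have pr0 : 0 <= \prod_k rho k ^+ fiber_card chi k.
  by apply: prodr_ge0 => k _; rewrite exprn_ge0.
have le1 : N%:R ^+ #|K| * (#|rearr chi|%:R * `|perm_avg e chi| * sqrtC (\prod_k rho k ^+ fiber_card chi k))
     <= N%:R ^+ #|K| * sqrtC ((\sum_k rho k) ^+ n).
  have -> : N%:R ^+ #|K| * (#|rearr chi|%:R * `|perm_avg e chi| *
     sqrtC (\prod_k rho k ^+ fiber_card chi k)) =
     `|\sum_t H t * (\prod_x z ^+ t (chi x))^*|.
    rewrite coef prod_r !normrM normrX !normr_nat mulrA.
    by rewrite [`|sqrtC _|]ger0_norm ?sqrtC_ge0.
  apply: le_trans (ler_norm_sum _ _ _) _.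
  have -> : N%:R ^+ #|K| = #|{: {ffun K -> 'I_N}}|%:R :> C.
    by rewrite card_ffun card_ord natrX.
  rewrite mulr_natl -sumr_const; apply: ler_sum => t _.
  have np1 : `|\prod_x z ^+ t (chi x)| = 1.
    by rewrite normr_prod big1 // => x _; rewrite normrX nz1 expr1n.
  by rewrite normrM norm_conjC np1 mulr1.
rewrite ler_pM2l ?exprn_gt0 // in le1.
have -> : `|perm_avg e chi| ^+ 2 * #|rearr chi|%:R ^+ 2 * \prod_k rho k ^+ fiber_card chi k =
    (#|rearr chi|%:R * `|perm_avg e chi| * sqrtC (\prod_k rho k ^+ fiber_card chi k)) ^+ 2.
  by rewrite !exprMn sqrtCK; ring.
rewrite -[leRHS]sqrtCK ler_pXn2r ?nnegrE ?mulr_ge0 ?sqrtC_ge0 ?exprn_ge0 //.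
Qed.

End Hadamard.

(** * Summing the cubes of the Hadamard bound *)

Section Factorial.
Variable F : realType.
Local Notation E := (expR 1 : F).

Lemma expR1_natX n : E ^+ n = expR n%:R.
Proof. by rewrite -expRM_natl mulr1. Qed.

Lemma exp1X_ge n : n.+1%:R ^+ n <= E * n%:R ^+ n.
Proof.
case: n => [|n]; first by rewrite !expr0 mulr1 ltW // expR_gt1.
have n0 : 0 < n.+1%:R :> F by rewrite ltr0n.
have -> : E = expR n.+1%:R^-1 ^+ n.+1 by rewrite -expRM_natl divff ?gt_eqF.
rewrite -exprMn; apply: lerXn2r; rewrite ?nnegrE ?mulr_ge0 ?ler0n ?expR_ge0 //.
have -> : n.+2%:R = (1 + n.+1%:R^-1) * n.+1%:R :> F.
  by rewrite mulrDl mulVf ?gt_eqF // mul1r -natr1 addrC.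
by rewrite ler_pM2r // expR_ge1Dx.
Qed.

Lemma exp1X_le n : E * n%:R ^+ n.+1 <= n.+1%:R ^+ n.+1.
Proof.
have n0 : 0 < n.+1%:R :> F by rewrite ltr0n.
have -> : E = expR n.+1%:R^-1 ^+ n.+1 by rewrite -expRM_natl divff ?gt_eqF.
rewrite -exprMn; apply: lerXn2r; rewrite ?nnegrE ?mulr_ge0 ?ler0n ?expR_ge0 //.
have h : expR n.+1%:R^-1 * (n%:R / n.+1%:R) <= (1 : F).
  have -> : n%:R / n.+1%:R = 1 + - n.+1%:R^-1 :> F.
    have -> : n%:R = n.+1%:R - 1 :> F by rewrite -natr1 addrK.
    by rewrite mulrBl divff ?gt_eqF // mul1r.
  apply: le_trans (ler_wpM2l (expR_ge0 _) (expR_ge1Dx _)) _.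
  by rewrite expRN divff // gt_eqF // expR_gt0.
by rewrite mulrA ler_pdivrMr // mul1r in h.
Qed.

Lemma fact_ge n : (n%:R / E) ^+ n <= (n`!)%:R.
Proof.
have E0 : 0 < E by exact: expR_gt0.
elim: n => [|n IH]; first by rewrite expr0.
rewrite expr_div_n ler_pdivrMr ?exprn_gt0 // in IH.
rewrite expr_div_n ler_pdivrMr ?exprn_gt0 // factS natrM !exprS -mulrA.
rewrite ler_pM2l ?ltr0n //; apply: le_trans (exp1X_ge n) _.
by rewrite mulrCA ler_pM2l.
Qed.

Lemma fact_le n : (0 < n)%N -> (n`!)%:R <= E * n%:R * (n%:R / E) ^+ n.
Proof.
have E0 : 0 < E by exact: expR_gt0.
case: n => // n _; elim: n => [|n IH].
  by rewrite mulr1 expr1 mul1r divff ?gt_eqF.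
rewrite factS natrM; set a := n.+1 in IH *.
apply: le_trans (ler_wpM2l (ler0n _ _) IH) _.
rewrite -(ler_pM2l (exprn_gt0 a.+1 E0)).
have -> : E ^+ a.+1 * (a.+1%:R * (E * a%:R * (a%:R / E) ^+ a)) =
   (E * a%:R ^+ a.+1) * (E * a.+1%:R).
  by rewrite expr_div_n !exprS; field; rewrite ?expf_neq0 ?lt0r_neq0.
have -> : E ^+ a.+1 * (E * a.+1%:R * (a.+1%:R / E) ^+ a.+1) =
   a.+1%:R ^+ a.+1 * (E * a.+1%:R).
  by rewrite expr_div_n; field; rewrite ?expf_neq0 ?lt0r_neq0.
by rewrite ler_pM2r ?exp1X_le // mulr_gt0 // ltr0n.
Qed.

End Factorial.

(** * The permanent bound over the reals, and its cube summed over multiplicity profiles *)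

Section RealNorm.
Variables (F : realType) (G K : finZmodType) (e : pairing F[i] G K).
Implicit Types (k : K) (x y i j l : G) (chi g : {ffun G -> K}).
Local Notation n := #|G|.
Local Notation E := (expR 1 : F).

Definition abs_avg chi : F := complex.Re `|perm_avg e chi|.

Lemma abs_avgE chi : `|perm_avg e chi| = real_complex F (abs_avg chi).
Proof. by rewrite /abs_avg RRe_real // normr_real. Qed.

Lemma abs_avg_ge0 chi : 0 <= abs_avg chi.
Proof. by rewrite -ler0c -abs_avgE. Qed.

Definition abs_mass p m : F := \sum_(chi : {ffun G -> K} | #|supp chi| == m) abs_avg chi ^+ p.

Lemma abs_massE p m : mass e p m = real_complex F (abs_mass p m).
Proof.
by rewrite rmorph_sum; apply: eq_bigr => chi _; rewrite abs_avgE rmorphXn.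
Qed.

Lemma abs_mass_ge0 p m : 0 <= abs_mass p m.
Proof. by apply: sumr_ge0 => chi _; rewrite exprn_ge0 ?abs_avg_ge0. Qed.

Lemma abs_mass_0 p : abs_mass p 0 = 1.
Proof. by apply: (@complexI F); rewrite -abs_massE mass_0. Qed.

Lemma abs_mass_1 p : abs_mass p.+1 1 = 0.
Proof. by apply: (@complexI F); rewrite -abs_massE mass_1. Qed.

Lemma abs_mass2_rec m : (m.+2 <= n)%N ->
  m.+2%:R * abs_mass 2 m.+2 = (2 * m.+1)%:R * abs_mass 2 m.+1 + (n - m)%:R * abs_mass 2 m.
Proof.
move=> mn; apply: (@complexI F); rewrite rmorphD !rmorphM !rmorph_nat /= -!abs_massE.
exact: mass2_rec.
Qed.

Lemma abs_avg_hadamard (rho : K -> F) chi : (forall k, 0 <= rho k) ->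
  abs_avg chi ^+ 2 * #|rearr chi|%:R ^+ 2 * \prod_k rho k ^+ fiber_card chi k
  <= (\sum_k rho k) ^+ n.
Proof.
move=> rho0; rewrite -lecR.
have := @hadamard _ _ _ e (fun k => real_complex F (rho k)) chi.
rewrite abs_avgE => /(_ (fun k => _)) h.
rewrite !rmorphM !rmorphXn rmorph_nat rmorph_prod rmorph_sum /=.
under [X in _ * X <= _]eq_bigr do rewrite rmorphXn.
by apply: h => k; rewrite ler0c.
Qed.

Local Notation nF := (n%:R : F).

Lemma nF_gt0 : 0 < nF.
Proof. by rewrite ltr0n card_zmod_gt0. Qed.

(** The square root of [prod_k rho k ^ a_k] at [rho k = a_k / n], the weights of total mass one that
    maximise this product. *)
Definition wt chi : F := \prod_k Num.sqrt ((fiber_card chi k)%:R / nF) ^+ fiber_card chi k.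

Lemma wt_gt0 chi : 0 < wt chi.
Proof.
apply: prodr_gt0 => k _; case: (fiber_card chi k) => [|c]; first by rewrite expr0 ltr01.
by rewrite exprn_gt0 // sqrtr_gt0 divr_gt0 ?nF_gt0 ?ltr0n.
Qed.

Lemma abs_avg_rearr chi : abs_avg chi * #|rearr chi|%:R * wt chi <= 1.
Proof.
rewrite -(@ler_pXn2r _ 2) ?nnegrE ?mulr_ge0 ?abs_avg_ge0 ?ler0n ?(ltW (wt_gt0 _)) //.
rewrite expr1n; have := @abs_avg_hadamard (fun k => (fiber_card chi k)%:R / nF) chi.
rewrite -mulr_suml -natr_sum sum_fiber_card divff ?gt_eqF ?nF_gt0 // expr1n => h.
rewrite !exprMn; have -> : wt chi ^+ 2 = \prod_k ((fiber_card chi k)%:R / nF) ^+ fiber_card chi k.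
  rewrite -prodrXl; apply: eq_bigr => k _.
  by rewrite exprAC sqr_sqrtr ?divr_ge0 ?ler0n.
by apply: h => k; rewrite divr_ge0 ?ler0n.
Qed.

Lemma rearr_gt0 chi : (0 < #|rearr chi|)%N.
Proof. by apply/card_gt0P; exists chi; apply/rearrP. Qed.

Lemma abs_avg_le_fiber_card chi :
  abs_avg chi <= (\prod_k ((fiber_card chi k)`!)%:R) / (n`!)%:R / wt chi.
Proof.
have w0 := wt_gt0 chi; have f0 : 0 < (n`!)%:R :> F by rewrite ltr0n fact_gt0.
rewrite ler_pdivlMr // ler_pdivlMr //.
have c0 : 0 < #|rearr chi|%:R :> F by rewrite ltr0n rearr_gt0.
rewrite -(ler_pM2l c0).
apply: le_trans (_ : (n`!)%:R <= _); last first.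
  by rewrite -natr_prod -natrM ler_nat card_rearr.
rewrite -[leRHS]mul1r mulrA ler_pM2r //.
by apply: le_trans (abs_avg_rearr chi); rewrite mulrA [_ * abs_avg _]mulrC.
Qed.

(* An upper bound for [a!^2 (E / n)^(2 a) (n / a)^(3 a / 2)], the contribution of a
   value of multiplicity [a] to the cubed bound. *)
Definition entropy_wt (a : nat) : F :=
  if a == 0 then 1 else E ^+ 2 * a%:R ^+ 2 * Num.sqrt (a%:R / nF) ^+ a.

Lemma entropy_wt_ge0 a : 0 <= entropy_wt a.
Proof.
rewrite /entropy_wt; case: eqP => // _.
by rewrite !mulr_ge0 ?exprn_ge0 ?expR_ge0 ?ler0n ?sqrtr_ge0.
Qed.

Lemma entropy_wt_fact a : (a`!)%:R ^+ 2 * (E / nF) ^+ (2 * a) / Num.sqrt (a%:R / nF) ^+ (3 * a)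
  <= entropy_wt a.
Proof.
rewrite /entropy_wt; case: a => [|a]; first by rewrite !muln0 !expr0 expr1n divr1 mulr1.
set b := a.+1 => /=; have b0 : 0 < b%:R :> F by rewrite ltr0n.
have n0 := nF_gt0; have E0 : 0 < E := expR_gt0 _.
have s0 : 0 < Num.sqrt (b%:R / nF) by rewrite sqrtr_gt0 divr_gt0.
rewrite ler_pdivrMr ?exprn_gt0 // -[leRHS]mulrA -exprD.
have -> : (b + 3 * b = 2 * (2 * b))%N by rewrite -mulSn mulnA.
rewrite [X in _ <= _ * X]exprM sqr_sqrtr ?divr_ge0 ?ler0n //.
have -> : E ^+ 2 * b%:R ^+ 2 * (b%:R / nF) ^+ (2 * b) =
   (E * b%:R * (b%:R / E) ^+ b) ^+ 2 * (E / nF) ^+ (2 * b).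
  have -> : b%:R / nF = (b%:R / E) * (E / nF) by field; rewrite !gt_eqF.
  by rewrite [in RHS]exprMn [in RHS]exprMn [in LHS]exprMn [(2 * b)%N]mulnC !exprM; ring.
rewrite ler_pM2r ?exprn_gt0 ?divr_gt0 //; apply: lerXn2r.
- by rewrite nnegrE.
- by rewrite nnegrE !mulr_ge0 ?exprn_ge0 ?divr_ge0 ?ler0n ?(ltW E0).
exact: fact_le.
Qed.

(** The [chi] with given multiplicities form one class [rearr chi0], on which [abs_avg] is at most
    the inverse of [#|rearr chi0| * wt chi0]. The class thus contributes at most
    [#|rearr chi0|^-2 * wt chi0 ^- 3], which is bounded by a product over [k]; dropping the
    constraint that multiplicities add up to [n] gives a product of sums. The free weights [u] serve
    as generating-function markers for conditions on multiplicities. *)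
Lemma sum_abs_avg3 (u : K -> nat -> F) : (forall k a, 0 <= u k a) ->
  \sum_(chi : {ffun G -> K}) abs_avg chi ^+ 3 * \prod_k u k (fiber_card chi k)
  <= \prod_k \sum_(a < n.+1) u k a * entropy_wt a.
Proof.
move=> u0; rewrite bigA_distr_bigA /=.
pose c chi : {ffun K -> 'I_n.+1} := [ffun k => inord (fiber_card chi k)].
have cE chi k : c chi k = fiber_card chi k :> nat by rewrite ffunE inordK // ltnS fiber_card_le.
rewrite (partition_big c predT) //=; apply: ler_sum => b _.
have [[chi0 /eqP cb]|noc] := pselect (exists chi, c chi == b); last first.
  rewrite big_pred0; first by apply: prodr_ge0 => k _; rewrite mulr_ge0 ?entropy_wt_ge0.
  by move=> chi; apply/negP => hc; apply: noc; exists chi.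
have bE k : b k = fiber_card chi0 k :> nat by rewrite -cb cE.
have in_rearr chi : c chi == b -> fiber_card chi =1 fiber_card chi0.
  by move=> /eqP cb' k; rewrite -bE -cb' cE.
set U := \prod_k u k (fiber_card chi0 k); have U0 : 0 <= U by apply: prodr_ge0.
have w0 := wt_gt0 chi0.
have c0 : 0 < #|rearr chi0|%:R :> F by rewrite ltr0n rearr_gt0.
have f0 : 0 < (n`!)%:R :> F by rewrite ltr0n fact_gt0.
have n0 := nF_gt0; have E0 : 0 < E := expR_gt0 _.
have cf : (#|rearr chi0|%:R)^-1 <= (\prod_k ((fiber_card chi0 k)`!)%:R) / (n`!)%:R :> F.
  rewrite ler_pdivlMr // mulrC ler_pdivrMr // -natr_prod -natrM ler_nat mulnC.
  exact: card_rearr.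
have ff : (n`!)%:R^-1 <= (E / nF) ^+ n.
  rewrite -[E / nF]invf_div exprVn lef_pV2 ?posrE ?exprn_gt0 ?divr_gt0 //.
  exact: fact_ge.
apply: le_trans (_ : \sum_(chi in rearr chi0) (#|rearr chi0|%:R * wt chi0)^-1 ^+ 3 * U <= _).
  rewrite big_mkcond [leRHS]big_mkcond; apply: ler_sum => chi _.
  case: ifP => [/in_rearr h|_]; last first.
    by case: ifP => // _; rewrite mulr_ge0 ?exprn_ge0 ?invr_ge0 ?mulr_ge0 ?(ltW w0) ?(ltW c0).
  have -> : chi \in rearr chi0 by apply/rearrP.
  have -> : \prod_k u k (fiber_card chi k) = U by apply: eq_bigr => k _; rewrite h.
  rewrite ler_wpM2r // lerXn2r ?nnegrE ?abs_avg_ge0 ?invr_ge0 ?mulr_ge0 ?(ltW w0) ?(ltW c0) //.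
  rewrite -[leRHS]mul1r ler_pdivlMr ?mulr_gt0 //.
  have -> : #|rearr chi0| = #|rearr chi|.
    by apply: eq_card => g; apply/rearrP/rearrP => hg k; rewrite hg h.
  have -> : wt chi0 = wt chi by apply: eq_bigr => k _; rewrite h.
  by rewrite mulrA abs_avg_rearr.
rewrite sumr_const -[leLHS]mulr_natl.
have -> : #|rearr chi0|%:R * ((#|rearr chi0|%:R * wt chi0)^-1 ^+ 3 * U) =
   (#|rearr chi0|%:R^-1) ^+ 2 * (wt chi0 ^- 3 * U) :> F.
  by field; rewrite !gt_eqF.
apply: le_trans (_ : ((\prod_k ((fiber_card chi0 k)`!)%:R) * (E / nF) ^+ n) ^+ 2 *
    (wt chi0 ^- 3 * U) <= _).
  rewrite ler_wpM2r ?mulr_ge0 ?invr_ge0 ?exprn_ge0 ?(ltW w0) //.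
  rewrite lerXn2r ?nnegrE ?mulr_ge0 ?invr_ge0 ?exprn_ge0 ?divr_ge0 ?(ltW E0) ?(ltW n0)
     ?(ltW c0) ?prodr_ge0 //.
  by apply: le_trans cf _; rewrite ler_wpM2l ?prodr_ge0.
under [leRHS]eq_bigr do rewrite bE.
rewrite [leRHS]big_split /= -/U mulrA [leRHS]mulrC ler_wpM2r //.
have -> : (E / nF) ^+ n = \prod_k (E / nF) ^+ fiber_card chi0 k by rewrite prodrXr sum_fiber_card.
have -> : wt chi0 ^- 3 = \prod_k (Num.sqrt ((fiber_card chi0 k)%:R / nF) ^+ (3 * fiber_card chi0 k))^-1.
  rewrite prodfV -prodrXl; congr (_^-1); apply: eq_bigr => k _; by rewrite mulnC exprM.
rewrite -big_split -prodrXl -big_split; apply: ler_prod => k _ /=.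
rewrite exprMn -exprM [(fiber_card chi0 k * 2)%N]mulnC entropy_wt_fact andbT.
by rewrite !mulr_ge0 ?invr_ge0 ?exprn_ge0 ?sqrtr_ge0 ?divr_ge0 ?(ltW E0) ?(ltW n0) ?ler0n.
Qed.
End RealNorm.

(** * Supports of size at most n/2 *)

Lemma ffact_ge n m : ((n - m) ^ m <= n ^_ m)%N.
Proof.
rewrite ffact_prod; apply: (@leq_trans (\prod_(i < m) (n - m))).
  by rewrite prod_nat_const card_ord.
by apply: leq_prod => i _; rewrite leq_sub2l // ltnW.
Qed.

Lemma fact_le_expn n : (n`! <= n ^ n)%N.
Proof.
elim: n => // n IH; rewrite factS expnS leq_mul // (leq_trans IH) //.
by case: n {IH} => // n; rewrite leq_exp2r.
Qed.

(** Lets a factor [a ^ a] absorb one extra [m] when turned into [(2 * m) ^ a]: the source of the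
    gain per distinct value in [abs_avg_supp]. *)
Lemma expn_self_le c m : (c < m)%N -> (c.+1 ^ c.+1 * m <= (2 * m) ^ c.+1)%N.
Proof.
move=> cm; rewrite expnMn expnS -mulnA; apply: leq_mul.
  by apply: ltnW; apply: ltn_expl.
rewrite [X in (_ <= X)%N]expnSr; apply: leq_mul => //.
by case: c cm => // c cm; rewrite leq_exp2r.
Qed.

Section Sparse.
Variables (F : realType) (G K : finZmodType) (e : pairing F[i] G K).
Implicit Types (k : K) (chi g : {ffun G -> K}).
Local Notation n := #|G|.
Local Notation E := (expR 1 : F).
Local Notation nF := (n%:R : F).

(** Induction on two consecutive sizes in [mass2_rec]. The square root is the growth dictated by the
    term in [mass 2 m]; the base 3 absorbs the other term, since [2 * 3 + 1 <= 3 ^ 2]. *)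
Lemma abs_mass2_le m : (m <= n)%N ->
  abs_mass e 2 m <= 3 ^+ m * Num.sqrt (nF ^+ m / (m`!)%:R).
Proof.
have n0 : 0 < nF := nF_gt0 F G.
pose s m := Num.sqrt (nF ^+ m / (m`!)%:R).
have f0 i : 0 < (i`!)%:R :> F by rewrite ltr0n fact_gt0.
have s_rec i : s i.+1 = s i * Num.sqrt (nF / i.+1%:R).
  rewrite /s -sqrtrM ?divr_ge0 ?exprn_ge0 ?ler0n //; congr (Num.sqrt _).
  by rewrite exprSr factS mulnC natrM invfM mulrACA.
have s_ge0 i : 0 <= s i by exact: sqrtr_ge0.
suff H i : (i.+1 <= n)%N ->
    abs_mass e 2 i <= 3 ^+ i * s i /\ abs_mass e 2 i.+1 <= 3 ^+ i.+1 * s i.+1.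
  case: m => [|m] mn; last by case: (H m mn).
  by case: (H 0%N) => //; exact: card_zmod_gt0.
elim: i => [|i IH] ni.
  split; first by rewrite abs_mass_0 /s !expr0 divr1 mul1r sqrtr1.
  by rewrite abs_mass_1 mulr_ge0 ?exprn_ge0.
have [h0 h1] := IH (ltnW ni); split=> //.
have i0 : 0 < i.+2%:R :> F by rewrite ltr0n.
rewrite -(ler_pM2l i0) abs_mass2_rec //.
have r1 : 1 <= Num.sqrt (nF / i.+2%:R).
  by rewrite -[leLHS]sqrtr1 ler_sqrt ?divr_ge0 ?ler0n // ler_pdivlMr // mul1r ler_nat.
have s1 : s i.+1 <= s i.+2 by rewrite (s_rec i.+1) ler_peMr.
have s2 : (n - i)%:R * s i <= i.+2%:R * s i.+2.
  have -> : i.+2%:R * s i.+2 = s i * (i.+2%:R * (Num.sqrt (nF / i.+1%:R) * Num.sqrt (nF / i.+2%:R))).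
    by rewrite !s_rec; ring.
  rewrite mulrC ler_wpM2l //.
  apply: le_trans (_ : nF <= _); first by rewrite ler_nat leq_subr.
  have q2 : Num.sqrt (nF / i.+2%:R) <= Num.sqrt (nF / i.+1%:R).
    by rewrite ler_sqrt ?divr_ge0 ?ler0n // ler_pM2l // lef_pV2 ?posrE ?ltr0n // ler_nat.
  apply: le_trans (_ : i.+2%:R * (nF / i.+2%:R) <= _).
    by rewrite mulrC divfK // gt_eqF.
  rewrite ler_pM2l // -[leLHS]sqr_sqrtr ?divr_ge0 ?ler0n // expr2.
  by rewrite ler_wpM2r ?sqrtr_ge0.
have t1 : (2 * i.+1)%:R * abs_mass e 2 i.+1 <= i.+2%:R * (6 * 3 ^+ i * s i.+2).
  apply: le_trans (_ : i.+2%:R * (2 * abs_mass e 2 i.+1) <= _).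
    rewrite mulrA ler_wpM2r ?abs_mass_ge0 // -natrM ler_nat; lia.
  rewrite ler_pM2l //; apply: le_trans (ler_wpM2l _ h1) _ => //.
  rewrite exprS; have : 0 <= 3 ^+ i :> F by rewrite exprn_ge0.
  move: (3 ^+ i : F) => p p0.
  have -> : 2 * (3 * p * s i.+1) = 6 * p * s i.+1 by ring.
  by rewrite ler_wpM2l // mulr_ge0.
have t2 : (n - i)%:R * abs_mass e 2 i <= i.+2%:R * (3 ^+ i * s i.+2).
  apply: le_trans (ler_wpM2l (ler0n _ _) h0) _.
  by rewrite mulrCA [leRHS]mulrCA ler_wpM2l // exprn_ge0.
apply: le_trans (lerD t1 t2) _; rewrite -mulrDr ler_pM2l // !exprS.
have : 0 <= 3 ^+ i * s i.+2 by rewrite mulr_ge0 // exprn_ge0.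
by move: (3 ^+ i : F) (s i.+2) => p t pt; nra.
Qed.

Lemma fiber_card0 chi : fiber_card chi 0 = (n - #|supp chi|)%N.
Proof.
rewrite -(cardsT G) -cardsDS ?subsetT //; apply: eq_card => i.
by rewrite !inE andbT negbK.
Qed.

Lemma supp_le chi : (#|supp chi| <= n)%N.
Proof. exact: max_card. Qed.

Lemma sum_fiber_card_neq0 chi : (\sum_(k | k != 0%R) fiber_card chi k = #|supp chi|)%N.
Proof.
have := sum_fiber_card chi; rewrite (bigD1 0) //= fiber_card0 => h.
apply/eqP; rewrite -(eqn_add2l (n - #|supp chi|)) h subnK //; exact: supp_le.
Qed.

Definition nvals chi := #|[set k | (k != 0) && (0 < fiber_card chi k)%N]|.

Lemma fiber_card_le_supp chi k : k != 0 -> (fiber_card chi k <= #|supp chi|)%N.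
Proof. by move=> k0; rewrite -sum_fiber_card_neq0 (bigD1 k) //= leq_addr. Qed.

(** In the squared permanent bound the trivial value, of multiplicity [n - m], is split off. For
    each other value [a!^2 (n / a)^a <= a^a n^a], and [a^a] leaves room for an additional factor
    [m], whence [m ^ nvals chi]. *)
Lemma abs_avg_supp chi m : #|supp chi| = m -> (2 * m <= n)%N ->
  abs_avg e chi ^+ 2 * m%:R ^+ nvals chi <= (8 * E / nF) ^+ m * m%:R ^+ m.
Proof.
move=> sm mn; have n0 : 0 < nF := nF_gt0 F G.
have E0 : 0 < E := expR_gt0 _.
have w0 := wt_gt0 F chi.
have f0 i : 0 < (i`!)%:R :> F by rewrite ltr0n fact_gt0.
have nm : n%:R = (n - m)%:R + m%:R :> F by rewrite -natrD subnK //; lia.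
have nm0 : 0 < (n - m)%:R :> F.
  by rewrite ltr0n; have := card_zmod_gt0 G; lia.
pose b k := fiber_card chi k.
have B : abs_avg e chi ^+ 2 <= (n`!)%:R ^- 2 *
    \prod_k (((b k)`!)%:R ^+ 2 * (nF / (b k)%:R) ^+ b k).
  apply: le_trans (_ : ((\prod_k ((b k)`!)%:R) / (n`!)%:R / wt F chi) ^+ 2 <= _).
    apply: lerXn2r; rewrite ?nnegrE ?abs_avg_ge0 ?abs_avg_le_fiber_card //.
    by rewrite !divr_ge0 ?(ltW w0) ?ler0n // prodr_ge0.
  have -> : ((\prod_k ((b k)`!)%:R) / (n`!)%:R / wt F chi) ^+ 2 =
      (n`!)%:R ^- 2 * ((\prod_k ((b k)`!)%:R) ^+ 2 * (wt F chi)^-1 ^+ 2).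
    by field; rewrite ?gt_eqF.
  rewrite ler_wpM2l ?invr_ge0 ?exprn_ge0 // big_split /= prodrXl.
  rewrite ler_wpM2l ?exprn_ge0 ?prodr_ge0 // -prodfV -prodrXl.
  apply: ler_prod => k _; rewrite exprn_ge0 ?invr_ge0 ?exprn_ge0 ?sqrtr_ge0 //=.
  by rewrite exprVn exprAC sqr_sqrtr ?divr_ge0 ?ler0n // -exprVn invf_div.
have fm : ((n - m)`!)%:R / (n`!)%:R <= (2 / nF) ^+ m.
  rewrite ler_pdivrMr // -[leLHS]mul1r.
  have -> : (n`!)%:R = (n ^_ m)%:R * ((n - m)`!)%:R :> F by rewrite -natrM ffact_fact //; lia.
  rewrite mulrA ler_pM2r //; apply: le_trans (_ : (2 / nF) ^+ m * (n - m)%:R ^+ m <= _).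
    rewrite -exprMn exprn_ege1 // mulrAC ler_pdivlMr // mul1r -natrM ler_nat; lia.
  by rewrite ler_pM2l ?exprn_gt0 ?divr_gt0 // -natrX ler_nat ffact_ge.
(* The trivial value costs only [(1 + m / (n - m)) ^ (n - m) <= exp m]. *)
have em : (nF / (n - m)%:R) ^+ (n - m) <= E ^+ m.
  have -> : E ^+ m = expR (m%:R / (n - m)%:R) ^+ (n - m).
    by rewrite expR1_natX -expRM_natl mulrC divfK // gt_eqF.
  rewrite lerXn2r ?nnegrE ?divr_ge0 ?expR_ge0 ?ler0n //.
  by rewrite nm mulrDl divff ?gt_eqF // expR_ge1Dx.
have pm : (\prod_(k | k != 0) (((b k)`!)%:R ^+ 2 * (nF / (b k)%:R) ^+ b k)) *
    m%:R ^+ nvals chi <= (2 * m%:R * nF) ^+ m.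
  have -> : (2 * m%:R * nF) ^+ m = \prod_(k | k != 0) (2 * m%:R * nF) ^+ b k.
    by rewrite prodrXr sum_fiber_card_neq0 sm.
  have -> : m%:R ^+ nvals chi = \prod_(k | k != 0) if (0 < b k)%N then m%:R else 1 :> F.
    by rewrite /nvals -sum1dep_card -prodrXr big_mkcondr.
  rewrite -big_split; apply: ler_prod => k k0 /=.
  have bm : (b k <= m)%N by rewrite -sm fiber_card_le_supp.
  move: (b k) bm => [|c] bm; first by rewrite /= !expr0 fact0 expr1n !mulr1 ler01 lexx.
  have c0 : 0 < c.+1%:R :> F by rewrite ltr0n.
  rewrite /= !mulr_ge0 ?exprn_ge0 ?divr_ge0 ?ler0n //=.
  apply: le_trans (_ : (c.+1%:R ^+ c.+1) ^+ 2 * (nF / c.+1%:R) ^+ c.+1 * m%:R <= _).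
    rewrite !ler_wpM2r ?ler0n ?exprn_ge0 ?divr_ge0 // lerXn2r ?nnegrE ?ler0n ?exprn_ge0 //.
    by rewrite -natrX ler_nat fact_le_expn.
  have -> : (c.+1%:R ^+ c.+1) ^+ 2 * (nF / c.+1%:R) ^+ c.+1 * m%:R =
     (c.+1 ^ c.+1 * m)%:R * nF ^+ c.+1.
    rewrite natrM natrX expr_div_n expr2; field; by rewrite expf_neq0 // gt_eqF.
  rewrite [leRHS]exprMn ler_pM2r ?exprn_gt0 // -[2]/(2%:R) -natrM -natrX ler_nat.
  exact: expn_self_le.
rewrite (bigD1 0) //= /b fiber_card0 sm -/b in B.
apply: le_trans (ler_wpM2r (exprn_ge0 _ (ler0n _ _)) B) _.
have -> : (8 * E / nF) ^+ m * m%:R ^+ m =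
    ((2 / nF) ^+ m) ^+ 2 * E ^+ m * (2 * m%:R * nF) ^+ m.
  rewrite -exprM [(m * 2)%N]mulnC exprM -!exprMn; congr (_ ^+ _); field.
  by rewrite gt_eqF.
set P := \prod_(k | k != 0) _ in pm *.
have -> : (n`!)%:R ^- 2 * (((n - m)`!)%:R ^+ 2 * (nF / (n - m)%:R) ^+ (n - m) * P) *
    m%:R ^+ nvals chi = (((n - m)`!)%:R / (n`!)%:R) ^+ 2 *
    (nF / (n - m)%:R) ^+ (n - m) * (P * m%:R ^+ nvals chi).
  by field; rewrite !gt_eqF.
have P0 : 0 <= P.
  by apply: prodr_ge0 => k _; rewrite mulr_ge0 ?exprn_ge0 ?divr_ge0 ?ler0n.
have d0 : 0 <= ((n - m)`!)%:R / (n`!)%:R :> F by rewrite divr_ge0 ?ler0n.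
have q0 : 0 <= nF / (n - m)%:R by rewrite divr_ge0 ?ler0n.
apply: ler_pM; rewrite ?mulr_ge0 ?exprn_ge0 ?invr_ge0 ?ler0n //.
apply: ler_pM; rewrite ?exprn_ge0 //.
by apply: lerXn2r; rewrite ?nnegrE ?exprn_ge0 ?divr_ge0 ?ler0n.
Qed.
End Sparse.

Section Geometric.
Variable F : realFieldType.

(** A fourth power: three factors [(19 / 20) ^ a] absorb [a ^ 3] and the last one is summed. The
    value, about 0.81, must exceed [1 / sqrt 2] for [entropy_base] to exceed 1. *)
Definition cube_ratio : F := (19 / 20) ^+ 4.

Lemma sum_geo N : \sum_(j < N) (19 / 20 : F) ^+ j <= 20.
Proof.
have h : 1 - (19 / 20) ^+ N = (1 - 19 / 20 : F) * \sum_(j < N) (19 / 20) ^+ j.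
  by have := subrX1 (19 / 20 : F) N; lra.
have : 0 <= (19 / 20 : F) ^+ N by rewrite exprn_ge0 //; lra.
lra.
Qed.

Lemma sum_cube_geo N : \sum_(a < N) a%:R ^+ 3 * cube_ratio ^+ a <= 20 ^+ 4.
Proof.
have s0 : 0 <= 19 / 20 :> F by lra.
have h a : a%:R * (19 / 20 : F) ^+ a <= 20.
  apply: le_trans (sum_geo a); rewrite mulr_natl.
  have -> : (19 / 20 : F) ^+ a *+ a = \sum_(j < a) (19 / 20) ^+ a.
    by rewrite sumr_const card_ord.
  apply: ler_sum => j _; apply: ler_wiXn2l => //; first lra.
  exact: ltnW.
apply: le_trans (_ : \sum_(a < N) 20 ^+ 3 * (19 / 20) ^+ a <= _).
  apply: ler_sum => a _; have -> : a%:R ^+ 3 * cube_ratio ^+ a =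
      (a%:R * (19 / 20) ^+ a) ^+ 3 * (19 / 20) ^+ a.
    by rewrite /cube_ratio exprAC; ring.
  rewrite ler_wpM2r ?exprn_ge0 //.
  by apply: lerXn2r; rewrite ?nnegrE ?mulr_ge0 ?exprn_ge0 ?ler0n.
by rewrite -mulr_sumr [leRHS]exprSr ler_wpM2l ?exprn_ge0 // sum_geo.
Qed.

Lemma sqr_le_self (x y : F) : 1 <= y -> x ^+ 2 <= y -> x <= y.
Proof. by move=> y1 xy; rewrite leNgt; apply/negP => h; nra. Qed.

End Geometric.

(** * The sup bound multiplied by the mass *)

Section Regimes.
Variables (F : realType) (G K : finZmodType) (e : pairing F[i] G K).
Implicit Types (k : K) (chi g : {ffun G -> K}).
Local Notation n := #|G|.
Local Notation E := (expR 1 : F).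
Local Notation nF := (n%:R : F).
Local Notation D := (72 * E ^+ 2).
Local Notation B := (20 ^+ 4 : F).

Lemma D_ge1 : 1 <= D.
Proof. by have := @expR_gt1 F 1; rewrite ltr01 => h; nra. Qed.

(** The [n ^- m] of [abs_avg_supp] cancels the [n ^ m] of the squared mass, and
    [m ^ m / m! <= E ^ m]. The constant is [72 * E ^ 2 = (8 * E) * 9 * E]. *)
Lemma abs_avg_abs_mass2 chi m : #|supp chi| = m -> (2 * m <= n)%N ->
  (abs_avg e chi * abs_mass e 2 m) ^+ 2 * m%:R ^+ nvals chi <= D ^+ m.
Proof.
move=> sm mn; have n0 : 0 < nF := nF_gt0 F G.
have E0 : 0 < E := expR_gt0 _.
have f0 : 0 < (m`!)%:R :> F by rewrite ltr0n fact_gt0.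
have r2 : abs_mass e 2 m ^+ 2 * (m%:R / E) ^+ m <= (9 * nF) ^+ m.
  apply: le_trans (_ : (3 ^+ m * Num.sqrt (nF ^+ m / (m`!)%:R)) ^+ 2 * (m`!)%:R <= _).
    apply: ler_pM; rewrite ?exprn_ge0 ?divr_ge0 ?ler0n ?abs_mass_ge0 ?(ltW E0) ?fact_ge //.
    apply: lerXn2r; rewrite ?nnegrE ?mulr_ge0 ?exprn_ge0 ?sqrtr_ge0 ?abs_mass_ge0 //.
    by apply: abs_mass2_le; lia.
  rewrite exprMn sqr_sqrtr ?divr_ge0 ?exprn_ge0 ?ler0n // mulrA divfK ?gt_eqF //.
  by rewrite -exprM mulnC exprM -exprMn; have -> : 3 ^+ 2 = 9 :> F by ring.
apply: le_trans (_ : (abs_avg e chi ^+ 2 * m%:R ^+ nvals chi) * abs_mass e 2 m ^+ 2 <= _).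
  by rewrite le_eqVlt; apply/orP; left; apply/eqP; ring.
apply: le_trans (ler_wpM2r _ (abs_avg_supp e sm mn)) _; first by rewrite exprn_ge0 ?abs_mass_ge0.
have -> : (8 * E / nF) ^+ m * m%:R ^+ m * abs_mass e 2 m ^+ 2 =
    (8 * E ^+ 2 / nF) ^+ m * (abs_mass e 2 m ^+ 2 * (m%:R / E) ^+ m).
  rewrite [RHS]mulrCA [RHS]mulrC -!exprMn; congr (_ ^+ _ * _); field.
  by rewrite !gt_eqF.
apply: le_trans (ler_wpM2l _ r2) _.
  by rewrite exprn_ge0 // divr_ge0 ?ler0n // mulr_ge0 ?exprn_ge0 ?(ltW E0).
rewrite -exprMn le_eqVlt; apply/orP; left; apply/eqP; congr (_ ^+ _); field.
by rewrite gt_eqF.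
Qed.

(** One factor of the cube is bounded by its supremum on [P] and the other two are summed to the
    mass. If the mass vanishes, so does every average. *)
Lemma sum_abs_avg3_sup (P : pred {ffun G -> K}) m b : 0 <= b ->
  (forall chi, #|supp chi| = m -> P chi -> abs_avg e chi * abs_mass e 2 m <= b) ->
  \sum_(chi : {ffun G -> K} | (#|supp chi| == m) && P chi) abs_avg e chi ^+ 3 <= b.
Proof.
move=> b0 h; have [S0|S0] := eqVneq (abs_mass e 2 m) 0.
  rewrite big1 // => chi /andP[sm _].
  move/eqP: S0; rewrite psumr_eq0 => [/allP/(_ chi)|? _]; last by rewrite exprn_ge0 ?abs_avg_ge0.
  by rewrite mem_index_enum sm /= expf_eq0 => /(_ isT) /= /eqP->; rewrite expr0n.
have Sp : 0 < abs_mass e 2 m by rewrite lt_def S0 abs_mass_ge0.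
rewrite -(ler_pM2r Sp) mulr_suml.
apply: le_trans (_ : \sum_(chi : {ffun G -> K} | (#|supp chi| == m) && P chi) b * abs_avg e chi ^+ 2 <= _).
  apply: ler_sum => chi /andP[/eqP sm Pc].
  by rewrite exprSr -mulrA mulrC ler_wpM2r ?exprn_ge0 ?abs_avg_ge0 // h.
rewrite -mulr_sumr ler_wpM2l // big_mkcondr; apply: ler_sum => chi _.
by case: (P chi) => //; rewrite exprn_ge0 ?abs_avg_ge0.
Qed.

(** A bound free of [n], which makes the error of the cubed recursion vanish for fixed [m]. *)
Lemma abs_mass3_le m : (2 * m <= n)%N -> abs_mass e 3 m <= D ^+ m.
Proof.
move=> mn; case: m mn => [|m] mn; first by rewrite abs_mass_0 expr0.
have D1 : 1 <= D ^+ m.+1 by rewrite exprn_ege1 // D_ge1.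
rewrite /abs_mass -(eq_bigl _ _ (fun chi => andbT _)).
apply: sum_abs_avg3_sup => [|chi sm _]; first by apply: le_trans D1.
apply: sqr_le_self => //; apply: le_trans (abs_avg_abs_mass2 sm mn).
by rewrite ler_peMr ?sqr_ge0 // exprn_ege1 // ler1n.
Qed.

(** With [m >= (4 * D) ^ 5] and [m / 5] values, [m ^ nvals chi >= (4 * D) ^ m], which turns [D ^ m]
    into [4 ^- m]. *)
Lemma many_values m : (4 * D) ^+ 5 <= m%:R -> (2 * m <= n)%N ->
  \sum_(chi : {ffun G -> K} | (#|supp chi| == m) && (m <= 5 * nvals chi)%N)
     abs_avg e chi ^+ 3 <= 2^-1 ^+ m.
Proof.
move=> mD mn; have D1 := D_ge1.
have D4 : 1 <= 4 * D by lra.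
apply: sum_abs_avg3_sup => [|chi sm r5]; first by rewrite exprn_ge0 // invr_ge0.
have nn0 : 0 <= abs_avg e chi * abs_mass e 2 m by rewrite mulr_ge0 ?abs_avg_ge0 ?abs_mass_ge0.
rewrite -(@ler_pXn2r _ 2) ?nnegrE ?exprn_ge0 ?invr_ge0 //.
have Dm : 0 < D ^+ m by rewrite exprn_gt0 //; lra.
rewrite -(ler_pM2r Dm); have := abs_avg_abs_mass2 sm mn.
have -> : (2^-1 ^+ m) ^+ 2 * D ^+ m = D ^+ m / 4 ^+ m :> F.
  by rewrite mulrC -!exprM mulnC exprM -exprVn; congr (_ * _ ^+ _); field.
rewrite ler_pdivlMr ?exprn_gt0 // => h; rewrite -[_ * _ * 4 ^+ m]mulrA -[D ^+ m * 4 ^+ m]exprMn.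
apply: le_trans h; rewrite ler_wpM2l ?sqr_ge0 //.
apply: le_trans (_ : (4 * D) ^+ (5 * nvals chi) <= _).
  by rewrite mulrC; apply: ler_weXn2l.
by rewrite exprM; apply: lerXn2r; rewrite ?nnegrE ?ler0n ?exprn_ge0 //; lra.
Qed.
End Regimes.

(** * Weighted sums of the cubed permanent bound *)

Section Entropy.
Variables (F : realType) (G K : finZmodType) (e : pairing F[i] G K).
Implicit Types (k : K) (chi g : {ffun G -> K}).
Local Notation n := #|G|.
Local Notation E := (expR 1 : F).
Local Notation nF := (n%:R : F).
Local Notation B := (20 ^+ 4 : F).
Local Notation q := (cube_ratio F).
Local Notation tau := (entropy_wt F G).

(* Any base in [(1, sqrt 2)] would do: [cube_ratio < 1] makes [sum a^3 q^a] converge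
   and [entropy_base > 1] gives the exponential decay in the support size. *)
Definition entropy_base : F := q * Num.sqrt 2.

Lemma cube_ratio_gt0 : 0 < q. Proof. by rewrite exprn_gt0 //; lra. Qed.

Lemma cube_ratio_ge : 81 / 100 <= q.
Proof.
have -> : 81 / 100 = (9 / 10) ^+ 2 :> F by field.
have -> : q = ((19 / 20) ^+ 2) ^+ 2 by rewrite -exprM.
apply: lerXn2r; rewrite ?nnegrE ?expr2; lra.
Qed.

Lemma entropy_base_gt1 : 1 < entropy_base.
Proof.
have s2 : Num.sqrt 2 ^+ 2 = 2 :> F by rewrite sqr_sqrtr.
have z0 : 0 < entropy_base by rewrite mulr_gt0 ?cube_ratio_gt0 // sqrtr_gt0.
have : entropy_base ^+ 2 = q ^+ 2 * 2 by rewrite exprMn s2.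
have := cube_ratio_ge; move: q => r hr h.
have r2 : 65 / 100 <= r ^+ 2 by nra.
by nra.
Qed.

Lemma cube_geo_ge0 a : 0 <= a%:R ^+ 3 * q ^+ a.
Proof. by apply: mulr_ge0; apply: exprn_ge0; [exact: ler0n | exact: ltW cube_ratio_gt0]. Qed.

Lemma sum_le_geo (v : nat -> F) (c : F) : 0 <= c -> v 0%N <= 1 ->
  (forall a, (0 < a <= n)%N -> v a <= c * (a%:R ^+ 3 * q ^+ a)) ->
  \sum_(a < n.+1) v a <= 1 + c * B.
Proof.
move=> c0 v0 h; rewrite big_ord_recl; apply: lerD => //.
apply: le_trans (ler_wpM2l c0 (sum_cube_geo F n.+1)).
rewrite [X in _ <= _ * X]big_ord_recl expr0n mul0r add0r mulr_sumr.
by apply: ler_sum => a _; apply: h; rewrite lift0 /=.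
Qed.

(** For [2 * a <= n] the base [sqrt (2 * a / n)] is at most 1, so its [a]-th power is at most its
    first power. The single [1 / sqrt n] gained is what leads to [exp(O(sqrt n))] after the product
    over [n] characters. *)
Lemma tau_cube a : (0 < a)%N -> (2 * a <= n)%N ->
  tau a * entropy_base ^+ a <= 2 * E ^+ 2 / Num.sqrt nF * (a%:R ^+ 3 * q ^+ a).
Proof.
move=> a0 an; have n0 : 0 < nF := nF_gt0 F G.
have sn : 0 < Num.sqrt nF by rewrite sqrtr_gt0.
have aF : 0 < a%:R :> F by rewrite ltr0n.
have h : Num.sqrt (2 * a%:R / nF) ^+ a <= 2 * a%:R / Num.sqrt nF.
  have x1 : 2 * a%:R / nF <= 1 by rewrite ler_pdivrMr // mul1r -natrM ler_nat.
  have x0 : 0 <= 2 * a%:R / nF by rewrite divr_ge0 ?mulr_ge0 ?ler0n.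
  apply: le_trans (_ : Num.sqrt (2 * a%:R / nF) <= _).
    rewrite -[leRHS]expr1; apply: ler_wiXn2l => //; first exact: sqrtr_ge0.
    by rewrite -[leRHS]sqrtr1 ler_sqrt.
  rewrite ler_pdivlMr // -sqrtrM // divfK ?gt_eqF //.
  have y1 : 1 <= 2 * a%:R :> F by rewrite -natrM ler1n; lia.
  have y0 : 0 <= 2 * a%:R :> F by lra.
  rewrite -[leRHS]ger0_norm // -sqrtr_sqr ler_sqrt ?sqr_ge0 //.
  by rewrite expr2 ler_peMr.
rewrite /entropy_wt /entropy_base -[a == _]negbK -lt0n a0 /=.
have -> : E ^+ 2 * a%:R ^+ 2 * Num.sqrt (a%:R / nF) ^+ a * (q * Num.sqrt 2) ^+ a =
    E ^+ 2 * a%:R ^+ 2 * q ^+ a * Num.sqrt (2 * a%:R / nF) ^+ a.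
  by rewrite -[2 * _ / _]mulrA [in RHS]sqrtrM // !exprMn; ring.
have -> : 2 * E ^+ 2 / Num.sqrt nF * (a%:R ^+ 3 * q ^+ a) =
    E ^+ 2 * a%:R ^+ 2 * q ^+ a * (2 * a%:R / Num.sqrt nF) by ring.
rewrite ler_wpM2l //; do 2?apply: mulr_ge0; apply: exprn_ge0.
- exact: expR_ge0.
- exact: ler0n.
- exact: ltW cube_ratio_gt0.
Qed.

Lemma prod_le_exp (P : pred K) (v : K -> F) (x : F) : 0 <= x ->
  (forall k, P k -> 0 <= v k <= 1 + x) -> \prod_(k | P k) v k <= expR (nF * x).
Proof.
move=> x0 h; apply: le_trans (_ : \prod_(k | P k) expR x <= _).
  by apply: ler_prod => k /h /andP[-> /le_trans]; apply; exact: expR_ge1Dx.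
rewrite prodr_const expRM_natl; apply: ler_weXn2l; last first.
  by rewrite -(card_dual e) max_card.
by rewrite -[leLHS]expR0 ler_expR.
Qed.

(** As a marker in [sum_abs_avg3], it excludes majority values and multiplies up to a power of
    [entropy_base]. *)
Let u (a : nat) : F := if (2 * a <= n)%N then entropy_base ^+ a else 0.

Let u_ge0 a : 0 <= u a.
Proof.
by rewrite /u; case: ifP => // _; rewrite exprn_ge0 // ltW // (lt_trans _ entropy_base_gt1).
Qed.

Let Cent : F := 2 * E ^+ 2 * B / Num.sqrt nF.

Let Cent_ge0 : 0 <= Cent.
Proof. by rewrite divr_ge0 ?sqrtr_ge0 // !mulr_ge0 ?exprn_ge0 ?expR_ge0. Qed.

Let sum_u : 0 <= \sum_(a < n.+1) u a * tau a <= 1 + Cent.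
Proof.
apply/andP; split; first by apply: sumr_ge0 => a _; rewrite mulr_ge0 ?u_ge0 ?entropy_wt_ge0.
have -> : Cent = 2 * E ^+ 2 / Num.sqrt nF * B by rewrite /Cent; ring.
apply: (@sum_le_geo (fun a => u a * tau a)); first by rewrite divr_ge0 ?sqrtr_ge0 // mulr_ge0 ?exprn_ge0 ?expR_ge0.
  by rewrite /u muln0 expr0 /entropy_wt mulr1.
move=> a /andP[a0 _]; rewrite /u; case: ifP => [an|_]; first by rewrite mulrC tau_cube.
rewrite mul0r mulr_ge0 ?cube_geo_ge0 // divr_ge0 ?sqrtr_ge0 //.
by rewrite mulr_ge0 ?exprn_ge0 ?expR_ge0.
Qed.

Lemma no_majority :
  (\sum_(chi : {ffun G -> K} | [forall k, 2 * fiber_card chi k <= n]%N) abs_avg e chi ^+ 3)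
    * entropy_base ^+ n <= expR (2 * E ^+ 2 * B * Num.sqrt nF).
Proof.
have n0 : 0 < nF := nF_gt0 F G.
have -> : 2 * E ^+ 2 * B * Num.sqrt nF = nF * Cent.
  rewrite /Cent -{2}[nF]sqr_sqrtr ?ltW //; field.
  by rewrite gt_eqF // sqrtr_gt0.
apply: le_trans (_ : \prod_k \sum_(a < n.+1) u a * tau a <= _); last first.
  by apply: prod_le_exp => // k _; exact: sum_u.
apply: le_trans (sum_abs_avg3 e (u := fun _ => u) _); last by move=> k a; exact: u_ge0.
rewrite big_mkcond mulr_suml; apply: ler_sum => chi _; case: forallP => [h|_]; last first.
  by rewrite mul0r mulr_ge0 ?exprn_ge0 ?abs_avg_ge0 // prodr_ge0.
rewrite -(sum_fiber_card chi) -prodrXr; apply: ler_wpM2l; first by rewrite exprn_ge0 ?abs_avg_ge0.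
by under [leRHS]eq_bigr do rewrite /u h.
Qed.

Lemma tau_le a : (0 < a <= n)%N -> tau a <= E ^+ 2 * nF ^+ 2.
Proof.
move=> /andP[a0 an]; have n0 : 0 < nF := nF_gt0 F G.
rewrite /entropy_wt -[a == _]negbK -lt0n a0 /= -mulrA ler_wpM2l ?exprn_ge0 ?expR_ge0 //.
rewrite -[leRHS]mulr1; apply: ler_pM; rewrite ?exprn_ge0 ?ler0n ?sqrtr_ge0 //.
  by rewrite lerXn2r ?nnegrE ?ler0n // ler_nat.
rewrite exprn_ile1 ?sqrtr_ge0 // -[leRHS]sqrtr1 ler_sqrt //.
by rewrite ler_pdivrMr // mul1r ler_nat.
Qed.

Lemma sum_at m : (m < n)%N ->
  \sum_(a < n.+1) (a == n - m :> nat)%N%:R * tau a <= E ^+ 2 * nF ^+ 2.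
Proof.
move=> mn; have h : (n - m < n.+1)%N by rewrite ltnS leq_subr.
rewrite (bigD1 (Ordinal h)) //= eqxx mul1r big1 => [|a /negPf ha].
  by rewrite addr0 tau_le // subn_gt0 mn leq_subr.
by rewrite -[(a == _ :> nat)%N]/(a == Ordinal h) ha mul0r.
Qed.

(** The trivial character gets the indicator of multiplicity [n - m], costing [O(n ^ 2)]. The others
    get the marker [u], never zero here because their multiplicities are at most [m < n / 2] and add
    up to [m]. *)
Lemma abs_mass3_entropy m : (2 * m < n)%N ->
  abs_mass e 3 m * entropy_base ^+ m <= E ^+ 2 * nF ^+ 2 * expR (2 * E ^+ 2 * B * Num.sqrt nF).
Proof.
move=> mn; have n0 : 0 < nF := nF_gt0 F G.
have -> : 2 * E ^+ 2 * B * Num.sqrt nF = nF * Cent.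
  rewrite /Cent -{2}[nF]sqr_sqrtr ?ltW //; field.
  by rewrite gt_eqF // sqrtr_gt0.
pose v k a : F := if k == 0 then (a == n - m)%N%:R else u a.
have v0 k a : 0 <= v k a by rewrite /v; case: ifP.
apply: le_trans (_ : \prod_k \sum_(a < n.+1) v k a * tau a <= _); last first.
  rewrite (bigD1 0) //= /v eqxx; apply: ler_pM.
  - by apply: sumr_ge0 => a _; rewrite mulr_ge0 ?entropy_wt_ge0.
  - by apply: prodr_ge0 => k _; apply: sumr_ge0 => a _; rewrite mulr_ge0 ?entropy_wt_ge0 //; exact: v0.
  - by apply: sum_at; lia.
  - by apply: prod_le_exp => // k /negPf k0; rewrite k0 sum_u.
apply: le_trans (sum_abs_avg3 e v0).
rewrite /abs_mass big_mkcond mulr_suml; apply: ler_sum => chi _; case: eqP => [sm|_]; last first.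
  by rewrite mul0r mulr_ge0 ?exprn_ge0 ?abs_avg_ge0 // prodr_ge0.
apply: ler_wpM2l; first by rewrite exprn_ge0 ?abs_avg_ge0.
rewrite (bigD1 0) //= {1}/v eqxx fiber_card0 sm eqxx mul1r.
rewrite -[in leLHS]sm -sum_fiber_card_neq0 -prodrXr.
rewrite le_eqVlt; apply/orP; left; apply/eqP; apply: eq_bigr => k k0.
rewrite /v (negPf k0) /u; case: ifP => //; have := fiber_card_le_supp chi k0; lia.
Qed.

(** Each nontrivial value present is weighted by an extra [1 / n], so that a character contributes
    [1 + O(1 / n)] and the product over [K] stays bounded. Undoing these weights costs
    [n ^ nvals chi <= n ^ (m %/ 5)]. *)
Lemma few_values m : (0 < m)%N -> (2 * m < n)%N ->
  \sum_(chi : {ffun G -> K} | (#|supp chi| == m) && (5 * nvals chi <= m)%N)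
     abs_avg e chi ^+ 3 <=
  E ^+ 2 * nF ^+ 2 * expR (E ^+ 2 * B) * (nF ^+ (m %/ 5) * (2 * Num.sqrt (m%:R / nF)) ^+ m).
Proof.
move=> m0 mn; have n0 : 0 < nF := nF_gt0 F G.
have mF : 0 < m%:R :> F by rewrite ltr0n.
(* Chosen so that [z * sqrt (a / n) <= 1 / 2 <= cube_ratio] whenever [a <= m]. *)
have [z [z0 zD]] : exists z : F, 0 < z /\ z = Num.sqrt (nF / m%:R) / 2.
  by exists (Num.sqrt (nF / m%:R) / 2); rewrite divr_gt0 // sqrtr_gt0 divr_gt0.
have zE : (2 * Num.sqrt (m%:R / nF)) = z^-1.
  by rewrite zD -invf_div sqrtrV ?divr_ge0 ?ler0n // invf_div.
pose w a : F := if a == 0%N then 1 else if (a <= m)%N then z ^+ a / nF else 0.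
have w0 a : 0 <= w a.
  by rewrite /w; do 2 case: ifP => //; rewrite divr_ge0 ?exprn_ge0 ?(ltW z0) ?ler0n.
pose v k a : F := if k == 0 then (a == n - m)%N%:R else w a.
have v0 k a : 0 <= v k a by rewrite /v; case: ifP.
have sw : 0 <= \sum_(a < n.+1) w a * tau a <= 1 + E ^+ 2 / nF * B.
  apply/andP; split; first by apply: sumr_ge0 => a _; rewrite mulr_ge0 ?entropy_wt_ge0.
  apply: (@sum_le_geo (fun a => w a * tau a)); first by rewrite divr_ge0 ?exprn_ge0 ?expR_ge0 ?ler0n.
    by rewrite /w /entropy_wt mulr1.
  move=> a /andP[a0 an]; rewrite /w -[a == 0%N]negbK -lt0n a0 /=.
  case: ifP => [am|_]; last first.
    by rewrite mul0r mulr_ge0 ?cube_geo_ge0 // divr_ge0 ?exprn_ge0 ?expR_ge0 ?ler0n.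
  rewrite /entropy_wt -[a == 0%N]negbK -lt0n a0 /=.
  have -> : z ^+ a / nF * (E ^+ 2 * a%:R ^+ 2 * Num.sqrt (a%:R / nF) ^+ a) =
     E ^+ 2 / nF * (a%:R ^+ 2 * (z * Num.sqrt (a%:R / nF)) ^+ a).
    by rewrite [(z * _) ^+ a]exprMn; ring.
  rewrite ler_wpM2l ?divr_ge0 ?exprn_ge0 ?expR_ge0 ?ler0n //.
  apply: ler_pM; rewrite ?exprn_ge0 ?mulr_ge0 ?sqrtr_ge0 ?(ltW z0) //.
    by rewrite -!natrX ler_nat leq_pexp2l.
  apply: lerXn2r; rewrite ?nnegrE.
  - by rewrite mulr_ge0 ?sqrtr_ge0 ?(ltW z0).
  - exact: ltW cube_ratio_gt0.
  apply: le_trans (_ : 2^-1 <= _); last by apply: le_trans cube_ratio_ge; lra.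
  rewrite zD mulrAC -sqrtrM ?divr_ge0 ?ler0n // -[leRHS]mul1r ler_pM2r ?invr_gt0 //.
  rewrite -[leRHS]sqrtr1 ler_sqrt //.
  have -> : nF / m%:R * (a%:R / nF) = a%:R / m%:R by field; rewrite !gt_eqF.
  by rewrite ler_pdivrMr // mul1r ler_nat.
rewrite zE exprVn mulrA ler_pdivlMr ?exprn_gt0 //.
apply: le_trans (_ : nF ^+ (m %/ 5) * \prod_k \sum_(a < n.+1) v k a * tau a <= _); last first.
  rewrite [leLHS]mulrC ler_pM2r ?exprn_gt0 //.
  rewrite (bigD1 0) //= /v eqxx; apply: ler_pM.
  - by apply: sumr_ge0 => a _; rewrite mulr_ge0 ?entropy_wt_ge0.
  - by apply: prodr_ge0 => k _; apply: sumr_ge0 => a _; rewrite mulr_ge0 ?entropy_wt_ge0 //; exact: v0.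
  - by apply: sum_at; lia.
  have -> : E ^+ 2 * B = nF * (E ^+ 2 / nF * B) by field; rewrite gt_eqF.
  apply: prod_le_exp => [|k /negPf k0]; last by rewrite k0 sw.
  by rewrite mulr_ge0 ?divr_ge0 ?exprn_ge0 ?expR_ge0 ?ler0n.
apply: le_trans (ler_wpM2l (exprn_ge0 _ (ltW n0)) (sum_abs_avg3 e v0)).
rewrite big_mkcond mulr_suml mulr_sumr; apply: ler_sum => chi _.
case: ifP => [/andP[/eqP sm r5]|_]; last first.
  by rewrite mul0r !mulr_ge0 ?exprn_ge0 ?abs_avg_ge0 ?ler0n // prodr_ge0.
rewrite [leRHS]mulrCA ler_wpM2l ?exprn_ge0 ?abs_avg_ge0 //.
rewrite (bigD1 0) //= {1}/v eqxx fiber_card0 sm eqxx mul1r.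
have -> : \prod_(k | k != 0) v k (fiber_card chi k) = z ^+ m / nF ^+ nvals chi.
  rewrite -exprVn -[in RHS]sm -sum_fiber_card_neq0 -prodrXr.
  rewrite /nvals -sum1dep_card -prodrXr big_mkcondr -big_split.
  apply: eq_bigr => k k0 /=; rewrite /v (negPf k0) /w lt0n.
  have := fiber_card_le_supp chi k0; rewrite sm => cm.
  case: eqP => [->|_] /=; first by rewrite expr0 mulr1.
  by rewrite cm expr1.
rewrite mulrA ler_pdivlMr ?exprn_gt0 // [leRHS]mulrC ler_pM2l ?exprn_gt0 //.
by apply: ler_weXn2l; rewrite ?ler1n ?card_zmod_gt0 // leq_divRL // mulnC.
Qed.

End Entropy.

(** * Asymptotics for bounded support *)

Section RealValuedNorm.
Variable F : realType.
Implicit Types z w : F[i].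

Definition cabs z : F := complex.Re `|z|.

Lemma cabsE z : `|z| = real_complex F (cabs z).
Proof. by rewrite /cabs RRe_real // normr_real. Qed.

Lemma cabs_ge0 z : 0 <= cabs z. Proof. by rewrite -ler0c -cabsE. Qed.

Lemma cabsM z w : cabs (z * w) = cabs z * cabs w.
Proof. by apply: (@complexI F); rewrite rmorphM /= -!cabsE normrM. Qed.

Lemma cabsX z m : cabs (z ^+ m) = cabs z ^+ m.
Proof. by apply: (@complexI F); rewrite rmorphXn /= -!cabsE normrX. Qed.

Lemma cabsN z : cabs (- z) = cabs z.
Proof. by rewrite /cabs normrN. Qed.

Lemma cabs_real (x : F) : cabs (real_complex F x) = `|x|.
Proof. by apply: (@complexI F); rewrite -cabsE normc_def /= expr0n addr0 sqrtr_sqr. Qed.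

Lemma cabs_nat m : cabs m%:R = m%:R.
Proof. by rewrite -(rmorph_nat (real_complex F)) cabs_real normr_nat. Qed.

Lemma cabs0 : cabs 0 = 0. Proof. exact: (cabs_nat 0). Qed.

Lemma cabsD_le z w : cabs (z + w) <= cabs z + cabs w.
Proof. by rewrite -lecR rmorphD /= -!cabsE ler_normD. Qed.

Lemma cabsB_le z w : cabs (z - w) <= cabs z + cabs w.
Proof. by rewrite -(cabsN w) cabsD_le. Qed.

Lemma cabs_sum_le (I : finType) (P : pred I) (z : I -> F[i]) :
  cabs (\sum_(i | P i) z i) <= \sum_(i | P i) cabs (z i).
Proof.
elim/big_ind2: _ => [|x a y b xa yb|//]; first by rewrite cabs0.
by apply: le_trans (cabsD_le _ _) (lerD xa yb).
Qed.

Lemma cube_sum_le (I : finType) (A : {pred I}) (x : I -> F) N :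
  (forall i, 0 <= x i) -> (#|A| <= N)%N ->
  (\sum_(i in A) x i) ^+ 3 <= N%:R ^+ 3 * \sum_(i in A) x i ^+ 3.
Proof.
move=> x0 AN; have [i0 iA|A0] := pickP (mem A); last first.
  by rewrite !big_pred0 // expr0n mulr0.
have [i1 i1A max] := arg_maxP x iA.
apply: le_trans (_ : (N%:R * x i1) ^+ 3 <= _).
  apply: lerXn2r; rewrite ?nnegrE ?mulr_ge0 ?ler0n ?sumr_ge0 //.
  apply: le_trans (_ : \sum_(i in A) x i1 <= _); first by apply: ler_sum => i /max.
  by rewrite sumr_const -[leLHS]mulr_natl ler_wpM2r // ler_nat.
rewrite exprMn ler_wpM2l ?exprn_ge0 ?ler0n //.
by rewrite (bigD1 i1) //= lerDl sumr_ge0 // => i _; rewrite exprn_ge0.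
Qed.

(** Expand the cube and compare [|r|] with [dl * |u|]; the coefficients 3, 3, 1 add up to 7. *)
Lemma cubeD_diff u r (dl : F) : 0 < dl <= 1 ->
  cabs ((u + r) ^+ 3 - u ^+ 3) <= 7 * dl * cabs u ^+ 3 + 7 / dl ^+ 2 * cabs r ^+ 3.
Proof.
move=> /andP[d0 d1].
have h : cabs ((u + r) ^+ 3 - u ^+ 3) <= 3 * cabs u ^+ 2 * cabs r + 3 * cabs u * cabs r ^+ 2 + cabs r ^+ 3.
  have -> : (u + r) ^+ 3 - u ^+ 3 = 3%:R * u ^+ 2 * r + 3%:R * u * r ^+ 2 + r ^+ 3 by ring.
  apply: le_trans (cabsD_le _ _) _; rewrite cabsX lerD2r.
  by apply: le_trans (cabsD_le _ _) _; rewrite !cabsM !cabs_nat !expr2.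
apply: le_trans h _; move: (cabs u) (cabs r) (cabs_ge0 u) (cabs_ge0 r) => a b a0 b0.
have [ba|ab] := leP b (dl * a).
  apply: le_trans (_ : 7 * dl * a ^+ 3 <= _); last first.
    by rewrite lerDl !mulr_ge0 ?invr_ge0 ?exprn_ge0 ?(ltW d0).
  have ba1 : b <= a by nra.
  have t1 : a ^+ 2 * b <= dl * a ^+ 3 by rewrite [a ^+ 3]exprSr mulrCA ler_wpM2l ?exprn_ge0.
  have t2 : a * b ^+ 2 <= a ^+ 2 * b.
    have : 0 <= a * b * (a - b) by rewrite !mulr_ge0 // subr_ge0.
    lra.
  have t3 : b ^+ 3 <= a * b ^+ 2 by rewrite [b ^+ 3]exprS ler_wpM2r ?exprn_ge0.
  lra.
apply: le_trans (_ : 7 / dl ^+ 2 * b ^+ 3 <= _); last first.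
  by rewrite lerDr !mulr_ge0 ?exprn_ge0 ?(ltW d0).
have ad : a <= b / dl by rewrite ler_pdivlMr // mulrC ltW.
have bd : b <= b / dl by rewrite ler_pdivlMr // ler_piMr.
move: ad bd; set c := b / dl => ad bd.
have -> : 7 / dl ^+ 2 * b ^+ 3 = 7 * (c ^+ 2 * b) by rewrite /c; field; rewrite gt_eqF.
have t1 : a ^+ 2 * b <= c ^+ 2 * b.
  by rewrite ler_wpM2r // lerXn2r ?nnegrE // (le_trans a0 ad).
have t2 : a * b ^+ 2 <= c ^+ 2 * b.
  by rewrite [b ^+ 2]expr2 mulrA ler_wpM2r // [c ^+ 2]expr2 ler_pM.
have t3 : b ^+ 3 <= c ^+ 2 * b.
  by rewrite [b ^+ 3]exprSr ler_wpM2r // lerXn2r ?nnegrE // (le_trans b0 bd).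
lra.
Qed.

(** Used on the targets [j] of a transfer, with [b] saying that the moved character cancels the one
    at [j]. The cube of the sum is replaced by the sum of the cubes over cancelling targets; the
    errors measure the size of [dl], the mergers, and simultaneous cancellations. *)
Lemma cube_sum_split (I : finType) (A : {set I}) (b : pred I) (z : I -> F[i])
    (N : nat) (dl : F) : 0 < dl <= 1 -> (#|A| <= N)%N ->
  cabs ((\sum_(i in A) z i) ^+ 3 - \sum_(i in A | b i) z i ^+ 3) <=
    7 * dl * N%:R ^+ 3 * \sum_(i in A | b i) cabs (z i) ^+ 3
  + 7 / dl ^+ 2 * N%:R ^+ 3 * \sum_(i in A | ~~ b i) cabs (z i) ^+ 3
  + 2 * N%:R ^+ 3 * \sum_(i in A | b i)
      cabs (z i) ^+ 3 * #|[set j in A | b j && (j != i)]|%:R.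
Proof.
move=> dl01 AN; have /andP[d0 d1] := dl01.
rewrite (bigID b) /=; set u := \sum_(i in A | b i) z i; set r := \sum_(i in A | ~~ b i) z i.
have power (c : pred I) : cabs (\sum_(i in A | c i) z i) ^+ 3 <=
    N%:R ^+ 3 * \sum_(i in A | c i) cabs (z i) ^+ 3.
  apply: le_trans (_ : (\sum_(i in A | c i) cabs (z i)) ^+ 3 <= _).
    by apply: lerXn2r; rewrite ?nnegrE ?cabs_ge0 ?cabs_sum_le ?sumr_ge0 // => i _; exact: cabs_ge0.
  have := @cube_sum_le I [pred i in A | c i] (fun i => cabs (z i)) N (fun i => cabs_ge0 _).
  apply; apply: leq_trans AN; apply: subset_leq_card; apply/subsetP => i.
  by rewrite inE => /andP[].
have -> : (u + r) ^+ 3 - \sum_(i in A | b i) z i ^+ 3 =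
   ((u + r) ^+ 3 - u ^+ 3) + (u ^+ 3 - \sum_(i in A | b i) z i ^+ 3) by ring.
apply: le_trans (cabsD_le _ _) _; apply: lerD.
  apply: le_trans (cubeD_diff u r dl01) _; apply: lerD.
    by rewrite -[leRHS]mulrA ler_wpM2l ?mulr_ge0 ?(ltW d0) // power.
  by rewrite -[leRHS]mulrA ler_wpM2l ?divr_ge0 ?exprn_ge0 ?(ltW d0) // power.
have N0 : 0 <= 2 * N%:R ^+ 3 :> F by rewrite mulr_ge0 ?exprn_ge0 ?ler0n.
(* With at most one index in [b] the two sides agree; otherwise each index has a companion, so the
   count in the last error term is at least 1. *)
have [le1|gt1] := leqP #|[set i in A | b i]| 1.
  suff -> : u ^+ 3 - \sum_(i in A | b i) z i ^+ 3 = 0.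
    by rewrite cabs0 mulr_ge0 // sumr_ge0 // => i _; rewrite mulr_ge0 ?exprn_ge0 ?cabs_ge0 ?ler0n.
  have E (T : nmodType) (h : I -> T) :
    \sum_(i in A | b i) h i = \sum_(i in [set i in A | b i]) h i.
    by apply: eq_bigl => i; rewrite inE.
  rewrite /u !E; move: le1; rewrite leq_eqVlt ltnS leqn0.
  case/orP => [/cards1P[i ->]|]; first by rewrite !big_set1 subrr.
  by rewrite cards_eq0 => /eqP->; rewrite !big_set0 expr0n subrr.
apply: le_trans (cabsB_le _ _) _; rewrite cabsX.
have N1 : 1 <= N%:R ^+ 3 :> F.
  rewrite exprn_ege1 // ler1n; apply: leq_trans AN; apply: leq_trans (ltnW gt1) _.
  by apply: subset_leq_card; apply/subsetP => i; rewrite inE => /andP[].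
have S0 : 0 <= \sum_(i in A | b i) cabs (z i) ^+ 3.
  by apply: sumr_ge0 => i _; rewrite exprn_ge0 ?cabs_ge0.
apply: le_trans (_ : 2 * N%:R ^+ 3 * \sum_(i in A | b i) cabs (z i) ^+ 3 <= _).
  have h1 := power b; rewrite -/u in h1.
  have h2 : cabs (\sum_(i in A | b i) z i ^+ 3) <= \sum_(i in A | b i) cabs (z i) ^+ 3.
    by apply: le_trans (cabs_sum_le _ _) _; apply: ler_sum => i _; rewrite cabsX.
  nra.
rewrite ler_wpM2l //; apply: ler_sum => i /andP[iA bi].
rewrite ler_peMr ?exprn_ge0 ?cabs_ge0 // ler1n.
have : (0 < #|[set i in A | b i] :\ i|)%N.
  by move: gt1; rewrite (cardsD1 i) inE iA bi.
rewrite !card_gt0; apply: contra_neq => h; apply/setP => j.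
by have /setP/(_ j) := h; rewrite !inE => <-; case: (_ == _); rewrite ?andbF ?andbT.
Qed.

End RealValuedNorm.

(** * Phases, and the cancelling and merging parts of a transfer sum *)

Section Phase.
Variables (F : realType) (G K : finZmodType) (e : pairing F[i] G K).
Implicit Types (k : K) (chi g : {ffun G -> K}) (f : {ffun G -> G}).
Local Notation n := #|G|.
Local Notation E := (expR 1 : F).
Local Notation nF := (n%:R : F).
Local Notation D := (72 * E ^+ 2).

Lemma sum_supp2_cancel (T : nmodType) m (h : {ffun G -> K} -> G -> G -> T) :
  \sum_(chi | #|supp chi| == m.+2) \sum_(i in supp chi)
    \sum_(j in supp chi :\ i | chi i + chi j == 0) h chi i j =
  \sum_(chi : {ffun G -> K} | #|supp chi| == m) \sum_(i | i \notin supp chi)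
    \sum_(j | (j \notin supp chi) && (j != i))
      \sum_(k | k != 0) h (untransfer chi i j k) i j.
Proof.
under eq_bigr do under eq_bigr do rewrite big_mkcondr.
rewrite sum_supp2 [X in _ + X]big1 ?addr0 => [|chi _].
  apply: eq_bigr => chi _; apply: eq_bigr => i si; apply: eq_bigr => j /andP[sj ji].
  rewrite !inE !negbK in si sj; rewrite eq_sym in ji.
  by apply: eq_bigr => k _; rewrite untransfer_at ?(eqP si) // untransfer_at2 // (eqP sj) addrC subrK eqxx.
rewrite big1 // => i si; rewrite big1 // => j sj; rewrite big1 // => k _.
rewrite !inE negbK in si sj; have ij : i != j by apply: contraNneq sj => <-.
by rewrite untransfer_at ?(eqP si) // untransfer_at2 // addrC subrK (negPf sj).
Qed.

Lemma sum_supp2_merge (T : nmodType) m (h : {ffun G -> K} -> G -> G -> T) :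
  \sum_(chi | #|supp chi| == m.+2) \sum_(i in supp chi)
    \sum_(j in supp chi :\ i | chi i + chi j != 0) h chi i j =
  \sum_(chi : {ffun G -> K} | #|supp chi| == m.+1) \sum_(i | i \notin supp chi)
    \sum_(j in supp chi) \sum_(k | (k != 0) && (k != chi j)) h (untransfer chi i j k) i j.
Proof.
under eq_bigr do under eq_bigr do rewrite big_mkcondr.
rewrite sum_supp2 [X in X + _]big1 ?add0r => [|chi _].
  apply: eq_bigr => chi _; apply: eq_bigr => i si; apply: eq_bigr => j sj.
  rewrite !inE negbK in si sj; have ij : i != j by apply: contraNneq sj => <-.
  by apply: eq_bigr => k _; rewrite untransfer_at ?(eqP si) // untransfer_at2 // addrC subrK sj.
rewrite big1 // => i si; rewrite big1 // => j /andP[sj ji]; rewrite big1 // => k _.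
rewrite !inE !negbK in si sj; rewrite eq_sym in ji.
by rewrite untransfer_at ?(eqP si) // untransfer_at2 // (eqP sj) addrC subrK eqxx.
Qed.

Definition phase f chi : F[i] := \prod_i e (chi i) (- f i).

Lemma cabs_phase f chi : cabs (phase f chi) = 1.
Proof.
apply: (@complexI F); rewrite -cabsE normr_prod big1 // => i _.
exact: norm_pair.
Qed.

Lemma phase_untransfer f chi i j k :
  phase f (untransfer chi i j k) = phase f chi * e k (f j - f i).
Proof.
have E l : untransfer chi i j k l = chi l + (if l == i then k else 0) + (if l == j then - k else 0).
  by rewrite ffunE; case: (l == j); rewrite ?subr0 ?addr0.
have P l (c : K) : \prod_x e (if x == l then c else 0) (- f x) = e c (- f l).
  by rewrite (bigD1 l) //= eqxx big1 ?mulr1 // => x /negPf->; rewrite pair0l.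
rewrite /phase; under eq_bigr do rewrite E !pairDl.
rewrite !big_split /= !P -mulrA pairNl -pairNr opprK -pairDr; congr (_ * e _ _).
exact: addrC.
Qed.

Definition term f chi := perm_avg e chi ^+ 3 * phase f chi.

Definition esum f m := \sum_(chi : {ffun G -> K} | #|supp chi| == m) term f chi.

(** Counts ordered pairs of positions, hence equals the sum of the squared fibre sizes of [f]. *)
Definition collisions f : F := \sum_i \sum_j (f i == f j)%:R.

Lemma cabs_esum f m : cabs (esum f m) <= abs_mass e 3 m.
Proof.
apply: le_trans (cabs_sum_le _ _) _; apply: ler_sum => chi _.
by rewrite cabsM cabsX cabs_phase mulr1.
Qed.

Lemma sum_const_le (I : finType) (P : pred I) (c : F) (N : nat) :
  0 <= c -> (#|I| <= N)%N -> \sum_(i | P i) c <= N%:R * c.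
Proof.
move=> c0 IN; rewrite sumr_const -[leLHS]mulr_natl ler_wpM2r // ler_nat.
exact: leq_trans (max_card _) IN.
Qed.

Lemma cancel_bound m :
  \sum_(chi : {ffun G -> K} | #|supp chi| == m.+2) \sum_(i in supp chi)
    \sum_(j in supp chi :\ i | chi i + chi j == 0) cabs (perm_avg e (transfer chi i j)) ^+ 3
  <= nF ^+ 3 * abs_mass e 3 m.
Proof.
rewrite sum_supp2_cancel /abs_mass mulr_sumr; apply: ler_sum => chi _.
have c0 : 0 <= abs_avg e chi ^+ 3 by rewrite exprn_ge0 ?abs_avg_ge0.
have -> : nF ^+ 3 * abs_avg e chi ^+ 3 = nF * (nF * (nF * abs_avg e chi ^+ 3)) by ring.
apply: le_trans (sum_const_le (fun i => i \notin supp chi) _ (leqnn _)); last first.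
  by rewrite mulr_ge0 ?ler0n // mulr_ge0 ?ler0n.
apply: ler_sum => i si.
apply: le_trans (sum_const_le (fun j => (j \notin supp chi) && (j != i)) _ (leqnn _)); last first.
  by rewrite mulr_ge0 ?ler0n.
apply: ler_sum => j /andP[sj ji].
apply: le_trans (sum_const_le (fun k : K => k != 0) c0 _); last by rewrite (card_dual e).
rewrite !inE !negbK in si; rewrite eq_sym in ji.
by apply: ler_sum => k _; rewrite untransferK ?(eqP si).
Qed.

(** The target now lies in the smaller support, so a factor [n] is lost against [cancel_bound]:
    mergers are of lower order. *)
Lemma merge_bound m :
  \sum_(chi : {ffun G -> K} | #|supp chi| == m.+2) \sum_(i in supp chi)
    \sum_(j in supp chi :\ i | chi i + chi j != 0) cabs (perm_avg e (transfer chi i j)) ^+ 3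
  <= m.+1%:R * nF ^+ 2 * abs_mass e 3 m.+1.
Proof.
rewrite sum_supp2_merge /abs_mass mulr_sumr; apply: ler_sum => chi /eqP sm.
have c0 : 0 <= abs_avg e chi ^+ 3 by rewrite exprn_ge0 ?abs_avg_ge0.
have -> : m.+1%:R * nF ^+ 2 * abs_avg e chi ^+ 3 = nF * (m.+1%:R * (nF * abs_avg e chi ^+ 3)) by ring.
apply: le_trans (sum_const_le (fun i => i \notin supp chi) _ (leqnn _)); last first.
  by rewrite mulr_ge0 ?ler0n // mulr_ge0 ?ler0n.
apply: ler_sum => i si.
apply: le_trans (_ : \sum_(j in supp chi) nF * abs_avg e chi ^+ 3 <= _); last first.
  by rewrite sumr_const sm -[leLHS]mulr_natl.
apply: ler_sum => j sj.
apply: le_trans (sum_const_le (fun k : K => (k != 0) && (k != chi j)) c0 _);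
  last by rewrite (card_dual e).
rewrite !inE negbK in si sj; have ij : i != j by apply: contraNneq sj => <-.
by apply: ler_sum => k _; rewrite untransferK ?(eqP si).
Qed.

(** A second cancelling position [l] lies in the smaller support and forces [k = - chi l], so
    summing over [k] yields at most [m] instead of [n]. *)
Lemma double_cancel_bound m :
  \sum_(chi : {ffun G -> K} | #|supp chi| == m.+2) \sum_(i in supp chi)
    \sum_(j in supp chi :\ i | chi i + chi j == 0) cabs (perm_avg e (transfer chi i j)) ^+ 3 *
      #|[set l in supp chi :\ i | (chi i + chi l == 0) && (l != j)]|%:R
  <= m%:R * nF ^+ 2 * abs_mass e 3 m.
Proof.
rewrite sum_supp2_cancel /abs_mass mulr_sumr; apply: ler_sum => chi /eqP sm.
have c0 : 0 <= abs_avg e chi ^+ 3 by rewrite exprn_ge0 ?abs_avg_ge0.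
have -> : m%:R * nF ^+ 2 * abs_avg e chi ^+ 3 = nF * (nF * (m%:R * abs_avg e chi ^+ 3)) by ring.
apply: le_trans (sum_const_le (fun i => i \notin supp chi) _ (leqnn _)); last first.
  by rewrite mulr_ge0 ?ler0n // mulr_ge0 ?ler0n.
apply: ler_sum => i si.
apply: le_trans (sum_const_le (fun j => (j \notin supp chi) && (j != i)) _ (leqnn _)); last first.
  by rewrite mulr_ge0 ?ler0n.
apply: ler_sum => j /andP[sj ji].
rewrite !inE !negbK in si; rewrite eq_sym in ji.
apply: le_trans (_ : \sum_(k | k != 0) abs_avg e chi ^+ 3 *
   #|[set l in supp chi | k + chi l == 0]|%:R <= _).
  apply: ler_sum => k _; rewrite untransferK ?(eqP si) // ler_wpM2l // ler_nat.
  apply: subset_leq_card; apply/subsetP => l; rewrite !inE untransfer_at ?(eqP si) //.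
  rewrite ffunE => /andP[/andP[li cl]] /andP[+ lj].
  by move: cl; rewrite (negPf li) (negPf lj) addr0 subr0 => -> ->.
rewrite -mulr_sumr mulrC ler_wpM2r // -natr_sum ler_nat.
apply: (@leq_trans (\sum_k #|[set l in supp chi | (k + chi l == 0)%R]|)%N).
  by rewrite [X in (_ <= X)%N](bigID (fun k : K => k != 0)) leq_addr.
under eq_bigr do rewrite -sum1dep_card big_mkcondr /=.
rewrite exchange_big /= -sm -sum1_card; apply: leq_sum => l _.
rewrite (bigD1 (- chi l)) //= addNr eqxx big1 // => k kl.
by rewrite addr_eq0 (negPf kl).
Qed.

End Phase.

Section Recursion.
Variables (F : realType) (G K : finZmodType) (e : pairing F[i] G K).
Implicit Types (k : K) (chi g : {ffun G -> K}) (f : {ffun G -> G}).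
Local Notation n := #|G|.
Local Notation E := (expR 1 : F).
Local Notation nF := (n%:R : F).
Local Notation D := (72 * E ^+ 2).
Local Notation "x %:C" := (real_complex F x) (at level 1, format "x %:C").

(** The coefficient with which the term of the smaller [chi] returns once cancelling transfers are
    reindexed. *)
Definition cancel_weight f chi : F[i] := \sum_(i | i \notin supp chi)
  \sum_(j | (j \notin supp chi) && (j != i)) \sum_(k | k != 0) e k (f j - f i).

Lemma collisions_ge0 f : 0 <= collisions F f.
Proof. by apply: sumr_ge0 => i _; apply: sumr_ge0. Qed.

Lemma collisions_le f : collisions F f <= nF ^+ 2.
Proof.
apply: le_trans (_ : \sum_(i : G) \sum_(j : G) (1 : F) <= _).
  by apply: ler_sum => i _; apply: ler_sum => j _; rewrite lern1 leq_b1.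
by rewrite !sumr_const -[leLHS]mulr_natl expr2.
Qed.

(** The sum over [k] is [n - 1] if [f i = f j] and [-1] otherwise. The [-1] and the excluded pairs
    of positions together cost [O(m * n ^ 2)]. *)
Lemma cancel_weight_approx f chi m : #|supp chi| = m ->
  cabs (cancel_weight f chi - (nF * collisions F f)%:C) <= (2 * m.+1)%:R * nF ^+ 2.
Proof.
move=> sm; rewrite -cabsN opprB.
pose A i j := [&& i \notin supp chi, j \notin supp chi & j != i].
have -> : cancel_weight f chi =
    \sum_i \sum_j (A i j)%:R * (n%:R * (f i == f j)%:R - 1).
  rewrite /cancel_weight big_mkcond; apply: eq_bigr => i _; rewrite /A.
  case: (i \notin supp chi) => /=; last by rewrite big1 // => j _; rewrite mul0r.
  rewrite big_mkcond; apply: eq_bigr => j _; case: ifP => _; last by rewrite mul0r.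
  rewrite mul1r; have := sum_pairlE e (f j - f i); rewrite (bigD1 0) //= pair0l.
  by rewrite subr_eq0 [f i == _]eq_sym [n%:R * _]mulrC => <-; rewrite addrC addrK.
have -> : (nF * collisions F f)%:C = \sum_i \sum_j n%:R * (f i == f j)%:R.
  rewrite rmorphM rmorph_nat /= /collisions rmorph_sum mulr_sumr; apply: eq_bigr => i _.
  by rewrite rmorph_sum mulr_sumr; apply: eq_bigr => j _; rewrite rmorph_nat.
rewrite -sumrB; under eq_bigr do rewrite -sumrB.
apply: le_trans (cabs_sum_le _ _) _.
apply: le_trans (_ : \sum_(i : G) \sum_(j : G)
   (nF * ((i \in supp chi)%:R + (j \in supp chi)%:R + (j == i)%:R) + 1) <= _).
  apply: ler_sum => i _; apply: le_trans (cabs_sum_le _ _) _; apply: ler_sum => j _.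
  have [Aij|Aij] := boolP (A i j).
    rewrite mul1r opprB addrC subrK (cabs_nat F 1).
    by rewrite lerDr mulr_ge0 ?addr_ge0 ?ler0n.
  rewrite mul0r subr0 -natrM cabs_nat natrM.
  apply: le_trans (_ : nF * 1 <= _); first by rewrite ler_wpM2l // lern1 leq_b1.
  apply: le_trans (_ : nF * ((i \in supp chi)%:R + (j \in supp chi)%:R + (j == i)%:R) <= _).
    rewrite ler_wpM2l // -!natrD ler1n; move: Aij; rewrite /A !negb_and !negbK.
    by case: (i \in _); case: (j \in _); case: (j == i).
  by rewrite lerDl.
have sS : \sum_(i : G) (i \in supp chi)%:R = m%:R :> F.
  by rewrite -natr_sum -sm -sum1_card [in RHS]big_mkcond.
have -> : \sum_(i : G) \sum_(j : G) (nF * ((i \in supp chi)%:R + (j \in supp chi)%:R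
   + (j == i)%:R) + 1) = \sum_(i : G) (nF * (nF * (i \in supp chi)%:R + m%:R + 1) + nF).
  apply: eq_bigr => i _; rewrite big_split /= sumr_const -mulr_sumr !big_split /= sS.
  rewrite sumr_const (bigD1 i) //= eqxx [\sum_(j | j != i) _]big1 => [|j /negPf-> //].
  by rewrite addr0 -[(i \in supp chi)%:R *+ _]mulr_natl.
rewrite big_split /= -mulr_sumr !big_split /= -mulr_sumr sS !sumr_const.
rewrite -[m%:R *+ _]mulr_natr -[nF *+ _]mulr_natr natrM -[m.+1%:R]natr1.
rewrite le_eqVlt; apply/orP; left; apply/eqP; ring.
Qed.

(** The power of [D] bounds all cubic masses involved. The summands come, in order, from
    [cancel_weight_approx], the three errors of [cube_sum_split], and the replacement of
    [(n - m - 1) ^ 3] by [n ^ 3]. *)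
Definition rec_const m : F :=
  D ^+ m.+2 * ((2 * m.+1)%:R + 7 * m.+1%:R ^+ 3 + 7 * m.+1%:R ^+ 4
     + 2 * m.+1%:R ^+ 4 + 3 * m.+2%:R * m.+1%:R).

(** Cubing [perm_avg_supp] gives [(n - m - 1) ^ 3 * P ^ 3] as minus a cubed transfer sum. Of this
    only the cubes of single cancelling transfers have total order [n ^ 3], and they reproduce the
    terms of size [m] with weight close to [n * collisions F f]. *)
Lemma esum_rec f m (dl : F) : 0 < dl <= 1 -> (2 * m.+2 <= n)%N ->
  cabs (m.+2%:R * esum e f m.+2 + (collisions F f / nF ^+ 2)%:C * esum e f m)
  <= rec_const m * ((1 + dl ^- 2) / nF + dl).
Proof.
move=> dl01 mn; have /andP[d0 d1] := dl01.
have n0 : 0 < nF := nF_gt0 F G.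
set d : F := (n - m).-1%:R.
have dE : d = nF - m.+1%:R by rewrite /d -subnS natrB //; lia.
have Q chi i : #|supp chi| = m.+2 -> i \in supp chi ->
    d%:C * perm_avg e chi = - \sum_(j in supp chi :\ i) perm_avg e (transfer chi i j).
  move=> sm si; rewrite -perm_avg_supp // sm /d rmorph_nat; congr (_%:R * _); lia.
pose T chi i := \sum_(j in supp chi :\ i) perm_avg e (transfer chi i j).
pose U chi i := \sum_(j in supp chi :\ i | chi i + chi j == 0) perm_avg e (transfer chi i j) ^+ 3.
have e1 : (d ^+ 3)%:C * (m.+2%:R * esum e f m.+2) =
    - \sum_(chi : {ffun G -> K} | #|supp chi| == m.+2) \sum_(i in supp chi)
      T chi i ^+ 3 * phase e f chi.
  rewrite -sumrN !mulr_sumr; apply: eq_bigr => chi /eqP sm.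
  rewrite -sumrN; transitivity (\sum_(i in supp chi) (d%:C * perm_avg e chi) ^+ 3 * phase e f chi).
    by rewrite sumr_const sm -[RHS]mulr_natl /term rmorphXn /=; ring.
  by apply: eq_bigr => i si; rewrite (Q chi i sm si) -/(T chi i); ring.
have e2 : \sum_(chi : {ffun G -> K} | #|supp chi| == m.+2) \sum_(i in supp chi)
      U chi i * phase e f chi =
    \sum_(chi : {ffun G -> K} | #|supp chi| == m) term e f chi * cancel_weight f chi.
  under eq_bigr do under eq_bigr do rewrite mulr_suml.
  rewrite sum_supp2_cancel; apply: eq_bigr => chi _; rewrite mulr_sumr.
  apply: eq_bigr => i si; rewrite mulr_sumr; apply: eq_bigr => j /andP[sj ji].
  rewrite !inE !negbK in si; rewrite eq_sym in ji.
  rewrite mulr_sumr; apply: eq_bigr => k _; rewrite untransferK ?(eqP si) //.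
  by rewrite phase_untransfer mulrA.
have A0 j : 0 <= abs_mass e 3 j := abs_mass_ge0 e 3 j.
set N := m.+1.
have b1 : cabs ((d ^+ 3)%:C * (m.+2%:R * esum e f m.+2) +
    \sum_(chi : {ffun G -> K} | #|supp chi| == m) term e f chi * cancel_weight f chi) <=
    7 * dl * N%:R ^+ 3 * (nF ^+ 3 * abs_mass e 3 m) +
    7 / dl ^+ 2 * N%:R ^+ 3 * (m.+1%:R * nF ^+ 2 * abs_mass e 3 m.+1) +
    2 * N%:R ^+ 3 * (m%:R * nF ^+ 2 * abs_mass e 3 m).
  rewrite e1 -e2 -cabsN opprD opprK -sumrB.
  under eq_bigr do rewrite -sumrB.
  apply: le_trans (cabs_sum_le _ _) _.
  apply: le_trans (_ : _ <= 7 * dl * N%:R ^+ 3 * _ + 7 / dl ^+ 2 * N%:R ^+ 3 * _ + 2 * N%:R ^+ 3 * _)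
     (lerD (lerD (ler_wpM2l _ (cancel_bound e m)) (ler_wpM2l _ (merge_bound e m)))
        (ler_wpM2l _ (double_cancel_bound e m))).
  - rewrite !mulr_sumr -!big_split; apply: ler_sum => chi /eqP sm /=.
    rewrite !mulr_sumr -!big_split /=.
    apply: le_trans (cabs_sum_le _ _) _; apply: ler_sum => i si.
    rewrite -mulrBl cabsM cabs_phase mulr1; apply: cube_sum_split => //.
    by have := cardsD1 i (supp chi); rewrite si sm; lia.
  - by rewrite !mulr_ge0 ?exprn_ge0 ?(ltW d0) ?ler0n.
  - by rewrite !mulr_ge0 ?invr_ge0 ?exprn_ge0 ?(ltW d0) ?ler0n.
  - by rewrite !mulr_ge0 ?exprn_ge0 ?ler0n.
have b2 : cabs (\sum_(chi : {ffun G -> K} | #|supp chi| == m) term e f chi * cancel_weight f chi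
    - (nF * collisions F f)%:C * esum e f m) <= (2 * m.+1)%:R * nF ^+ 2 * abs_mass e 3 m.
  have -> : (nF * collisions F f)%:C * esum e f m = \sum_(chi : {ffun G -> K} | #|supp chi| == m)
     (nF * collisions F f)%:C * term e f chi by exact: mulr_sumr.
  rewrite -sumrB; apply: le_trans (cabs_sum_le _ _) _.
  rewrite /abs_mass [leRHS]mulr_sumr.
  apply: ler_sum => chi /eqP sm; rewrite [_ * term _ _ _]mulrC -mulrBr cabsM mulrC.
  rewrite cabsM cabsX cabs_phase mulr1 ler_wpM2r ?exprn_ge0 ?cabs_ge0 //.
  exact: cancel_weight_approx.
have b3 : cabs ((nF ^+ 3 - d ^+ 3)%:C * (m.+2%:R * esum e f m.+2)) <=
    3 * m.+2%:R * m.+1%:R * nF ^+ 2 * abs_mass e 3 m.+2.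
  have m1 : 0 <= m.+1%:R :> F by [].
  have d00 : 0 <= d by [].
  have h0 : 0 <= nF ^+ 3 - d ^+ 3 <= 3 * m.+1%:R * nF ^+ 2.
    have -> : nF ^+ 3 - d ^+ 3 = m.+1%:R * (nF ^+ 2 + nF * d + d ^+ 2).
      by rewrite dE; ring.
    have dn : d <= nF by rewrite dE; lra.
    have dn2 : nF * d <= nF ^+ 2 by rewrite expr2 ler_wpM2l ?(ltW n0).
    have dn3 : d ^+ 2 <= nF ^+ 2 by rewrite lerXn2r ?nnegrE ?(ltW n0).
    have t0 : 0 <= nF * d by rewrite mulr_ge0 ?(ltW n0).
    rewrite mulr_ge0 ?addr_ge0 ?exprn_ge0 ?(ltW n0) //=.
    by rewrite [3 * _]mulrC -mulrA ler_wpM2l //; lra.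
  have /andP[h1 h2] := h0.
  rewrite !cabsM cabs_real cabs_nat ger0_norm //.
  have -> : 3 * m.+2%:R * m.+1%:R * nF ^+ 2 * abs_mass e 3 m.+2 =
    (3 * m.+1%:R * nF ^+ 2) * (m.+2%:R * abs_mass e 3 m.+2) by ring.
  apply: ler_pM; rewrite ?mulr_ge0 ?cabs_ge0 ?ler0n //.
  by rewrite ler_wpM2l ?cabs_esum.
have D1 := D_ge1 F.
have AD j : (j <= m.+2)%N -> abs_mass e 3 j <= D ^+ m.+2.
  move=> jm; apply: le_trans (abs_mass3_le e _) _; first lia.
  by apply: ler_weXn2l.
set L := D ^+ m.+2 in AD *.
have L0 : 0 <= L by rewrite exprn_ge0 //; lra.
have n3 : 0 < nF ^+ 3 by rewrite exprn_gt0.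
rewrite -(ler_pM2l n3).
have -> : nF ^+ 3 * cabs (m.+2%:R * esum e f m.+2 + (collisions F f / nF ^+ 2)%:C * esum e f m) =
   cabs (((d ^+ 3)%:C * (m.+2%:R * esum e f m.+2) +
    \sum_(chi : {ffun G -> K} | #|supp chi| == m) term e f chi * cancel_weight f chi)
    - (\sum_(chi : {ffun G -> K} | #|supp chi| == m) term e f chi * cancel_weight f chi
      - (nF * collisions F f)%:C * esum e f m)
    + (nF ^+ 3 - d ^+ 3)%:C * (m.+2%:R * esum e f m.+2)).
  rewrite -[nF ^+ 3 in LHS]ger0_norm ?(ltW n3) // -cabs_real -cabsM; congr cabs.
  rewrite mulrDr mulrA [(nF ^+ 3)%:C * (collisions F f / _)%:C * _]mulrC.
  rewrite -rmorphM /=; have -> : nF ^+ 3 * (collisions F f / nF ^+ 2) = nF * collisions F f.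
    by field; rewrite gt_eqF.
  by rewrite rmorphB /=; ring.
apply: le_trans (cabsD_le _ _) _.
apply: le_trans (lerD (le_trans (cabsB_le _ _) (lerD b1 b2)) b3) _.
rewrite /rec_const -/L.
have am := AD m (leqW (leqnSn m)); have am1 := AD m.+1 (leqnSn _); have am2 := AD m.+2 (leqnn _).
have -> : nF ^+ 3 * (L * ((2 * m.+1)%:R + 7 * m.+1%:R ^+ 3 + 7 * m.+1%:R ^+ 4
     + 2 * m.+1%:R ^+ 4 + 3 * m.+2%:R * m.+1%:R) * ((1 + dl ^- 2) / nF + dl)) =
   ((2 * m.+1)%:R + 7 * m.+1%:R ^+ 3 + 7 * m.+1%:R ^+ 4
     + 2 * m.+1%:R ^+ 4 + 3 * m.+2%:R * m.+1%:R) *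
     (L * (nF ^+ 2 + dl ^- 2 * nF ^+ 2 + nF ^+ 3 * dl)).
  by field; rewrite ?gt_eqF.
set p := nF ^+ 2; set q := dl ^- 2 * p; set t := nF ^+ 3 * dl.
have p0 : 0 <= p by rewrite exprn_ge0 ?(ltW n0).
have q0 : 0 <= q by rewrite mulr_ge0 // invr_ge0 exprn_ge0 ?(ltW d0).
have t0 : 0 <= t by rewrite mulr_ge0 ?(ltW n3) ?(ltW d0).
have bound (c x a : F) : 0 <= c -> 0 <= x -> x <= p + q + t -> 0 <= a -> a <= L ->
    c * (x * a) <= c * (L * (p + q + t)).
  move=> c0 x0 xle a0 aL; rewrite ler_wpM2l // [L * _]mulrC.
  by apply: ler_pM.
have N0 : 0 <= N%:R :> F by [].
have i1 := fun c0 h => bound (7 * N%:R ^+ 3) t _ c0 t0 h (A0 m) am.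
have i2 := fun c0 h => bound (7 * N%:R ^+ 4) q _ c0 q0 h (A0 m.+1) am1.
have i3 := fun c0 h => bound (2 * N%:R ^+ 4) p _ c0 p0 h (A0 m) am.
have i4 := fun c0 h => bound (2 * m.+1)%:R p _ c0 p0 h (A0 m) am.
have i5 := fun c0 h => bound (3 * m.+2%:R * m.+1%:R) p _ c0 p0 h (A0 m.+2) am2.
have i3' : 2 * N%:R ^+ 3 * (m%:R * p * abs_mass e 3 m) <= 2 * N%:R ^+ 4 * (p * abs_mass e 3 m).
  rewrite [N%:R ^+ 4]exprSr -[m%:R * p * _]mulrA [2 * (_ * _)]mulrA -[leRHS]mulrA.
  by rewrite ler_wpM2l ?mulr_ge0 ?exprn_ge0 // ler_wpM2r ?mulr_ge0 // ler_nat.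
have -> : 7 * dl * N%:R ^+ 3 * (nF ^+ 3 * abs_mass e 3 m) = 7 * N%:R ^+ 3 * (t * abs_mass e 3 m).
  by rewrite /t; ring.
have -> : 7 / dl ^+ 2 * N%:R ^+ 3 * (N%:R * p * abs_mass e 3 N) =
   7 * N%:R ^+ 4 * (q * abs_mass e 3 N) by rewrite /q; ring.
rewrite -[_ * p * abs_mass e 3 m.+2]mulrA -[(2 * m.+1)%:R * p * _]mulrA.
have {}i1 : 7 * N%:R ^+ 3 * (t * abs_mass e 3 m) <= 7 * N%:R ^+ 3 * (L * (p + q + t)).
  by apply: i1; rewrite ?mulr_ge0 ?exprn_ge0 //; lra.
have {}i2 : 7 * N%:R ^+ 4 * (q * abs_mass e 3 N) <= 7 * N%:R ^+ 4 * (L * (p + q + t)).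
  by apply: i2; rewrite ?mulr_ge0 ?exprn_ge0 //; lra.
have {}i3 : 2 * N%:R ^+ 4 * (p * abs_mass e 3 m) <= 2 * N%:R ^+ 4 * (L * (p + q + t)).
  by apply: i3; rewrite ?mulr_ge0 ?exprn_ge0 //; lra.
have {}i4 : (2 * m.+1)%:R * (p * abs_mass e 3 m) <= (2 * m.+1)%:R * (L * (p + q + t)).
  by apply: i4; rewrite ?mulr_ge0 ?exprn_ge0 //; lra.
have {}i5 : 3 * m.+2%:R * m.+1%:R * (p * abs_mass e 3 m.+2) <=
    3 * m.+2%:R * m.+1%:R * (L * (p + q + t)).
  by apply: i5; rewrite ?mulr_ge0 ?exprn_ge0 //; lra.
have {}i3 := le_trans i3' i3.
apply: le_trans (lerD (lerD (lerD (lerD i1 i2) i3) i4) i5) _.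
rewrite le_eqVlt; apply/orP; left; apply/eqP; rewrite /N; ring.
Qed.

End Recursion.

(* The coefficient of [t^m] in [exp (- s t^2)]. *)
Definition expc (F : fieldType) (s : F) m : F :=
  if odd m then 0 else (- s) ^+ m./2 / (m./2`!)%:R.

Definition collision_rate (F : realType) (G : finZmodType) (f : {ffun G -> G}) : F :=
  collisions F f / (2 * #|G|%:R ^+ 2).

(** With [s = collision_rate F f] this is [esum_rec] without its error. *)
Lemma expc_rec (F : realType) (s : F) m : m.+2%:R * expc s m.+2 = - (2 * s * expc s m).
Proof.
rewrite /expc /= negbK; case: (boolP (odd m)) => [_|om]; first by rewrite !mulr0 oppr0.
have -> : m.+2%:R = 2 * (m./2).+1%:R :> F.
  by rewrite -natrM mul2n doubleS even_halfK.
have f0 : (m./2`!)%:R != 0 :> F by rewrite pnatr_eq0 -lt0n fact_gt0.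
have h0 : (m./2).+1%:R != 0 :> F by rewrite pnatr_eq0.
rewrite factS natrM exprS.
move: ((m./2)`!%:R) ((m./2).+1%:R) f0 h0 => a b a0 b0.
by field; rewrite a0 b0.
Qed.

Lemma collision_rate_ge0 (F : realType) (G : finZmodType) (f : {ffun G -> G}) : 0 <= collision_rate F f.
Proof. by rewrite divr_ge0 ?collisions_ge0 // mulr_ge0 ?exprn_ge0 ?ler0n. Qed.

Lemma collision_rate_le (F : realType) (G : finZmodType) (f : {ffun G -> G}) : 2 * collision_rate F f <= 1.
Proof.
have n0 : 0 < #|G|%:R ^+ 2 :> F by rewrite exprn_gt0 // nF_gt0.
have -> : 2 * collision_rate F f = collisions F f / #|G|%:R ^+ 2.
  by rewrite /collision_rate; field; rewrite gt_eqF // nF_gt0.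
rewrite ler_pdivrMr // mul1r.
exact: collisions_le.
Qed.

(** Induction on two consecutive sizes, comparing [esum_rec] with [expc_rec]; size 1 contributes
    nothing. *)
Lemma esum_lim (F : realType) m (eps : F) : 0 < eps ->
  exists N : nat, forall (G K : finZmodType) (e : pairing F[i] G K) (f : {ffun G -> G}),
    (N <= #|G|)%N -> cabs (esum e f m - real_complex F (expc (collision_rate F f) m)) <= eps.
Proof.
suff H i : (forall eps : F, 0 < eps -> exists N : nat,
    forall (G K : finZmodType) (e : pairing F[i] G K) (f : {ffun G -> G}),
    (N <= #|G|)%N -> cabs (esum e f i - real_complex F (expc (collision_rate F f) i)) <= eps) /\
   (forall eps : F, 0 < eps -> exists N : nat,
    forall (G K : finZmodType) (e : pairing F[i] G K) (f : {ffun G -> G}),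
    (N <= #|G|)%N -> cabs (esum e f i.+1 - real_complex F (expc (collision_rate F f) i.+1)) <= eps).
  by case: (H m) => + _; exact.
elim: i => [|i [IH0 IH1]].
  split=> {}eps eps0; exists 0%N => G K e f _.
    rewrite /esum (bigD1 (0 : {ffun G -> K})) /=; last first.
      by apply/eqP/eqP; rewrite cards_eq0; apply/eqP/setP => j; rewrite !inE ffunE eqxx.
    rewrite big1 => [|chi /andP[]]; last first.
      rewrite cards_eq0 => /eqP s0 /eqP[]; apply/ffunP => j; rewrite ffunE.
      by apply/eqP; have := in_set0 j; rewrite -s0 inE => /negbFE.
    rewrite /term perm_avg0 expr1n mul1r /phase big1 => [|j _]; last by rewrite ffunE pair0l.
    by rewrite /expc /= expr0 divr1 rmorph1 addr0 subrr cabs0 ltW.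
  rewrite /expc /= subr0; apply: le_trans (cabs_esum e f 1) _.
  by rewrite abs_mass_1 ltW.
split=> // {IH1} {}eps eps0.
have C0 : 0 <= rec_const F i.
  have D1 := D_ge1 F.
  apply: mulr_ge0; first by rewrite exprn_ge0 //; lra.
  by rewrite !addr_ge0 ?mulr_ge0 ?exprn_ge0.
set C := rec_const F i in C0.
(* [dl] is fixed first; only then is [n] taken large against [dl ^- 2]. *)
have [dl [dl0 dl1 Cdl]] : exists dl : F, [/\ 0 < dl, dl <= 1 & C * dl <= eps / 4].
  exists (Num.min 1 (eps / 4 / (C + 1))).
  have c1 : 0 < C + 1 by lra.
  have e4 : 0 < eps / 4 by lra.
  split; first by rewrite lt_min ltr01 divr_gt0.
    by rewrite ge_min lexx.
  apply: le_trans (_ : (C + 1) * (eps / 4 / (C + 1)) <= _); last by rewrite mulrC divfK ?gt_eqF.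
  apply: ler_pM => //; first by rewrite le_min ler01 divr_ge0 ?ltW.
    by lra.
  by rewrite ge_min lexx orbT.
have eps2 : 0 < eps / 2 by lra.
have [N1 h1] := IH0 (eps / 2) eps2.
pose X := C * (1 + dl ^- 2) * 4 / eps.
have X0 : 0 <= X.
  apply: divr_ge0; last exact: ltW.
  apply: mulr_ge0 => //; apply: mulr_ge0 => //.
  by rewrite addr_ge0 // invr_ge0 exprn_ge0 ?(ltW dl0).
exists (maxn (2 * i.+2) (maxn N1 (Num.bound X))) => G K e f.
rewrite !geq_max => /and3P[ni nN1 nX].
have n0 := nF_gt0 F G.
have dl01 : 0 < dl <= 1 by rewrite dl0 dl1.
have := esum_rec e f dl01 ni; rewrite -/C => hrec.
have {}h1 := h1 G K e f nN1.
set c := collision_rate F f in h1 *.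
have cE : collisions F f / #|G|%:R ^+ 2 = 2 * c by rewrite /c /collision_rate; field; rewrite gt_eqF.
rewrite cE in hrec.
have m1 : 1 <= i.+2%:R :> F by rewrite ler1n.
have m0 : 0 < i.+2%:R :> F by rewrite ltr0n.
apply: le_trans (_ : i.+2%:R * cabs (esum e f i.+2 - real_complex F (expc c i.+2)) <= _).
  by rewrite ler_peMl ?cabs_ge0.
rewrite -(cabs_nat F) -cabsM.
have -> : i.+2%:R * (esum e f i.+2 - real_complex F (expc c i.+2)) =
   (i.+2%:R * esum e f i.+2 + real_complex F (2 * c) * esum e f i)
   - real_complex F (2 * c) * (esum e f i - real_complex F (expc c i)).
  have := congr1 (real_complex F) (expc_rec c i).
  rewrite rmorphM rmorph_nat rmorphN rmorphM /= => hc.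
  by rewrite mulrBr hc; ring.
apply: le_trans (cabsB_le _ _) _.
have c0 : 0 <= 2 * c by rewrite mulr_ge0 ?collision_rate_ge0.
(* Since [2 * c <= 1], the error inherited from size [i] is not amplified. *)
have t2 : cabs (real_complex F (2 * c) * (esum e f i - real_complex F (expc c i))) <= eps / 2.
  rewrite cabsM cabs_real ger0_norm //; apply: le_trans h1.
  by rewrite ler_piMl ?cabs_ge0 ?collision_rate_le.
have t1 : C * ((1 + dl ^- 2) / #|G|%:R + dl) <= eps / 2.
  have : C * (1 + dl ^- 2) / #|G|%:R <= eps / 4.
    rewrite ler_pdivrMr //; apply: le_trans (_ : eps / 4 * X <= _).
      by rewrite /X; rewrite le_eqVlt; apply/orP; left; apply/eqP; field; rewrite !gt_eqF.
    have e4 : 0 <= eps / 4 by lra.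
    rewrite ler_wpM2l //.
    by apply: ltW; apply: lt_le_trans (archi_boundP X0) _; rewrite ler_nat.
  move=> hX; have -> : C * ((1 + dl ^- 2) / #|G|%:R + dl) =
     C * (1 + dl ^- 2) / #|G|%:R + C * dl by ring.
  lra.
lra.
Qed.

(** * Explicit decay once [n] is large *)

Section Tails.
Variable F : realType.
Local Notation E := (expR 1 : F).
Local Notation D := (72 * E ^+ 2).
Local Notation B := (20 ^+ 4 : F).
Local Notation z := (entropy_base F).

Lemma entropy_base_exp m : z ^+ m = expR (m%:R * ln z).
Proof. by rewrite expRM_natl lnK // posrE (lt_trans ltr01) // entropy_base_gt1. Qed.

Lemma ln_entropy_base_gt0 : 0 < ln z.
Proof. by rewrite ln_gt0 // entropy_base_gt1. Qed.

(** The exponent 4 leaves [n ^- 2] after the factor [n ^ 2] of [abs_mass3_entropy], enough to sum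
    over at most [n] sizes. *)
Lemma exp_sqrt_le n : (0 < n)%N -> expR (- Num.sqrt n%:R) <= 8 ^+ 8 / n%:R ^+ 4 :> F.
Proof.
move=> n0; have nF : 0 < n%:R :> F by rewrite ltr0n.
rewrite expRN -[leRHS]invf_div lef_pV2 ?posrE ?expR_gt0 ?divr_gt0 ?exprn_gt0 //.
have -> : Num.sqrt n%:R = 8%:R * (Num.sqrt n%:R / 8) :> F by rewrite mulrC divfK ?pnatr_eq0.
rewrite expRM_natl; apply: le_trans (_ : (Num.sqrt n%:R / 8) ^+ 8 <= _).
  rewrite expr_div_n.
  have -> : Num.sqrt n%:R ^+ 8 = (Num.sqrt n%:R ^+ 2) ^+ 4 :> F by rewrite -exprM.
  by rewrite sqr_sqrtr // ltW.
apply: lerXn2r; rewrite ?nnegrE ?expR_ge0 ?divr_ge0 ?sqrtr_ge0 //.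
by apply: le_trans _ (expR_ge1Dx _); rewrite lerDr.
Qed.

Let Cc : F := 2 * E ^+ 2 * B.

(** Beyond [m ^ 2 = cut * n], the gain [m * ln z] exceeds the loss [Cc * sqrt n] by a further
    [sqrt n]. *)
Let cut : nat := Num.bound (((Cc + 1) / ln z) ^+ 2).

Lemma entropy_base_beats m n : (cut * n <= m ^ 2)%N ->
  expR (Cc * Num.sqrt n%:R) / z ^+ m <= expR (- Num.sqrt n%:R).
Proof.
move=> hm; rewrite entropy_base_exp -expRN -expRD ler_expR.
have l0 := ln_entropy_base_gt0; set s := Num.sqrt n%:R.
have C0 : 0 <= Cc by rewrite !mulr_ge0 ?exprn_ge0 ?expR_ge0.
suff : (Cc + 1) * s <= m%:R * ln z by lra.
rewrite -ler_pdivrMr // mulrAC.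
have q0 : 0 <= (Cc + 1) / ln z by rewrite divr_ge0 ?(ltW l0) // addr_ge0.
rewrite -(@ler_pXn2r _ 2) ?nnegrE ?ler0n //; last by apply: mulr_ge0 => //; exact: sqrtr_ge0.
rewrite exprMn sqr_sqrtr ?ler0n // -natrX.
apply: le_trans (_ : (cut * n)%:R <= _); last by rewrite ler_nat.
by rewrite natrM ler_wpM2r // ltW // archi_boundP // sqr_ge0.
Qed.

Lemma abs_mass3_large (G K : finZmodType) (e : pairing F[i] G K) m :
  (2 * m < #|G|)%N -> (cut * #|G| <= m ^ 2)%N ->
  abs_mass e 3 m <= E ^+ 2 * 8 ^+ 8 / #|G|%:R ^+ 2.
Proof.
move=> mn hm; have n0 := nF_gt0 F G.
have z0 : 0 < z ^+ m by rewrite exprn_gt0 // (lt_trans ltr01) // entropy_base_gt1.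
have := abs_mass3_entropy e mn; rewrite -ler_pdivlMr // => h; apply: le_trans h _.
have zb := entropy_base_beats hm; rewrite /Cc in zb.
rewrite -[leLHS]mulrA; apply: le_trans (ler_wpM2l _ zb) _.
  by rewrite mulr_ge0 ?exprn_ge0 ?expR_ge0 ?ler0n.
apply: le_trans (ler_wpM2l _ (exp_sqrt_le (card_zmod_gt0 G))) _.
  by rewrite mulr_ge0 ?exprn_ge0 ?expR_ge0 ?ler0n.
by rewrite le_eqVlt; apply/orP; left; apply/eqP; field; rewrite gt_eqF.
Qed.

Lemma no_majority_small (G K : finZmodType) (e : pairing F[i] G K) :
  (cut <= #|G|)%N ->
  \sum_(chi : {ffun G -> K} | [forall k, 2 * fiber_card chi k <= #|G|]%N) abs_avg e chi ^+ 3
  <= 8 ^+ 8 / #|G|%:R ^+ 4.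
Proof.
move=> hn; have z0 : 0 < z ^+ #|G| by rewrite exprn_gt0 // (lt_trans ltr01) // entropy_base_gt1.
have := no_majority e; rewrite -ler_pdivlMr // => h; apply: le_trans h _.
apply: le_trans (exp_sqrt_le (card_zmod_gt0 G)).
by apply: entropy_base_beats; rewrite expnS expn1 leq_mul2r hn orbT.
Qed.

Let C2 : F := E ^+ 2 * expR (E ^+ 2 * B).

Let C2_ge1 : 1 <= C2.
Proof.
have e1 : 1 <= E by rewrite ltW // expR_gt1.
rewrite -[leLHS]mulr1; apply: ler_pM => //; first by rewrite exprn_ege1.
by rewrite -[leLHS]expR0 ler_expR mulr_ge0 ?exprn_ge0 ?expR_ge0.
Qed.

Lemma few_values_small (G K : finZmodType) (e : pairing F[i] G K) m :
  (80 <= m)%N -> (2 * m < #|G|)%N -> (m ^ 2 <= cut * #|G|)%N ->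
  C2 ^+ 40 * (16 * cut%:R) ^+ 10 * 2 ^+ 40 <= #|G|%:R ->
  \sum_(chi : {ffun G -> K} | (#|supp chi| == m) && (5 * nvals chi <= m)%N)
     abs_avg e chi ^+ 3 <= 2^-1 ^+ m.
Proof.
move=> m80 mn mcut nbig; have n0 := nF_gt0 F G.
have m0 : (0 < m)%N by lia.
set n := #|G| in mn mcut n0 nbig *.
apply: le_trans (few_values e m0 mn) _; rewrite -/n.
set x : F := Num.sqrt (m%:R / n%:R).
have x0 : 0 <= x by exact: sqrtr_ge0.
have -> : E ^+ 2 * n%:R ^+ 2 * expR (E ^+ 2 * B) = C2 * n%:R ^+ 2 by rewrite /C2; ring.
move: C2 C2_ge1 nbig => c c_ge1 nbig; have c0 : 0 <= c by apply: le_trans c_ge1.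
have n1 : 1 <= n%:R :> F by rewrite ler1n card_zmod_gt0.
have h0 : 0 <= 2^-1 :> F by rewrite invr_ge0.
(* Fortieth powers keep exponents integral: the powers of [n] total at most [80 + 8 * m <= 9 * m] by
   [80 <= m], against [n ^- (10 * m)] from the square root. The remaining [n ^- m] absorbs the
   constants. *)
rewrite -(@ler_pXn2r _ 40) ?nnegrE ?exprn_ge0 //; last first.
  apply: mulr_ge0; first by apply: mulr_ge0 => //; rewrite exprn_ge0 ?(ltW n0).
  by apply: mulr_ge0; rewrite exprn_ge0 ?(ltW n0) // mulr_ge0.
have -> : (c * n%:R ^+ 2 * (n%:R ^+ (m %/ 5) * (2 * x) ^+ m)) ^+ 40 =
   c ^+ 40 * n%:R ^+ 80 * n%:R ^+ (40 * (m %/ 5)) * ((2 * x) ^+ 4) ^+ (10 * m).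
  rewrite -exprM mulnA; move: (m %/ 5)%N (2 * x) => a y.
  by rewrite ![(40 * _)%N]mulnC !exprM; ring.
have x4 : (2 * x) ^+ 4 <= 16 * cut%:R / n%:R.
  have x2 : x ^+ 2 = m%:R / n%:R by rewrite sqr_sqrtr ?divr_ge0 ?ler0n.
  rewrite exprMn; have -> : x ^+ 4 = (x ^+ 2) ^+ 2 by rewrite -exprM.
  rewrite x2.
  have -> : 2 ^+ 4 = 16 :> F by ring.
  rewrite -mulrA ler_wpM2l // expr_div_n ler_pdivrMr ?exprn_gt0 //.
  have -> : cut%:R / n%:R * n%:R ^+ 2 = (cut * n)%:R :> F.
    by rewrite natrM; field; rewrite gt_eqF.
  by rewrite -natrX ler_nat.
have y0 : 0 <= 16 * cut%:R :> F by rewrite mulr_ge0.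
have s1 : ((2 * x) ^+ 4) ^+ (10 * m) <= (16 * cut%:R) ^+ (10 * m) / n%:R ^+ (10 * m).
  rewrite -expr_div_n; apply: lerXn2r; rewrite ?nnegrE ?exprn_ge0 ?mulr_ge0 //.
  by rewrite invr_ge0 ler0n.
have s2 : n%:R ^+ 80 * n%:R ^+ (40 * (m %/ 5)) <= n%:R ^+ (9 * m) :> F.
  rewrite -exprD; apply: ler_weXn2l => //.
  by move: (leq_divM m 5) m80; clear; lia.
have s3 : c ^+ 40 <= c ^+ 40 ^+ m.
  by rewrite -[leLHS]expr1; apply: ler_weXn2l; rewrite ?exprn_ege1.
apply: le_trans (_ : c ^+ 40 ^+ m * n%:R ^+ (9 * m) *
   ((16 * cut%:R) ^+ (10 * m) / n%:R ^+ (10 * m)) <= _).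
  rewrite -[c ^+ 40 * _ * _]mulrA; apply: ler_pM => //.
  - by rewrite !mulr_ge0 ?exprn_ge0 ?(ltW n0).
  - by rewrite exprn_ge0 // exprn_ge0 // mulr_ge0.
  by apply: ler_pM => //; rewrite ?mulr_ge0 ?exprn_ge0 ?(ltW n0).
have -> : c ^+ 40 ^+ m * n%:R ^+ (9 * m) * ((16 * cut%:R) ^+ (10 * m) / n%:R ^+ (10 * m))
   = (c ^+ 40 * (16 * cut%:R) ^+ 10 / n%:R) ^+ m.
  rewrite [RHS]expr_div_n [(c ^+ 40 * (16 * cut%:R) ^+ 10) ^+ m]exprMn.
  rewrite (exprM (16 * cut%:R) 10 m).
  have -> : (10 * m = 9 * m + m)%N by rewrite mulSnr.
  rewrite exprD; have : n%:R ^+ (9 * m) != 0 :> F by rewrite expf_neq0 ?gt_eqF.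
  have : n%:R ^+ m != 0 :> F by rewrite expf_neq0 ?gt_eqF.
  move: (n%:R ^+ m : F) (n%:R ^+ (9 * m) : F) => u v u0 v0.
  by field; rewrite u0 v0.
rewrite -exprM mulnC exprM; apply: lerXn2r; rewrite ?nnegrE ?exprn_ge0 //.
  by rewrite divr_ge0 ?mulr_ge0 ?exprn_ge0 ?(ltW n0).
by rewrite exprVn ler_pdivrMr // [leRHS]mulrC ler_pdivlMr ?exprn_gt0.
Qed.

End Tails.

Lemma sum_half_le (F : realFieldType) M N :
  \sum_(M <= m < N) (2^-1 : F) ^+ m <= 2 * 2^-1 ^+ M.
Proof.
have [MN|NM] := leqP M N; last first.
  by rewrite big_geq ?mulr_ge0 ?exprn_ge0 ?invr_ge0 // ltnW.
have -> : \sum_(M <= m < N) (2^-1 : F) ^+ m =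
    \sum_(M <= m < N) (- (2 * 2^-1 ^+ m.+1) - - (2 * 2^-1 ^+ m)).
  by apply: eq_bigr => m _; rewrite exprS; field.
rewrite telescope_sumr // opprK.
by rewrite gerDr oppr_le0 mulr_ge0 ?exprn_ge0 ?invr_ge0.
Qed.

(** * The tail *)

Section ExpSeries.
Import classical_sets topology normedtype numFieldNormedType.Exports.
Variable F : realType.

Lemma expR_partial (x : F) L : `|x| <= 2^-1 ->
  `|expR x - \sum_(k < L) x ^+ k / (k`!)%:R| <= 2 * 2^-1 ^+ L.
Proof.
move=> x2; apply/ler_addgt0Pr => eps eps0.
have cv : (series (exp_coeff x) @ \oo --> expR x)%classic by exact: is_cvg_series_exp_coeff.
move/cvgrPdist_lt: cv => /(_ eps eps0) cv.
near \oo%classic => N.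
have LN : (L <= N)%N by near: N; exact: nbhs_infty_ge.
have hN : `|expR x - series (exp_coeff x) N| < eps by near: N; exact: cv.
have -> : expR x - \sum_(k < L) x ^+ k / (k`!)%:R =
   (\sum_(L <= k < N) x ^+ k / (k`!)%:R) + (expR x - series (exp_coeff x) N).
  have -> : series (exp_coeff x) N =
      \sum_(k < L) x ^+ k / (k`!)%:R + \sum_(L <= k < N) x ^+ k / (k`!)%:R.
    by rewrite -(big_mkord xpredT (fun k => x ^+ k / (k`!)%:R)) -big_cat_nat.
  by ring.
apply: le_trans (ler_normD _ _) _; apply: lerD; last exact: ltW.
apply: le_trans (sum_half_le F L N).
apply: le_trans (ler_norm_sum _ _ _) _; apply: ler_sum => k _.
rewrite normrM normfV normr_nat normrX.
apply: le_trans (_ : 2^-1 ^+ k / 1 <= _); last by rewrite divr1.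
apply: ler_pM; rewrite ?exprn_ge0 ?invr_ge0 ?ler0n //.
  by apply: lerXn2r; rewrite ?nnegrE ?invr_ge0.
by rewrite lef_pV2 ?posrE ?ltr0n ?fact_gt0 // ler1n fact_gt0.
Unshelve. all: by end_near.
Qed.

End ExpSeries.

Section Tail.
Variable F : realType.
Local Notation E := (expR 1 : F).

Lemma tail_bound : exists M1 N1 : nat, exists2 c : F, 0 <= c &
  forall (G K : finZmodType) (e : pairing F[i] G K) M,
  (M1 <= M)%N -> (N1 <= #|G|)%N ->
  \sum_(M <= m < #|G| | (2 * m < #|G|)%N) abs_mass e 3 m <= 4 * 2^-1 ^+ M + c / #|G|%:R.
Proof.
pose cut := Num.bound (((2 * E ^+ 2 * 20 ^+ 4 + 1) / ln (entropy_base F)) ^+ 2).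
pose big := (E ^+ 2 * expR (E ^+ 2 * 20 ^+ 4)) ^+ 40 * (16 * cut%:R) ^+ 10 * 2 ^+ 40.
pose big2 := (4 * (72 * E ^+ 2)) ^+ 5.
exists (maxn 80 (Num.bound big2)), (Num.bound big), (E ^+ 2 * 8 ^+ 8).
  by rewrite mulr_ge0 ?exprn_ge0 ?expR_ge0.
move=> G K e M; rewrite geq_max => /andP[M80 Mb] Nb.
have n0 := nF_gt0 F G.
have nbig : big <= #|G|%:R.
  apply: ltW; apply: lt_le_trans (archi_boundP _) _; last by rewrite ler_nat; exact: Nb.
  by rewrite /big; apply: mulr_ge0; [apply: mulr_ge0|]; rewrite exprn_ge0 // mulr_ge0 ?exprn_ge0 ?expR_ge0.
have step m : (M <= m)%N -> (2 * m < #|G|)%N ->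
    abs_mass e 3 m <= 2 * 2^-1 ^+ m + E ^+ 2 * 8 ^+ 8 / #|G|%:R ^+ 2.
  move=> Mm mn.
  have [small|large] := leqP (m ^ 2) (cut * #|G|); last first.
    apply: le_trans (abs_mass3_large e mn (ltnW large)) _.
    by rewrite lerDr mulr_ge0 // exprn_ge0 // invr_ge0.
  apply: le_trans (_ : 2 * 2^-1 ^+ m <= _); last first.
    by rewrite lerDl divr_ge0 ?exprn_ge0 ?(ltW n0) // mulr_ge0 ?exprn_ge0 ?expR_ge0.
  have many : big2 <= m%:R.
    apply: ltW; apply: lt_le_trans (archi_boundP _) _; last by rewrite ler_nat; exact: leq_trans Mb Mm.
    by rewrite exprn_ge0 // !mulr_ge0 ?exprn_ge0 ?expR_ge0.
  have h1 := many_values e many (ltnW mn).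
  have h2 := few_values_small e (leq_trans M80 Mm) mn small nbig.
  apply: le_trans (_ : 2^-1 ^+ m + 2^-1 ^+ m <= _); last by rewrite mulr_natl mulr2n.
  apply: le_trans (lerD h1 h2).
  rewrite /abs_mass (bigID (fun chi => m <= 5 * nvals chi)%N) /= lerD2l.
  rewrite big_mkcondr [leRHS]big_mkcondr; apply: ler_sum => chi _.
  have := abs_avg_ge0 e chi; case: leqP => /= h n1.
    by case: ifP => // _; rewrite exprn_ge0.
  by rewrite (ltnW h).
apply: le_trans (_ : \sum_(M <= m < #|G|) (2 * 2^-1 ^+ m + E ^+ 2 * 8 ^+ 8 / #|G|%:R ^+ 2) <= _).
  rewrite big_mkcond big_nat [leRHS]big_nat; apply: ler_sum => m /andP[Mm _].
  case: ifP => [mn|_]; first exact: step.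
  apply: addr_ge0; first by rewrite mulr_ge0 // exprn_ge0 // invr_ge0.
  by rewrite divr_ge0 ?exprn_ge0 ?(ltW n0) // mulr_ge0 ?exprn_ge0 ?expR_ge0.
rewrite big_split /=; apply: lerD.
  rewrite -mulr_sumr; apply: le_trans (ler_wpM2l _ (sum_half_le F M #|G|)) _ => //.
  by rewrite mulrA -natrM.
rewrite sumr_const_nat -[leLHS]mulr_natl.
apply: le_trans (_ : #|G|%:R * (E ^+ 2 * 8 ^+ 8 / #|G|%:R ^+ 2) <= _).
  rewrite ler_wpM2r ?ler_nat ?leq_subr //.
  by rewrite divr_ge0 ?exprn_ge0 ?(ltW n0) // mulr_ge0 ?exprn_ge0 ?expR_ge0.
by rewrite le_eqVlt; apply/orP; left; apply/eqP; field; rewrite gt_eqF.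
Qed.

Lemma sum_expc (s : F) L : \sum_(m < L.*2) expc s m = \sum_(k < L) (- s) ^+ k / (k`!)%:R.
Proof.
elim: L => [|L IH]; first by rewrite !big_ord0.
rewrite doubleS !big_ord_recr /= IH /expc /= odd_double doubleK.
by rewrite addr0.
Qed.

End Tail.

(** * Fourier inversion *)

Definition perm_triples (G : finZmodType) (f : {ffun G -> G}) : nat :=
  #|[set t : {perm G} * {perm G} * {perm G} |
      [forall i, t.1.1 i + t.1.2 i + t.2 i == f i]]|.

Section Fourier.
Variables (F : realType) (G K : finZmodType) (e : pairing F[i] G K).
Implicit Types (k : K) (chi g : {ffun G -> K}) (f : {ffun G -> G}).
Local Notation n := #|G|.

Lemma cube_sum (I : finType) (a : I -> F[i]) :
  (\sum_s a s) ^+ 3 = \sum_(t : I * I * I) a t.1.1 * a t.1.2 * a t.2.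
Proof.
rewrite -(pair_bigA _ (fun p c => a p.1 * a p.2 * a c)) /=.
rewrite -(pair_bigA _ (fun x y => \sum_c a x * a y * a c)) /= !exprS expr0 mulr1.
rewrite mulr_suml; apply: eq_bigr => x _; rewrite mulr_suml mulr_sumr.
by apply: eq_bigr => y _; rewrite mulrA mulr_sumr.
Qed.

Lemma count_fourier f : (perm_triples f)%:R * n%:R ^+ n =
  (n`!)%:R ^+ 3 * \sum_(chi : {ffun G -> K}) term e f chi :> F[i].
Proof.
pose x (t : {perm G} * {perm G} * {perm G}) i := t.1.1 i + t.1.2 i + t.2 i - f i.
  have step (t : {perm G} * {perm G} * {perm G}) : [forall i, t.1.1 i + t.1.2 i + t.2 i == f i]%:R * n%:R ^+ n =
    \sum_(chi : {ffun G -> K}) \prod_i e (chi i) (x t i) :> F[i].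
  rewrite -(bigA_distr_bigA (fun i k => e k (x t i))).
  rewrite (eq_bigr (fun i => (x t i == 0)%:R * n%:R)) => [|i _]; last exact: sum_pairlE.
  rewrite big_split /= prodr_const; congr (_ * _).
  case: forallP => h; last first.
    have /forallPn[i hi] : ~~ [forall i, t.1.1 i + t.1.2 i + t.2 i == f i].
      by apply/negP => /forallP.
    by rewrite (bigD1 i) //= /x subr_eq0 (negPf hi) mul0r.
  by rewrite big1 // => i _; rewrite /x subr_eq0 h.
rewrite /perm_triples -sum1dep_card natr_sum mulr_suml big_mkcond /=.
rewrite (eq_bigr (fun t => \sum_(chi : {ffun G -> K}) \prod_i e (chi i) (x t i))); last first.
  by move=> t _; rewrite -step; case: forallP => _; rewrite ?mul1r ?mul0r.
rewrite exchange_big mulr_sumr; apply: eq_bigr => chi _ /=.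
rewrite /term /perm_avg expr_div_n mulrA [_ ^+ 3 * (_ / _)]mulrC divfK ?expf_neq0 ?fact_neq0 //.
rewrite cube_sum mulr_suml; apply: eq_bigr => t _.
rewrite /phase -!big_split /=; apply: eq_bigr => i _.
by rewrite /x !pairDr.
Qed.

(** With [u = e k (sum of G)], the three averages contribute [u ^ 3] and, by the sum condition, the
    phase contributes the conjugate of [u]. The sum of [G] is its own negative, so [u ^ 2 = 1] and
    everything cancels. *)
Lemma term_trans f chi k : \sum_i f i = \sum_(x : G) x ->
  term e f [ffun i => chi i + k] = term e f chi.
Proof.
move=> sf; have X2 : (\sum_(x : G) x) *+ 2 = 0.
  rewrite mulr2n -[X in X + _]opprK -sumrN [X in - X + _](reindex_inj (@oppr_inj G)).
  by under eq_bigr do rewrite opprK; rewrite addNr.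
rewrite /term perm_avg_trans exprMn /phase.
under [X in _ * X = _]eq_bigr do rewrite ffunE pairDl.
rewrite big_split /= -pair_sumr sumrN sf pairNr.
set u := e k _; have uu : u * u^* = 1 by rewrite -normCK norm_pair expr1n.
have u2 : u ^+ 2 = 1 by rewrite /u expr2 -pairDr -mulr2n X2 pair0r.
transitivity (perm_avg e chi ^+ 3 * (\prod_i e (chi i) (- f i)) * (u ^+ 2 * (u * u^*))).
  by ring.
by rewrite u2 uu !mulr1.
Qed.

Lemma fiber_card_trans chi k l : fiber_card [ffun i => chi i + k] (l + k) = fiber_card chi l.
Proof.
by apply: eq_card => i; rewrite !inE ffunE (inj_eq (addIr k)).
Qed.

(** At most one character can occupy more than half of the positions. Translating it to the trivial
    one preserves the term, and there are [n] choices for it. *)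
Lemma majority_split f : \sum_i f i = \sum_(x : G) x ->
  \sum_(chi : {ffun G -> K}) term e f chi =
  n%:R * \sum_(chi : {ffun G -> K} | (2 * #|supp chi| < n)%N) term e f chi
  + \sum_(chi : {ffun G -> K} | [forall k, 2 * fiber_card chi k <= n]%N) term e f chi.
Proof.
move=> sf; rewrite (bigID (fun chi => [forall k, 2 * fiber_card chi k <= n]%N)) /= addrC.
congr (_ + _).
transitivity (\sum_k \sum_(chi : {ffun G -> K} | (n < 2 * fiber_card chi k)%N) term e f chi).
  rewrite [RHS](exchange_big_dep xpredT) //= big_mkcond; apply: eq_bigr => chi _.
  have [/forallP h|/forallPn[k]] := boolP [forall k, 2 * fiber_card chi k <= n]%N.
    by rewrite big_pred0 // => k; rewrite ltnNge h.
  rewrite -ltnNge => hk; rewrite (bigD1 k) //= big_pred0 ?addr0 // => l.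
  apply/negP => /andP[hl lk].
  have := sum_fiber_card chi; rewrite (bigD1 k) //= (bigD1 l) //=.
  move: hk hl; move: (fiber_card chi k) (fiber_card chi l) (\sum_(_ | _) _)%N #|G| => a b c N.
  by clear; lia.
have -> : n%:R = #|K|%:R :> F[i] by rewrite (card_dual e).
rewrite mulr_natl -sumr_const; apply: eq_bigr => k _.
have inj : injective (fun chi => [ffun i => chi i + k] : {ffun G -> K}).
  move=> chi chi' /ffunP h; apply/ffunP => i; have := h i.
  by rewrite !ffunE => /addIr.
rewrite (reindex_inj inj); apply: eq_big => [chi|chi _]; last exact: term_trans.
rewrite -{2}[k]add0r fiber_card_trans fiber_card0; have := supp_le chi.
by move: #|supp chi| #|G| => a b; clear; lia.
Qed.
End Fourier.

(** * The dual group *)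

Section OrdinalRoot.
Variables (R : fieldType) (m : nat) (z : R).
Hypothesis zN : m.+1.-primitive_root z.
Implicit Types a b : 'I_m.+1.

Lemma root_addE a b : z ^+ (a + b)%R = z ^+ a * z ^+ b.
Proof. by rewrite /= -exprD -[RHS](prim_expr_mod zN). Qed.

Lemma root_inj a b : z ^+ a = z ^+ b -> a = b.
Proof.
move/eqP; rewrite (eq_prim_root_expr zN) => ab; apply/val_inj/eqP; move: ab.
by rewrite !modn_small.
Qed.

Lemma root_eq1 a : (z ^+ a == 1) = (a == 0).
Proof. by rewrite -(inj_eq root_inj) expr0. Qed.

End OrdinalRoot.

Section Dual.
Variable G : finZmodType.
Local Notation T := 'I_#|G|.-1.+1.

Definition homb : {pred {ffun G -> T}} :=
  fun k => [forall x, forall y, k (x + y) == k x + k y].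

Lemma hombP (k : {ffun G -> T}) : reflect {morph k : x y / x + y} (k \in homb).
Proof.
apply: (iffP forallP) => [h x y|h x]; first by have /forallP/(_ y)/eqP := h x.
by apply/forallP => y; rewrite h.
Qed.

Fact homb_zmod_closed : zmod_closed homb.
Proof.
split=> [|k l /hombP hk /hombP hl]; apply/hombP => x y; rewrite !ffunE ?addr0 //.
by rewrite hk hl opprD addrACA.
Qed.
HB.instance Definition _ := GRing.isZmodClosed.Build {ffun G -> T} homb homb_zmod_closed.

(** Characters are stored as exponents of a primitive [n]-th root of unity, that is as homomorphisms
    to the integers modulo [n]. This makes the group finite and independent of the coefficient
    field. *)
Record dual := Dual { dual_fun :> {ffun G -> T}; _ : dual_fun \in homb }.
HB.instance Definition _ := [isSub for dual_fun].
HB.instance Definition _ := [Finite of dual by <:].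
HB.instance Definition _ := [SubChoice_isSubZmodule of dual by <:].


Lemma card_prednK : #|G|.-1.+1 = #|G|.
Proof. by rewrite prednK // card_zmod_gt0. Qed.

(** The irreducible characters of [G] have trivial common kernel and are linear because [G] is
    abelian. They take values in [algC]; recording exponents of a root of unity makes the conclusion
    usable over any field. *)
Lemma dual_separates (x : G) : x != 0 -> exists k : dual, k x != 0.
Proof.
move=> x0.
have abG : abelian [set: G].
  by apply/centsP => u _ v _; rewrite /commute /mulg /= addrC.
have [i xi] : exists i : Iirr [set: G], x \notin cfker 'chi_i.
  apply/existsP; apply: contraNT x0; rewrite negb_exists => /forallP h.
  have : x \in (\bigcap_i cfker 'chi[[set: G]]_i)%g.
    by apply/bigcapP => i _; apply/negPn.
  by rewrite TI_cfker_irr inE.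
have lin : 'chi_i \is a linear_char by apply/char_abelianP.
have [z zN] := C_prim_root_exists (card_zmod_gt0 G).
have root y : {a : T | 'chi_i y = z ^+ a}.
  have y1 : 'chi_i y ^+ #|G| = 1.
    rewrite -lin_charX ?inE // -(cardsT G) expg_cardG ?inE //; exact: lin_char1.
  have [a ->] := prim_rootP zN y1.
  by exists (cast_ord (esym card_prednK) a).
pose k : {ffun G -> T} := [ffun y => sval (root y)].
have kE y : 'chi_i y = z ^+ k y by rewrite ffunE; case: (root y).
have zN' : #|G|.-1.+1.-primitive_root z by rewrite card_prednK.
have kh : k \in homb.
  apply/hombP => u v; apply: (root_inj zN').
  by rewrite (root_addE zN') -!kE -lin_charM ?inE.
exists (Dual kh) => /=; apply: contra xi => /eqP k0.
by rewrite cfkerEchar ?irr_char // !inE (lin_char1 lin) kE k0 expr0 eqxx.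
Qed.

Variables (C : numClosedFieldType) (z : C).
Hypothesis zN : #|G|.-primitive_root z.

Definition dual_pair (k : dual) (x : G) : C := z ^+ k x.

Let zN' : #|G|.-1.+1.-primitive_root z.
Proof. by rewrite card_prednK. Qed.

Lemma dual_pairDl k l x : dual_pair (k + l) x = dual_pair k x * dual_pair l x.
Proof. by rewrite /dual_pair /= ffunE (root_addE zN'). Qed.

Lemma dual_pairDr k x y : dual_pair k (x + y) = dual_pair k x * dual_pair k y.
Proof.
by rewrite /dual_pair; case: k => k kh /=; rewrite (hombP _ kh) (root_addE zN').
Qed.

Lemma norm_dual_pair k x : `|dual_pair k x| = 1.
Proof.
have n1 : `|z| = 1.
  apply: (pexpIrn (card_zmod_gt0 G)); rewrite ?nnegrE ?ler01 //.
  by rewrite -normrX (prim_expr_order zN) normr1 expr1n.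
by rewrite normrX n1 expr1n.
Qed.

Lemma fixed_sum0 (c s : C) : c != 1 -> s = c * s -> s = 0.
Proof.
move=> c1 /esym/eqP; rewrite -subr_eq0 -[X in _ - X]mul1r -mulrBl mulf_eq0.
by rewrite subr_eq0 (negPf c1) => /eqP.
Qed.

Lemma sum_dual_pairr k : k != 0 -> \sum_x dual_pair k x = 0.
Proof.
move=> k0; have [y ky] : exists y, k y != 0.
  apply/existsP; apply: contraNT k0; rewrite negb_exists => /forallP h.
  apply/eqP/val_inj/ffunP => y /=; rewrite ffunE; apply/eqP.
  by have := h y; rewrite negbK.
apply: (@fixed_sum0 (dual_pair k y)); first by rewrite (root_eq1 zN').
rewrite mulr_sumr [LHS](reindex_inj (@addrI _ y)); apply: eq_bigr => x _.
exact: dual_pairDr.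
Qed.

Lemma sum_dual_pairl x : x != 0 -> \sum_k dual_pair k x = 0.
Proof.
move=> /dual_separates[l lx].
apply: (@fixed_sum0 (dual_pair l x)); first by rewrite (root_eq1 zN').
rewrite mulr_sumr [LHS](reindex_inj (@addrI _ l)); apply: eq_bigr => k _.
exact: dual_pairDl.
Qed.

Definition dual_pairing : pairing C G dual :=
  Pairing dual_pairDl dual_pairDr norm_dual_pair sum_dual_pairr sum_dual_pairl.

End Dual.

Lemma pairing_exists (C : numClosedFieldType) (G : finZmodType) :
  exists K : finZmodType, inhabited (pairing C G K).
Proof.
have [z zN] := closed_prim_root C (card_zmod_gt0 G).
by exists (dual G); split; exact: dual_pairing zN.
Qed.

(** * Conclusion *)

Lemma esum_lim_upto (F : realType) L (eps : F) : 0 < eps ->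
  exists N : nat, forall (G K : finZmodType) (e : pairing F[i] G K) (f : {ffun G -> G}) m,
    (m < L)%N -> (N <= #|G|)%N ->
    cabs (esum e f m - real_complex F (expc (collision_rate F f) m)) <= eps.
Proof.
move=> eps0; elim: L => [|L [N hN]]; first by exists 0%N.
have [N' hN'] := esum_lim L eps0; exists (maxn N N') => G K e f m.
rewrite ltnS leq_eqVlt geq_max => /orP[/eqP->|mL] /andP[n1 n2]; first exact: hN'.
exact: hN.
Qed.

Lemma half_pow_le (F : realType) L (eps : F) : 0 < eps ->
  (Num.bound eps^-1 <= L)%N -> 2^-1 ^+ L <= eps.
Proof.
move=> eps0 hL; rewrite exprVn -[leRHS]invrK lef_pV2 ?posrE ?exprn_gt0 ?invr_gt0 //.
apply: ltW; apply: lt_le_trans (archi_boundP _) _; first by rewrite invr_ge0 ltW.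
by rewrite -natrX ler_nat; apply: leq_trans hL _; apply: ltnW; exact: ltn_expl.
Qed.

Lemma div_nat_le (F : realType) (c eps : F) n : 0 <= c -> 0 < eps ->
  (Num.bound (c / eps) <= n)%N -> (0 < n)%N -> c / n%:R <= eps.
Proof.
move=> c0 eps0 hn n0; rewrite ler_pdivrMr ?ltr0n // mulrC -ler_pdivrMr //.
apply: ltW; apply: lt_le_trans (archi_boundP _) _; first by rewrite divr_ge0 // ltW.
by rewrite ler_nat.
Qed.

Section Sparse.
Variables (F : realType) (G K : finZmodType) (e : pairing F[i] G K).
Implicit Types (chi : {ffun G -> K}) (f : {ffun G -> G}).
Local Notation n := #|G|.

Lemma sum_sparse f : \sum_(chi : {ffun G -> K} | (2 * #|supp chi| < n)%N) term e f chi =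
  \sum_(0 <= m < n | (2 * m < n)%N) esum e f m.
Proof.
rewrite big_mkord [RHS](exchange_big_dep xpredT) //= big_mkcond.
apply: eq_bigr => chi _; case: ifP => h; last first.
  by rewrite big_pred0 // => m; apply/negP => /andP[h1 /eqP h2]; rewrite h2 h1 in h.
have hs : (#|supp chi| < n)%N by apply: leq_ltn_trans h; rewrite leq_pmull.
rewrite (big_pred1 (Ordinal hs)) // => m.
by apply/andP/eqP => [[_ /eqP h2]|->]; [exact: val_inj | split].
Qed.

Lemma ratio_fourier f : \sum_i f i = \sum_(x : G) x ->
  real_complex F ((perm_triples f)%:R / ((n`!)%:R ^+ 3 / n%:R ^+ (n - 1))) =
  \sum_(0 <= m < n | (2 * m < n)%N) esum e f m
  + n%:R^-1 * \sum_(chi : {ffun G -> K} | [forall k, 2 * fiber_card chi k <= n]%N) term e f chi.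
Proof.
move=> sf; rewrite -sum_sparse.
have n0 : n%:R != 0 :> F[i] := natn_neq0 _ G.
have f0 : (n`!)%:R != 0 :> F[i] := fact_neq0 _ n.
apply: (mulfI n0); rewrite mulrDr [n%:R * (n%:R^-1 * _)]mulrA divff // mul1r -majority_split //.
apply: (mulfI (expf_neq0 3 f0)); rewrite -count_fourier.
have -> : n%:R ^+ n = n%:R * n%:R ^+ (n - 1) :> F[i].
  by rewrite -exprS; congr (_ ^+ _); have := card_zmod_gt0 G; lia.
rewrite fmorph_div fmorph_div rmorphXn rmorphXn !rmorph_nat /=.
by field; rewrite f0 expf_neq0.
Qed.

End Sparse.

(** Five errors of [eps / 5]: bounded supports, the truncated exponential, two parts of the tail,
    and the terms without majority. All thresholds are fixed before [G] and its pairing. *)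
Lemma perm_triples_asymptotic (F : realType) (eps : F) : 0 < eps ->
  exists N : nat, forall (G : finZmodType) (f : {ffun G -> G}),
    (N <= #|G|)%N -> \sum_i f i = \sum_(x : G) x ->
    `|(perm_triples f)%:R / ((#|G|`!)%:R ^+ 3 / #|G|%:R ^+ (#|G| - 1))
      - expR (- collision_rate F f)| <= eps.
Proof.
move=> eps0; have [M1 [N1 [c c0 tail]]] := tail_bound F.
(* From [2^-L <= eps / 20], the exponential remainder is at most [2 * 2^-L] and the geometric part
   of the tail at most [4 * 2^-L]. *)
pose L := maxn M1 (Num.bound (eps / 20)^-1).
have e5 : 0 < eps / 5 by lra.
have e20 : 0 < eps / 20 by lra.
have L1 : 0 < (L.*2.+1)%:R :> F by rewrite ltr0n.
have [N2 lim] := esum_lim_upto L.*2 (divr_gt0 e5 L1).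
have b0 : 0 <= 8 ^+ 8 :> F by rewrite exprn_ge0.
pose cut := Num.bound (((2 * expR (1 : F) ^+ 2 * 20 ^+ 4 + 1) / ln (entropy_base F)) ^+ 2).
pose N3 := maxn (Num.bound (c / (eps / 5))) (Num.bound (8 ^+ 8 / (eps / 5))).
(* The entry [4 * L + 1] ensures that every [m < 2 * L] satisfies [2 * m < n], so that the head of
   the sum is complete. *)
exists (maxn (maxn N1 N2) (maxn N3 (maxn cut (4 * L).+1))) => G f.
rewrite !geq_max => /andP[/andP[n1 n2] /and3P[/andP[n3 n3'] n4 n5]] sf.
have [K [e]] := pairing_exists F[i] G.
set n := #|G| in n1 n2 n3 n3' n4 n5 *.
have n0 : (0 < n)%N := card_zmod_gt0 G.
have Lh : 2^-1 ^+ L <= eps / 20 by apply: half_pow_le => //; exact: leq_maxr.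
rewrite -cabs_real rmorphB /= (ratio_fourier e sf) -/n.
set s := collision_rate F f.
set nm := \sum_(chi | _) _.
rewrite (big_cat_nat (n := L.*2)) //=; last by rewrite -addnn; lia.
have -> : \sum_(0 <= m < L.*2 | (2 * m < n)%N) esum e f m = \sum_(m < L.*2) esum e f m.
  rewrite big_mkord; apply: eq_bigl => m.
  by move: (ltn_ord m) n5; move: (nat_of_ord m) => {}m; rewrite -addnn; clear; lia.
set sp := \sum_(m < L.*2) esum e f m; set tl := \sum_(L.*2 <= m < n | _) _.
pose ex := \sum_(m < L.*2) expc s m.
have -> : sp + tl + n%:R^-1 * nm - real_complex F (expR (- s)) =
   (sp - real_complex F ex) + real_complex F (ex - expR (- s)) + tl + n%:R^-1 * nm.
  by rewrite rmorphB /=; ring.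
have h1 : cabs (sp - real_complex F ex) <= eps / 5.
  rewrite /ex rmorph_sum -sumrB; apply: le_trans (cabs_sum_le _ _) _.
  apply: le_trans (_ : \sum_(m < L.*2) eps / 5 / (L.*2.+1)%:R <= _).
    by apply: ler_sum => m _; exact: lim.
  rewrite sumr_const card_ord -[leLHS]mulr_natl mulrC mulrAC ler_pdivrMr //.
  by rewrite ler_pM2l // ler_nat.
have s0 : 0 <= s := collision_rate_ge0 F f.
have s1 : `|- s| <= 2^-1.
  by rewrite normrN ger0_norm //; have := collision_rate_le F f; rewrite -/s; lra.
have h2 : cabs (real_complex F (ex - expR (- s))) <= eps / 5.
  rewrite cabs_real distrC /ex sum_expc; apply: le_trans (expR_partial L s1) _.
  by lra.
have h3 : cabs tl <= eps / 5 + eps / 5.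
  apply: le_trans (_ : \sum_(L.*2 <= m < n | (2 * m < n)%N) abs_mass e 3 m <= _).
    apply: (big_ind2 (fun (x : F[i]) (y : F) => cabs x <= y)) => [|x a y b xa yb|m _].
    - by rewrite cabs0.
    - by apply: le_trans (cabsD_le _ _) (lerD xa yb).
    - exact: cabs_esum.
  apply: le_trans (tail G K e L.*2 _ n1) _.
    by rewrite -addnn; apply: leq_trans (leq_addr _ _); exact: leq_maxl.
  apply: lerD; last exact: div_nat_le.
  apply: le_trans (_ : 4 * 2^-1 ^+ L <= _); last by lra.
  rewrite ler_wpM2l // -addnn exprD ler_piMl ?exprn_ge0 ?invr_ge0 //.
  by rewrite exprn_ile1 ?invr_ge0 // invf_le1 // ler1n.
have h4 : cabs (n%:R^-1 * nm) <= eps / 5.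
  have n0F : 0 < n%:R :> F by rewrite ltr0n.
  have n1F : 1 <= n%:R :> F by rewrite ler1n.
  have -> : n%:R^-1 = real_complex F n%:R^-1 by rewrite fmorphV rmorph_nat.
  rewrite cabsM cabs_real ger0_norm ?invr_ge0 ?ler0n //.
  have hnm : cabs nm <= 8 ^+ 8 / n%:R ^+ 4.
    apply: le_trans (cabs_sum_le _ _) _; apply: le_trans (no_majority_small e n4).
    by apply: ler_sum => chi _; rewrite cabsM cabsX cabs_phase mulr1.
  apply: le_trans (_ : 8 ^+ 8 / n%:R <= _); last exact: div_nat_le.
  apply: le_trans (_ : 1 * cabs nm <= _).
    by rewrite ler_wpM2r ?cabs_ge0 // invf_le1.
  rewrite mul1r; apply: le_trans hnm _; rewrite ler_wpM2l //.
  by rewrite lef_pV2 ?posrE ?exprn_gt0 // -[leLHS]expr1; apply: ler_weXn2l.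
apply: le_trans (cabsD_le _ _) _; apply: le_trans (lerD (cabsD_le _ _) h4) _.
apply: le_trans (lerD (lerD (cabsD_le _ _) h3) (lexx _)) _.
apply: le_trans (lerD (lerD (lerD h1 h2) (lexx _)) (lexx _)) _.
lra.
Qed.

(** * Transfer to bijections on ordinals and to the reals of the statement *)

Import Rstruct Rstruct_topology.

Section Transfer.
Variable G : finZmodType.
Implicit Types f : {ffun 'I_#|G| -> G}.

Definition on_group f : {ffun G -> G} := [ffun x => f (enum_rank x)].

Definition listing (s : {perm G}) : {ffun 'I_#|G| -> G} := [ffun i => s (enum_val i)].

Lemma listing_inj : injective listing.
Proof.
move=> s t /ffunP h; apply/permP => x.
by have := h (enum_rank x); rewrite !ffunE enum_rankK.
Qed.

Lemma bijbP (p : {ffun 'I_#|G| -> G}) : reflect (exists s, p = listing s) (bijb p).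
Proof.
apply: (iffP andP) => [[/injectiveP pi _]|[s ->]].
  have si : injective (fun x => p (enum_rank x)) by move=> x y /pi/enum_rank_inj.
  by exists (perm si); apply/ffunP => i; rewrite ffunE permE enum_valK.
split; first by apply/injectiveP => i j; rewrite !ffunE => /perm_inj/enum_val_inj.
apply/forallP => x; apply/existsP; exists (enum_rank (s^-1%g x)).
by rewrite ffunE enum_rankK permKV.
Qed.

Lemma num_triplesE f : num_triples f = perm_triples (on_group f).
Proof.
pose h (t : {perm G} * {perm G} * {perm G}) := (listing t.1.1, listing t.1.2, listing t.2).
have hi : injective h.
  by case=> [[a b] c] [[a' b'] c'] [/listing_inj-> /listing_inj-> /listing_inj->].
rewrite /num_triples /perm_triples -(card_imset _ hi); apply: eq_card => -[[p q] r].
rewrite inE /=; apply/and4P/imsetP => [[/bijbP[a ->] /bijbP[b ->] /bijbP[c ->] /forallP H]|].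
  exists (a, b, c) => //; rewrite inE /=; apply/forallP => x.
  by have := H (enum_rank x); rewrite !ffunE enum_rankK.
case=> [[[a b] c]]; rewrite inE /= => /forallP H [-> -> ->].
split; try by [apply/bijbP; eexists].
by apply/forallP => i; have := H (enum_val i); rewrite !ffunE enum_valK.
Qed.

Lemma sum_on_group f : \sum_x on_group f x = \sum_i f i.
Proof.
rewrite [RHS](reindex _ (onW_bij _ (@enum_rank_bij G))) /=.
by apply: eq_bigr => x _; rewrite ffunE.
Qed.

(** Pairs of positions with equal values are sorted by their common value. *)
Lemma collisions_on_group f : collisions Rdefinitions.R (on_group f) = (fiber_sq_sum f)%:R.
Proof.
rewrite /collisions /fiber_sq_sum natr_sum.
transitivity (\sum_(x : G) \sum_(i : G) \sum_(j : G)
    (on_group f i == x)%:R * (on_group f j == x)%:R : Rdefinitions.R).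
  rewrite [RHS]exchange_big; apply: eq_bigr => i _.
  rewrite [RHS]exchange_big; apply: eq_bigr => j _.
  rewrite (bigD1 (on_group f i)) //= eqxx mul1r eq_sym big1 ?addr0 // => x /negPf.
  by rewrite eq_sym => ->; rewrite mul0r.
apply: eq_bigr => x _.
have -> : Nat.pow #|[set i | f i == x]| 2 = (#|[set i | f i == x]| * #|[set i | f i == x]|)%N.
  by rewrite /= PeanoNat.Nat.mul_1_r.
rewrite natrM -big_distrlr /=.
suff -> : \sum_(i : G) (on_group f i == x)%:R = #|[set i | f i == x]|%:R :> Rdefinitions.R by [].
rewrite -sum1dep_card natr_sum [RHS]big_mkcond /=.
rewrite [RHS](reindex _ (onW_bij _ (@enum_rank_bij G))) /=.
by apply: eq_bigr => y _; rewrite ffunE; case: (_ == x).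
Qed.

Lemma frakSE f : frakS f = expR (- collision_rate Rdefinitions.R (on_group f)).
Proof.
rewrite /frakS RexpE; congr expR.
by rewrite /collision_rate collisions_on_group RoppE RdivE RmultE RpowE IZRposE !INRE.
Qed.

End Transfer.

Lemma main_termE n :
  main_term n = (n`!)%:R ^+ 3 / n%:R ^+ (n - 1) :> Rdefinitions.R.
Proof. by rewrite /main_term RdivE !RpowE !INRE. Qed.


Local Close Scope ring_scope.
From Stdlib Require Import Reals.

(* count = (S(f) + o(1)) * n!^3 / n^(n-1), o(1) uniform in G and f:
   for every eps > 0 there is N such that for all finite abelian G with
   |G| >= N and all admissible f, |count / main_term - S(f)| <= eps. *)
Theorem theorem1p3 :
  forall eps : R, (0 < eps)%R ->
  exists N : nat,
  forall (G : finZmodType) (f : {ffun 'I_#|G| -> G}),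
    (N <= #|G|)%N ->
    sum_cond f ->
    (Rabs (INR (num_triples f) / main_term #|G| - frakS f) <= eps)%R.
Proof.
move=> eps /RltP eps0; have [N hN] := perm_triples_asymptotic eps0.
exists N => G f nN sf; apply/RleP.
rewrite RabsE RminusE RdivE INRE main_termE frakSE num_triplesE.
by apply: hN => //; rewrite sum_on_group.
Qed.
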